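(* Let $\rho$ be the unique real root of $x^3 = x+1$ and let $\lambda^* := \rho^{1/2} + \rho^{-1/2}$ ($\approx 2.01980$). For every real number $\lambda$, the family $\mathcal{G}^\pm(\lambda)$ of signed graphs with smallest eigenvalue at least $-\lambda$ has a finite forbidden subgraph characterization if and only if $\lambda < \lambda^*$.
   Context: A signed graph is a finite simple undirected graph each of whose edges is labeled $+$ or $-$; signed graphs are considered up to (sign-preserving) isomorphism. The eigenvalues of a signed graph $G^\pm$ are those of its signed adjacency matrix, whose $(i,j)$-th entry is $1$ if $ij$ is a positive edge, $-1$ if $ij$ is a negative edge, and $0$ otherwise. All subgraphs are induced and inherit the edge signs. Given a family $\mathcal{G}$ of signed graphs that is closed under taking (induced) subgraphs, a family $\mathcal{F}$ of signed graphs is a forbidden subgraph characterization of $\mathcal{G}$ if $\mathcal{G}$ consists exactly of the signed graphs that do not contain any member of $\mathcal{F}$ as an (induced) subgraph. *)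

(* Defs.v *)
From HB Require Import structures.
From mathcomp Require Import all_boot all_order all_algebra.
From mathcomp Require Import ring lra reals.
Set Implicit Arguments.
Unset Strict Implicit.
Unset Printing Implicit Defensive.
Import Order.TTheory GRing.Theory Num.Theory.
Local Open Scope ring_scope.

(* [sg_label x y] is [None] if [xy] is not an edge, [Some true] if it is a
   positive edge and [Some false] if it is a negative edge. *)
Record sgraph : Type := SGraph {
  sg_vertex :> finType;
  sg_label : sg_vertex -> sg_vertex -> option bool;
  sg_label_sym : forall x y, sg_label x y = sg_label y x;
  sg_label_irrefl : forall x, sg_label x x = None
}.

Definition sg_iso (G H : sgraph) : Prop :=
  exists f : G -> H,
    bijective f /\ forall x y, sg_label (f x) (f y) = sg_label x y.

(* Labels are preserved for all pairs of vertices, so non-edges go to non-edges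
   and [H] is isomorphic to the subgraph of [G] induced on the image of [f]. *)
Definition sg_induced (H G : sgraph) : Prop :=
  exists f : H -> G,
    injective f /\ forall x y, sg_label (f x) (f y) = sg_label x y.

Definition forbidden_characterization (F P : sgraph -> Prop) : Prop :=
  forall G, P G <-> ~ (exists H, F H /\ sg_induced H G).

(* Finitely many members up to isomorphism. *)
Definition finite_family (F : sgraph -> Prop) : Prop :=
  exists (k : nat) (K : 'I_k -> sgraph),
    forall H, F H -> exists i, sg_iso H (K i).

Definition has_finite_forbidden_characterization (P : sgraph -> Prop) : Prop :=
  exists F, finite_family F /\ forbidden_characterization F P.

Definition signed_adjacency (R : realType) (G : sgraph) : 'M[R]_#|G| :=
  \matrix_(i, j) match sg_label (enum_val i) (enum_val j) with
                 | Some true => 1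
                 | Some false => -1
                 | None => 0
                 end.

Definition smallest_eigenvalue (R : realType) (n : nat) (A : 'M[R]_n)
    (mu : R) : Prop :=
  eigenvalue A mu /\ forall nu, eigenvalue A nu -> mu <= nu.

(* The matrix is real symmetric, so a smallest eigenvalue exists as soon as [G]
   has a vertex; the graph without vertices belongs to every family, as needed
   for closure under induced subgraphs. *)
Definition smallest_eigenvalue_family (R : realType) (lambda : R)
    (G : sgraph) : Prop :=
  forall mu, smallest_eigenvalue (signed_adjacency R G) mu -> - lambda <= mu.

Lemma cubic_root_exists_unique (R : realType) :
  exists! rho : R, rho ^+ 3 = rho + 1.
Proof.
pose p : {poly R} := 'X^3 - 'X - 1.
have pE x : p.[x] = x ^+ 3 - x - 1 by rewrite !hornerE.
have gt1 (x : R) : x ^+ 3 = x + 1 -> 1 < x.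
  move=> hx; rewrite ltNge; apply/negP => x1.
  have h1 : 0 <= (x + 1) ^+ 2 by apply: sqr_ge0.
  have h2 : (x + 1) ^+ 2 * (1 - x) = - x ^+ 2 by ring: hx.
  have h3 : 0 <= (x + 1) ^+ 2 * (1 - x) by apply: mulr_ge0 => //; lra.
  have x0 : x = 0.
    by apply/eqP; rewrite -sqrf_eq0 eq_le sqr_ge0 andbT; lra.
  by move: hx; rewrite x0; lra.
have le12 : (1 : R) <= 2 by lra.
have p12 : p.[1] <= 0 <= p.[2] by rewrite !pE; apply/andP; split; lra.
have [rho _ /rootP] := poly_ivt le12 p12; rewrite pE => prho.
have hrho : rho ^+ 3 = rho + 1 by lra.
exists rho; split=> // x hx.
have r1 := gt1 _ hrho; have x1 := gt1 _ hx.
have : (rho - x) * (rho ^+ 2 + rho * x + x ^+ 2 - 1) = 0.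
  transitivity ((rho ^+ 3 - rho) - (x ^+ 3 - x)); first by ring.
  by rewrite hrho hx; ring.
move/eqP; rewrite mulf_eq0 subr_eq0 => /orP[/eqP //|/eqP h].
by exfalso; nra.
Qed.

(* Main.v *)
(* Let [q_l f = l * sum f x ^ 2 + sum (lab x y) * f x * f y]. A signed graph belongs to the family
   iff [q_l] is positive semidefinite, and the family has a finite forbidden subgraph
   characterization iff semidefiniteness on all induced subgraphs of some bounded size implies
   semidefiniteness. Write [l = t + 1 / t] and [s = sqrt rho], so that [s ^ 6 = s ^ 2 + 1].

   For [l >= s + 1 / s] there are locally positive graphs that are not positive. Start from a small
   rooted tree whose pivot at the root (the Schur complement of the form there) lies in
   [[1 / t, 1)]; this is where [t ^ 6 >= t ^ 2 + 1] is needed. Attach cliques one after the other,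
   each as large as possible and rooted at a new vertex, keeping the pivot in that interval. After
   [N] steps the form is positive on every set of [N] vertices, and one last huge clique destroys
   positivity. Large [l] are reduced to [l <= 5 / 2] by attaching a pendant vertex everywhere.

   For [l < s + 1 / s] choose [t < s] with [l < t + 1 / t]. A large connected graph which is positive
   on small sets contains a long geodesic or a large clique attached to any given small connected
   set [W]. Eliminating this tail shows that [q_(t + 1/t) f - (f p) ^ 2 / t] is positive near [W]
   for some vertex [p], and then [A + 2] is a Gram matrix of integer vectors on [W]: these are grown
   one vertex at a time, and because all entries are small integers the approximate 2 x 2 minors
   imply the exact ones. Hence small subgraphs are positive for [q_2]. The same growth, started
   from a long induced path or a large clique, shows that graphs that are minimal not positive for
   [q_2] have bounded size, which settles [l >= 2]. For [l < 2] a large graph contains a large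
   clique, the vectors form a tree with a hub of high degree and branches of bounded size, and [q_l]
   is a sum over the branches; there are finitely many types of branches, so each of them is
   positive if the hub is large enough. *)

Require Import Defs.
From HB Require Import structures.
From mathcomp Require Import all_boot all_order all_algebra.
From mathcomp Require Import ring lra zify.
From mathcomp Require classical_sets.
From mathcomp Require Import boolp reals.
Set Implicit Arguments.
Unset Strict Implicit.
Unset Printing Implicit Defensive.
Import Order.TTheory GRing.Theory Num.Theory.
Local Open Scope ring_scope.

(** * Quadratic forms of signed graphs *)

(** The polynomial [w ^ 3 - w - 1] with [w = t ^ 2] arises on the two sides for different reasons. A
    root with one pendant vertex and one pendant path of length 2 has pivot at least [1 / t] exactly
    when [w ^ 3 >= w + 1], and [1 / t] is what an infinite path costs its neighbour, [t] being the
    larger fixed point of [x = l - 1 / x]; these are the trees [E_n] with [n] tending to infinity.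
    On the other side, a vertex whose integer vector already has norm 2 has a pivot of at most
    [t - 1 / t ^ 3], a vertex not yet reached has pivot [t + 1 / t], and the product of the two is
    below 1 exactly when [w ^ 3 < w + 1]; only then must the integer pairing of the two vanish. The
    form [q_l] itself has no integral structure. This is why everything is compared with [A + 2],
    whose Schur complements stay integral: the excess of [l] over 2 is an error to be kept below the
    distance between integers, and its deficit a multiple of the squared length to be paid for.
    Paying is easy at large distance from 2, but near 2 the function must first be spread out so
    that its image under the vectors becomes short; hence the flows and the branches. *)

Definition lab (G : sgraph) (x y : G) : int :=
  match sg_label x y with Some true => 1 | Some false => -1 | None => 0 end.

Lemma lab_sym (G : sgraph) (x y : G) : lab x y = lab y x.
Proof. by rewrite /lab sg_label_sym. Qed.

Lemma lab_irr (G : sgraph) (x : G) : lab x x = 0.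
Proof. by rewrite /lab sg_label_irrefl. Qed.

Lemma labP (G : sgraph) (x y : G) : [\/ lab x y = 0, lab x y = 1 | lab x y = -1].
Proof.
by rewrite /lab; case: (sg_label x y) => [[]|]; [constructor 2|constructor 3|constructor 1].
Qed.

Definition dl (R : realType) (G : finType) (s : G) : G -> R := fun x => (x == s)%:R.

Lemma sum_dl (R : realType) (G : finType) (s : G) (f : G -> R) :
  \sum_x dl R s x * f x = f s.
Proof.
rewrite (bigD1 s) //= /dl eqxx mul1r big1 ?addr0 // => x /negbTE ->.
by rewrite mul0r.
Qed.

Section Forms.
Variables (R : realType) (G : sgraph).
Implicit Types (l : R) (f g h : G -> R).

Definition bq l f g : R :=
  \sum_x l * f x * g x + \sum_x \sum_y (lab x y)%:~R * f x * g y.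

Definition psd l := forall f, 0 <= bq l f f.
(** Induced subgraphs are treated as supports, so that forms on different vertex sets can be
    compared without changing the type of vertices. *)
Definition psd_on l (U : {set G}) :=
  forall f, (forall x, x \notin U -> f x = 0) -> 0 <= bq l f f.

Lemma bq_ext l f f' g g' : f =1 f' -> g =1 g' -> bq l f g = bq l f' g'.
Proof.
move=> ff gg; rewrite /bq; congr (_ + _); apply: eq_bigr => x _.
  by rewrite ff gg.
by apply: eq_bigr => y _; rewrite ff gg.
Qed.

Lemma bqC l f g : bq l f g = bq l g f.
Proof.
rewrite /bq; congr (_ + _); first by apply: eq_bigr => x _; rewrite -!mulrA [f x * _]mulrC.
rewrite exchange_big; apply: eq_bigr => x _; apply: eq_bigr => y _ /=.
by rewrite lab_sym -!mulrA [f y * _]mulrC.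
Qed.

Lemma bq_linl l (a b : R) f f' g :
  bq l (fun x => a * f x + b * f' x) g = a * bq l f g + b * bq l f' g.
Proof.
rewrite /bq !mulrDr addrACA; congr (_ + _).
  by rewrite !mulr_sumr -big_split /=; apply: eq_bigr => x _; ring.
rewrite !mulr_sumr -big_split /=; apply: eq_bigr => x _.
by rewrite !mulr_sumr -big_split /=; apply: eq_bigr => y _; ring.
Qed.

Lemma bq_linr l (a b : R) f g g' :
  bq l f (fun x => a * g x + b * g' x) = a * bq l f g + b * bq l f g'.
Proof. by rewrite bqC bq_linl ![bq _ _ f]bqC. Qed.

Lemma bq_dl l (s : G) g : bq l (dl R s) g = l * g s + \sum_y (lab s y)%:~R * g y.
Proof.
rewrite /bq; congr (_ + _).
  rewrite -(sum_dl s (fun x => l * g x)); apply: eq_bigr => x _; ring.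
rewrite -(sum_dl s (fun x => \sum_y (lab x y)%:~R * g y)).
apply: eq_bigr => x _; rewrite mulr_sumr; apply: eq_bigr => y _; ring.
Qed.

Lemma bq_expand l f g : bq l f g = \sum_x f x * bq l (dl R x) g.
Proof.
rewrite /bq -big_split /=; apply: eq_bigr => x _.
by rewrite -/(bq l (dl R x) g) bq_dl mulrDr mulr_sumr; congr (_ + _); [|apply: eq_bigr => y _]; ring.
Qed.

Lemma bq_dl2 l (s s' : G) :
  bq l (dl R s) (dl R s') = if s == s' then l else (lab s s')%:~R.
Proof.
rewrite bq_dl; under eq_bigr do rewrite mulrC; rewrite sum_dl /dl.
by case: eqP => [->|_]; rewrite ?lab_irr ?mulr1 ?addr0 ?mulr0 ?add0r.
Qed.

Lemma bq_shift l l' f g : bq l' f g = bq l f g + (l' - l) * \sum_x f x * g x.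
Proof.
rewrite /bq -addrA [X in _ = _ + X]addrC addrA; congr (_ + _).
by rewrite mulr_sumr -big_split /=; apply: eq_bigr => x _; ring.
Qed.

Lemma sumsq_ge0 f : 0 <= \sum_x f x * f x.
Proof. by apply: sumr_ge0 => x _; rewrite -expr2 sqr_ge0. Qed.

Lemma bq_mono l l' f : l <= l' -> bq l f f <= bq l' f f.
Proof.
move=> ll; rewrite (bq_shift l l') lerDl mulr_ge0 ?sumsq_ge0 // subr_ge0 //.
Qed.

Lemma psd_mono l l' : l <= l' -> psd l -> psd l'.
Proof. by move=> ll h f; apply: le_trans (bq_mono f ll). Qed.

Lemma psd_on_mono l l' U : l <= l' -> psd_on l U -> psd_on l' U.
Proof. by move=> ll h f /h hf; apply: le_trans (bq_mono f ll). Qed.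

Lemma psd_on_sub l (U V : {set G}) : U \subset V -> psd_on l V -> psd_on l U.
Proof.
move=> sUV h f hf; apply: h => x xV; apply: hf.
by apply: contra xV => /(subsetP sUV).
Qed.

Lemma psd_onT l : psd_on l [set: G] <-> psd l.
Proof. by split=> h f => [|_]; apply: h => x; rewrite inE. Qed.

End Forms.

Lemma minor2 (R : realType) (A B k : R) :
  (forall x y, 0 <= A * x ^+ 2 + 2 * k * x * y + B * y ^+ 2) -> k ^+ 2 <= A * B.
Proof.
move=> h; have A0 : 0 <= A by have := h 1 0; lra.
have B0 : 0 <= B by have := h 0 1; lra.
have [A_gt|A_le] := ltP 0 A.
  have := h (- k) A; nra.
have A00 : A = 0 by lra.
(* With [A = 0] the value at [(- (B + 1), k)] is [- (B + 2) * k ^ 2], which forces [k = 0]. *)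
rewrite A00 mul0r; have := h (- (B + 1)) k; rewrite A00.
have : 0 <= k ^+ 2 by exact: sqr_ge0.
nra.
Qed.

Section Cauchy.
Variables (R : realType) (G : sgraph) (l : R) (U : {set G}).

Lemma psd_on_minor (f g : G -> R) : psd_on l U ->
  (forall x, x \notin U -> f x = 0) -> (forall x, x \notin U -> g x = 0) ->
  bq l f g ^+ 2 <= bq l f f * bq l g g.
Proof.
move=> h hf hg; apply: minor2 => x y.
have := h (fun z => x * f z + y * g z).
rewrite bq_linl !bq_linr (bqC l g f) => hh.
suff -> : forall A B C : R, A * x ^+ 2 + 2 * C * x * y + B * y ^+ 2 =
  x * (x * A + y * C) + y * (x * C + y * B) by apply: hh => z zU; rewrite hf ?hg // !mulr0 addr0.
by move=> *; ring.
Qed.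
End Cauchy.

(** * Growing integer representations *)

Definition connected (G : sgraph) := forall A : {set G},
  A != set0 -> A != setT -> exists x y, [/\ x \in A, y \notin A & lab x y != 0].

Section Grow.
Variable G : sgraph.
Implicit Types (C : {set G}) (a v w s c : G).

(** The coordinate [Some x] belongs to the vertex [x] and comes into use when [x] enters [C]. [None]
    is a spare coordinate for the starting configuration: the private coordinate of a root, the hub
    of a star or the origin of a path. *)
Definition vec := option G -> int.
Implicit Types (W : G -> vec).

Definition dot (u w : vec) : int := \sum_i u i * w i.

Definition defect W v w : int := (if v == w then 2 else lab v w) - dot (W v) (W w).

Lemma dotC (u w : vec) : dot u w = dot w u.
Proof. by apply: eq_bigr => i _; rewrite mulrC. Qed.

Lemma dot_ge0 (u : vec) : 0 <= dot u u.
Proof. by apply: sumr_ge0 => i _; rewrite -expr2 sqr_ge0. Qed.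

Lemma dot_eq0 (u : vec) : dot u u = 0 -> forall i, u i = 0.
Proof.
move=> /eqP; rewrite /dot psumr_eq0 => [/allP h i|i _]; last by rewrite -expr2 sqr_ge0.
by have := h i (mem_index_enum _); rewrite /= -expr2 sqrf_eq0 => /eqP.
Qed.

Lemma defectC W v w : defect W v w = defect W w v.
Proof. by rewrite /defect dotC eq_sym lab_sym. Qed.

(* [W] assigns integer vectors to the vertices such that the Gram matrix agrees with [A + 2]
   as soon as one of the two arguments lies in [C]; on the other vertices [defect] is then the
   Schur complement of [A + 2], with integer entries. *)
Record growing C W : Prop := Growing {
  gr_supp : forall v i, i \notin C -> W v (Some i) = 0;
  gr_cons : forall v c, c \in C -> defect W v c = 0;
  gr_small : forall s, s \notin C -> 0 <= defect W s s }.

(* A vertex [a] of defect 1 gets a new coordinate of its own, which makes its defects vanish. *)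
Definition step_coef W a v : int := if v == a then 1 else defect W v a.
Definition step W a : G -> vec :=
  fun v i => W v i + step_coef W a v * (i == Some a)%:R.

Lemma step_dot C W a v w : growing C W -> a \notin C ->
  dot (step W a v) (step W a w) =
  dot (W v) (W w) + step_coef W a v * step_coef W a w.
Proof.
move=> gr aC; rewrite /dot (bigD1 (Some a)) //= [in RHS](bigD1 (Some a)) //=.
rewrite /step eqxx !(gr_supp gr _ aC) mulr0 !add0r !mulr1 addrC; congr (_ + _).
by apply: eq_bigr => i /negbTE ->; rewrite !mulr0 !addr0.
Qed.

Lemma step_defect C W a v w : growing C W -> a \notin C -> v != a -> w != a ->
  defect (step W a) v w = defect W v w - defect W v a * defect W w a.
Proof.
move=> gr aC va wa; rewrite {1}/defect (step_dot _ _ gr aC) opprD addrA /step_coef.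
by rewrite (negbTE va) (negbTE wa).
Qed.

Lemma step_defectl C W a v : growing C W -> a \notin C -> defect W a a = 1 ->
  defect (step W a) v a = 0.
Proof.
move=> gr aC a1; rewrite {1}/defect (step_dot _ _ gr aC) /step_coef eqxx mulr1 opprD addrA.
have [->|va] := eqVneq v a; last by rewrite /defect (negbTE va) subrr.
by move: a1; rewrite /defect eqxx => ->; rewrite subrr.
Qed.

Definition pair_test C W := forall s s', s \notin C -> s' \notin C -> s != s' ->
  defect W s s' ^+ 2 <= defect W s s * defect W s' s'.

Lemma step_growing C W a : growing C W -> pair_test C W -> a \notin C ->
  defect W a a = 1 -> growing (a |: C) (step W a).
Proof.
move=> gr pt aC a1; split.
- move=> v i; rewrite in_setU1 negb_or => /andP[ia iC].
  rewrite /step (gr_supp gr _ iC) add0r (_ : (Some i == Some a) = false) ?mulr0 //.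
  by apply/negbTE; apply: contra ia => /eqP [->].
- move=> v c; rewrite in_setU1; have [->|ca] /= := eqVneq c a.
    by move=> _; apply: (step_defectl _ gr).
  move=> cC; have [->|va] := eqVneq v a; first by rewrite defectC; apply: (step_defectl _ gr).
  by rewrite (step_defect gr aC va ca) (gr_cons gr v cC) [defect W c a]defectC
     (gr_cons gr a cC) mulr0 subr0.
- move=> s; rewrite in_setU1 negb_or => /andP[sa sC].
  rewrite (step_defect gr aC sa sa) subr_ge0 -expr2.
  by have := pt _ _ sC aC sa; rewrite a1 mulr1.
Qed.

(* A vertex of defect 2 has the zero vector, so its defects are its labels; the 2 x 2 minors and
   connectedness exclude it once no vertex of defect 1 is left. *)
Theorem grow (P : {set G} -> (G -> vec) -> Prop) :
  (forall C W, growing C W -> P C W -> pair_test C W) ->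
  (forall C W a, growing C W -> P C W -> a \notin C -> defect W a a = 1 ->
     P (a |: C) (step W a)) ->
  connected G -> forall C W, growing C W -> P C W -> C != set0 ->
  exists C' W', [/\ growing C' W', P C' W', C \subset C' &
    forall v w, defect W' v w = 0].
Proof.
move=> Ppt Pstep conn C W; have [n] := ubnP #|~: C|.
elim: n C W => // n IHn C W /ltnSE cardC gr PCW C0.
have pt := Ppt _ _ gr PCW.
case: (pickP [pred a | (a \notin C) && (defect W a a == 1)]) => [a /andP[aC /eqP a1]|none].
  have [||||C' [W' [gr' P' sub' d']]] := IHn (a |: C) (step W a).
  - rewrite (leq_trans _ cardC) // proper_card // properE.
    rewrite setCS subsetUr /=; apply/subsetPn; exists a; rewrite ?inE ?aC //.
    by rewrite eqxx.
  - exact: step_growing.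
  - exact: Pstep.
  - by apply/set0Pn; exists a; rewrite in_setU1 eqxx.
  - by exists C', W'; split=> //; apply: subset_trans sub'; apply: subsetUr.
have dle v : defect W v v <= 2 by rewrite /defect eqxx gerBl dot_ge0.
have d02 s : s \notin C -> defect W s s = 0 \/ defect W s s = 2.
  move=> sC; have := none s; rewrite /= sC /= => /eqP.
  by have := gr_small gr sC; have := dle s; move: (defect W s s) => d; lia.
pose Z := [set s | (s \notin C) && (defect W s s == 2)].
have Z0 : Z = set0.
  apply/eqP; apply/negP => /negP Zn0.
  have ZT : Z != setT.
    apply/negP => /eqP ZT; case/set0Pn: C0 => c cC.
    by have : c \in Z; rewrite ZT inE // => _; have := in_setT c; rewrite -ZT inE cC.
  have [x [y [xZ yZ xy]]] := conn _ Zn0 ZT.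
  move: xZ; rewrite inE => /andP[xC /eqP x2].
  have Wx i : W x i = 0.
    by apply: dot_eq0; move: x2; rewrite /defect eqxx; move: (dot _ _) => d; lia.
  have dxy : defect W x y = 0.
    case yC : (y \in C); first exact: (gr_cons gr).
    have xny : x != y by apply: contraNneq yZ => <-; rewrite inE xC x2 eqxx.
    have [y0|y2] := d02 y (negbT yC); last by rewrite inE yC y2 eqxx in yZ.
    have := pt _ _ xC (negbT yC) xny; rewrite y0 mulr0 => h.
    by apply/eqP; rewrite -sqrf_eq0 eq_le h sqr_ge0.
  have xny : x != y by apply: contraNneq xy => <-; rewrite lab_irr.
  move: dxy; rewrite /defect (negbTE xny) /dot big1 => [|i _]; last by rewrite Wx mul0r.
  by rewrite subr0 => e; rewrite e eqxx in xy.
have d0 s : s \notin C -> defect W s s = 0.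
  move=> sC; have [//|s2] := d02 s sC.
  by have := in_set0 s; rewrite -Z0 inE sC s2 eqxx.
exists C, W; split=> // v w.
case wC : (w \in C); first exact: (gr_cons gr).
case vC : (v \in C); first by rewrite defectC; exact: (gr_cons gr).
have [->|vw] := eqVneq v w; first by rewrite d0 // wC.
have := pt _ _ (negbT vC) (negbT wC) vw; rewrite d0 ?vC // mul0r => h.
by apply/eqP; rewrite -sqrf_eq0 eq_le h sqr_ge0.
Qed.

Section Represent.
Variable R : realType.

Definition img W (u : G -> R) (i : option G) : R := \sum_v u v * (W v i)%:~R.

(** This is [A + 2] written as a Gram matrix plus the matrix of defects; once the defects vanish,
    only squares remain. *)
Lemma bq2_img W (u u' : G -> R) : bq 2 u u' =
  \sum_i img W u i * img W u' i + \sum_v \sum_w u v * u' w * (defect W v w)%:~R.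
Proof.
have -> : \sum_i img W u i * img W u' i =
    \sum_v \sum_w u v * u' w * (dot (W v) (W w))%:~R.
  transitivity (\sum_i \sum_v \sum_w u v * u' w * (W v i * W w i)%:~R).
    apply: eq_bigr => i _; rewrite /img mulr_suml; apply: eq_bigr => v _.
    rewrite mulr_sumr; apply: eq_bigr => w _; rewrite intrM; ring.
  rewrite exchange_big; apply: eq_bigr => v _; rewrite exchange_big /=.
  by apply: eq_bigr => w _; rewrite /dot rmorph_sum /= mulr_sumr.
rewrite -big_split /= /bq -big_split /=; apply: eq_bigr => v _.
rewrite -big_split /= (bigD1 v) //= [in RHS](bigD1 v) //= lab_irr /defect eqxx !mul0r add0r.
congr (_ + _); first by rewrite intrB; ring.
apply: eq_bigr => w wv; rewrite eq_sym (negbTE wv) intrB; ring.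
Qed.

Lemma psd2_represented W : (forall v w, defect W v w = 0) -> @psd R G 2.
Proof.
move=> d0 f; rewrite (bq2_img W) [X in _ + X]big1 ?addr0; last first.
  by move=> v _; rewrite big1 // => w _; rewrite d0 mulr0.
by apply: sumr_ge0 => i _; rewrite -expr2 sqr_ge0.
Qed.
End Represent.
End Grow.

(** * A pendant path forces an integer representation *)

Lemma int_sq3 (R : realType) (d : int) :
  [\/ d = 0, d ^+ 2 = 1 /\ (d%:~R : R) ^+ 2 = 1 | 4 <= (d%:~R : R) ^+ 2].
Proof.
have [->|d0] := eqVneq d 0; first by constructor 1.
have [d1|d1] := eqVneq (d ^+ 2) 1.
  by constructor 2; split=> //; rewrite -rmorphXn /= d1.
constructor 3; rewrite -rmorphXn /= (_ : 4 = (4 : int)%:~R) // ler_int.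
have dn1 : d != 1 by apply: contraNneq d1 => ->.
have dn2 : d != -1 by apply: contraNneq d1 => ->.
have [h|h] : 2 <= d \/ d <= -2 by lia.
  by rewrite expr2; nia.
by rewrite expr2; nia.
Qed.

Lemma int_sqr_lt9 (n : int) : n ^+ 2 < 9 -> n ^+ 2 <= 2 * 2.
Proof.
rewrite expr2 => h; have h1 : -3 < n by nia.
have h2 : n < 3 by nia.
nia.
Qed.

Lemma sqr_normr (R : realType) (x : R) : `|x| ^+ 2 = x ^+ 2.
Proof. by rewrite real_normK ?num_real. Qed.

Lemma norm_le_sqr (R : realType) (x y : R) : 0 <= y -> x ^+ 2 <= y ^+ 2 -> `|x| <= y.
Proof. by move=> y0 h; rewrite -ler_sqr ?nnegrE // sqr_normr. Qed.

Lemma sqr1_norm (R : realType) (y : R) : y ^+ 2 = 1 -> `|y| = 1.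
Proof.
by move=> y1; apply/eqP; rewrite -(@eqrXn2 _ 2) ?ler01 // sqr_normr y1 expr1n.
Qed.

Lemma norm_mul_le (R : realType) (a b A B : R) :
  `|a| <= A -> `|b| <= B -> `|a * b| <= A * B.
Proof. by move=> ha hb; rewrite normrM ler_pM. Qed.

Lemma sqr_lt_of_norm (R : realType) (x e A B : R) :
  `|e| <= A -> `|x + e| <= B -> forall c, A + B < c -> x ^+ 2 < c ^+ 2.
Proof.
rewrite !ler_norml => /andP[e1 e2] /andP[x1 x2] c Ac.
have h1 : x < c by lra.
have h2 : - c < x by lra.
by nra.
Qed.

Lemma sextic_lt (R : realType) (t : R) : 1 < t -> t ^+ 6 <= t ^+ 2 + 1 -> t < 6 / 5.
Proof.
move=> t1 t6; rewrite ltNge; apply/negP => t65.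
have w65 : 36 / 25 <= t ^+ 2 by rewrite expr2; nra.
have e : t ^+ 6 = t ^+ 2 * t ^+ 2 * t ^+ 2 by rewrite -!exprD.
by move: t6; rewrite e; move: (t ^+ 2) w65 => w; nra.
Qed.

(** * Consequences of the sextic inequality *)

Section Threshold.
Variables (R : realType) (t : R).
Hypotheses (t_gt1 : 1 < t) (t6 : t ^+ 6 < t ^+ 2 + 1).
Local Notation u := (t^-1).

Lemma thr_u : [/\ 0 < u, u < 1 & t * u = 1].
Proof.
have t1 := t_gt1; have t0 : 0 < t by lra.
by rewrite invr_gt0 t0 invf_lt1 // t_gt1 divff // gt_eqF.
Qed.

Lemma thr_t : t < 6 / 5.
Proof. exact: sextic_lt t_gt1 (ltW t6). Qed.

Lemma thr_lt : t < 1 + u.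
Proof. by have t1 := t_gt1; have [u0 u1 tu] := thr_u; have := thr_t; nra. Qed.

(* Here [t ^ 6 < t ^ 2 + 1] enters: a vertex of defect 0 and one of defect 2 are orthogonal. *)
Lemma thr_rlam : (t - u ^+ 3) * (t + u) < 1.
Proof.
have t1 := t_gt1; have [u0 u1 tu] := thr_u.
have -> : (t - u ^+ 3) * (t + u) = 1 - u ^+ 4 * (t ^+ 2 + 1 - t ^+ 6).
  by field; lra.
have : 0 < u ^+ 4 * (t ^+ 2 + 1 - t ^+ 6) by rewrite mulr_gt0 ?exprn_gt0 // subr_gt0.
by lra.
Qed.

(** For a vertex of defect 0 and one of defect 1 this bounds the pairing by [u ^ 2]. The pairing
    differs from the integer defect by at most [1 - u ^ 2], so that defect is 0. *)
Lemma thr_rt : (t - u ^+ 3) * t < u ^+ 4.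
Proof.
have t1 := t_gt1; have [u0 u1 tu] := thr_u.
have -> : (t - u ^+ 3) * t = u ^+ 4 - u ^+ 4 * (t ^+ 2 + 1 - t ^+ 6).
  by field; lra.
have : 0 < u ^+ 4 * (t ^+ 2 + 1 - t ^+ 6) by rewrite mulr_gt0 ?exprn_gt0 // subr_gt0.
by lra.
Qed.

(** For two vertices of defect 0, both the pairing and its distance from the integer defect are at
    most [t - u ^ 3]; being below one half, they force that integer to be 0. *)
Lemma thr_r : 2 * (t - u ^+ 3) < 1.
Proof.
have t1 := t_gt1; have [u0 u1 tu] := thr_u; have := thr_rlam.
have : 2 < t + u by nra.
have : u ^+ 3 < 1 by rewrite exprn_ilt1 // ltW.
nra.
Qed.
End Threshold.

Section Key.
Variables (R : realType) (G : sgraph) (p : G) (t : R).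
Hypotheses (t_gt1 : 1 < t) (t6 : t ^+ 6 < t ^+ 2 + 1).
Local Notation u := (t^-1).
Local Notation lam := (t + u).
Local Notation kap := (1 - u).
Local Notation eps := (t + u - 2).
Local Notation r := (t - u ^+ 3).

(* The effect on [q_(t + 1/t)] of eliminating an infinite path attached to [p]. *)
Definition bqt (f g : G -> R) := bq lam f g - u * f p * g p.
Hypothesis bqt_ge0 : forall f, 0 <= bqt f f.

Lemma bqtC f g : bqt f g = bqt g f.
Proof. by rewrite /bqt bqC; ring. Qed.

Lemma bqt_linl a b f f' g :
  bqt (fun x => a * f x + b * f' x) g = a * bqt f g + b * bqt f' g.
Proof. by rewrite /bqt bq_linl; ring. Qed.

Lemma bqt_linr a b f g g' :
  bqt f (fun x => a * g x + b * g' x) = a * bqt f g + b * bqt f g'.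
Proof. by rewrite bqtC bqt_linl ![bqt _ f]bqtC. Qed.

Lemma bqt_minor f g : bqt f g ^+ 2 <= bqt f f * bqt g g.
Proof.
apply: minor2 => x y; have := bqt_ge0 (fun z => x * f z + y * g z).
rewrite bqt_linl !bqt_linr (bqtC g f).
by move=> h; apply: le_trans h _; rewrite le_eqVlt; apply/orP; left; apply/eqP; ring.
Qed.

(** Absorbing [a] adds two coordinates to the residuals: [(a, true)] holds the difference between
    the integer defect and the real coefficient of the elimination, and [(a, false)] that
    coefficient itself, weighted by the excess [eps] of the diagonal [t + u] over 2. *)
Definition vecE := (G * bool)%type -> R.
Definition wt (b : bool) : R := if b then 1 else eps.
Definition K (x y : vecE) : R := \sum_i wt i.2 * x i * y i.

Lemma eps_ge0 : 0 <= eps.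
Proof. have t1 := t_gt1; have [u0 u1 tu] := thr_u t_gt1; nra. Qed.

Lemma KC x y : K x y = K y x.
Proof. by apply: eq_bigr => i _; ring. Qed.

Lemma K_ext x x' y y' : x =1 x' -> y =1 y' -> K x y = K x' y'.
Proof. by move=> hx hy; apply: eq_bigr => i _; rewrite hx hy. Qed.

Lemma K_linl a b x x' y :
  K (fun i => a * x i + b * x' i) y = a * K x y + b * K x' y.
Proof. by rewrite /K !mulr_sumr -big_split /=; apply: eq_bigr => i _; ring. Qed.

Lemma K_linr a b x y y' :
  K x (fun i => a * y i + b * y' i) = a * K x y + b * K x y'.
Proof. by rewrite KC K_linl ![K _ x]KC. Qed.

Lemma K_scalel a x y : K (fun i => a * x i) y = a * K x y.
Proof. by rewrite /K mulr_sumr; apply: eq_bigr => i _; ring. Qed.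

Lemma K_scaler a x y : K x (fun i => a * y i) = a * K x y.
Proof. by rewrite KC K_scalel KC. Qed.

Lemma K_ge0 x : 0 <= K x x.
Proof.
apply: sumr_ge0 => -[i c] _; rewrite -mulrA -expr2 mulr_ge0 ?sqr_ge0 //.
by rewrite /wt /=; case: c; rewrite ?ler01 ?eps_ge0.
Qed.

Lemma K_minor x y : K x y ^+ 2 <= K x x * K y y.
Proof.
apply: minor2 => a b.
have : 0 <= K (fun i => a * x i + b * y i) (fun i => a * x i + b * y i).
  exact: K_ge0.
rewrite K_linl !K_linr (KC y x).
by move=> h; apply: le_trans h _; rewrite le_eqVlt; apply/orP; left; apply/eqP; ring.
Qed.

Definition ins (a : G) (x : vecE) (b c : R) : vecE :=
  fun i => x i + (if i.1 == a then if i.2 then b else c else 0).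

Lemma K_ins a x y b c b' c' : (forall d, x (a, d) = 0) -> (forall d, y (a, d) = 0) ->
  K (ins a x b c) (ins a y b' c') = K x y + b * b' + eps * c * c'.
Proof.
move=> hx hy; rewrite /K.
rewrite (bigD1 (a, true)) // [in RHS](bigD1 (a, true)) //=.
have ft : (a, false) != (a, true) by rewrite xpair_eqE andbF.
rewrite (bigD1 (a, false)) //= [in RHS](bigD1 (a, false)) //=.
rewrite /ins /= !eqxx !hx !hy /wt.
have -> : \sum_(i | (i != (a, true)) && (i != (a, false)))
   (if i.2 then 1 else eps) * (x i + (if i.1 == a then if i.2 then b else c else 0)) *
    (y i + (if i.1 == a then if i.2 then b' else c' else 0)) =
  \sum_(i | (i != (a, true)) && (i != (a, false))) (if i.2 then 1 else eps) * x i * y i.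
  apply: eq_bigr => -[i d] /= /andP[h1 h2].
  suff /negbTE -> : i != a by rewrite !addr0.
  by apply/negP => /eqP ia; move: h1 h2; rewrite ia; case: d; rewrite eqxx.
ring.
Qed.

Lemma K_insl a x y b c : (forall d, x (a, d) = 0) -> (forall d, y (a, d) = 0) ->
  K (ins a x b c) y = K x y.
Proof.
move=> hx hy; have -> : K (ins a x b c) y = K (ins a x b c) (ins a y 0 0).
  by apply: K_ext => // i; rewrite /ins; case: (i.1 == a) => //; case: i.2; rewrite addr0.
by rewrite K_ins // !mulr0 !addr0.
Qed.

(* [z s] realizes the defects up to [eps] on the diagonal and the Gram matrix of the residuals
   [res s]. These residuals stay so small that the 2 x 2 minors of [bqt] still force the
   inequality [d ^ 2 <= n n'] between the integer defects. *)
Record key_data (C : {set G}) (W : G -> vec G) (z : G -> G -> R) (res rho : G -> vecE) : Prop := KeyData {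
  kd_res0 : forall s i, s \notin C -> i.1 \notin C -> res s i = 0;
  kd_rho0 : forall c i, c \in C -> i.1 \notin C -> rho c i = 0;
  kd_gram : forall s s', s \notin C -> s' \notin C -> bqt (z s) (z s') =
    (defect W s s')%:~R + (s == s')%:R * eps + K (res s) (res s');
  kd_rr : forall c, c \in C -> K (rho c) (rho c) = kap;
  kd_rd : forall c d, c \in C -> d \in C -> c != d -> `|K (rho c) (rho d)| <= kap * u;
  kd_0 : forall s, s \notin C -> defect W s s = 2 -> forall i, res s i = 0;
  kd_1 : forall s, s \notin C -> defect W s s = 1 ->
    exists c (y : R), [/\ c \in C, y ^+ 2 = 1 & forall i, res s i = y * rho c i];
  kd_2 : forall s, s \notin C -> defect W s s = 0 -> K (res s) (res s) <= r - eps /\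
    forall b, b \in C -> `|K (res s) (rho b)| <= kap + kap * u }.

Definition key_state (C : {set G}) (W : G -> vec G) := exists z res rho, key_data C W z res rho.

Let u_facts : [/\ 0 < u, u < 1 & t * u = 1] := thr_u t_gt1.
Let t_lt : t < 6 / 5 := thr_t t_gt1 t6.
Let t_lt1u : t < 1 + u := thr_lt t_gt1 t6.
Let rlam : r * lam < 1 := thr_rlam t_gt1 t6.
Let rt : r * t < u ^+ 4 := thr_rt t_gt1 t6.
Let r2 : 2 * r < 1 := thr_r t_gt1 t6.

Lemma defect012 (C : {set G}) (W : G -> vec G) s : growing C W -> s \notin C ->
  [\/ defect W s s = 0, defect W s s = 1 | defect W s s = 2].
Proof.
move=> gr sC; have d0 := gr_small gr sC.
have : defect W s s <= 2 by rewrite /defect eqxx gerBl dot_ge0.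
move: d0; case: (defect W s s) => [[|[|[|n]]]|n] //= _ h.
- by constructor 1.
- by constructor 2.
- by constructor 3.
Qed.

Lemma key_self C W z res rho s : growing C W -> key_data C W z res rho -> s \notin C ->
  [/\ defect W s s = 2 -> bqt (z s) (z s) = lam,
      defect W s s = 1 -> bqt (z s) (z s) = t /\ K (res s) (res s) = kap &
      defect W s s = 0 -> bqt (z s) (z s) <= r].
Proof.
move=> gr kd sC; have q := kd_gram kd sC sC; rewrite eqxx mul1r in q; split.
- move=> d2; rewrite q d2 /K big1 ?addr0 //; first by ring.
  by move=> i _; rewrite (kd_0 kd sC d2) mulr0.
- move=> d1; have [c [y [cC y1 hres]]] := kd_1 kd sC d1.
  have Kk : K (res s) (res s) = kap.
    rewrite (K_ext hres hres) K_scalel K_scaler mulrA -expr2 y1 mul1r.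
    exact: (kd_rr kd).
  by rewrite q d1 Kk; split=> //; ring.
- move=> d0; have [h _] := kd_2 kd sC d0.
  by rewrite q d0 /=; lra.
Qed.

Lemma rho_le C W z res rho : key_data C W z res rho ->
  forall c d, c \in C -> d \in C -> `|K (rho c) (rho d)| <= kap.
Proof.
move=> kd c d cC dC; have t1 := t_gt1; have [u0 u1 tu] := u_facts.
have [->|cd] := eqVneq c d.
  by rewrite (kd_rr kd) // ger0_norm //; lra.
by apply: le_trans (kd_rd kd cC dC cd) _; nra.
Qed.

(** The pairing of [z s] and [z s'] is the integer defect plus the error [e]. The minor bounds the
    pairing, the key data bound [e], and the two bounds together stay below the first integer that
    violates the exact minor. *)
Lemma key_pair_test C W : growing C W -> key_state C W -> pair_test C W.
Proof.
move=> gr [z [res [rho kd]]].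
have t1 := t_gt1; have [u0 u1 tu] := u_facts.
have tl := t_lt; have tlu := t_lt1u; have rl := rlam; have rt' := rt; have r2' := r2.
have main s s' : s \notin C -> s' \notin C -> s != s' ->
    defect W s s <= defect W s' s' -> defect W s s' ^+ 2 <= defect W s s * defect W s' s'.
  move=> sC s'C ss' le.
  have [a2 a1 a0] := key_self gr kd sC; have [b2 b1 b0] := key_self gr kd s'C.
  have mn := bqt_minor (z s) (z s').
  rewrite (kd_gram kd sC s'C) (negbTE ss') mul0r addr0 in mn.
  have As := bqt_ge0 (z s); have Bs := bqt_ge0 (z s').
  have res0 : defect W s' s' = 2 -> K (res s) (res s') = 0.
    by move=> d2; rewrite /K big1 // => i _; rewrite (kd_0 kd s'C d2) mulr0.
  have lam1 : lam < 9 / 4 by lra.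
  have lam0 : 2 < lam by nra.
  move: mn; set d := defect W s s'; set e := K _ _ => mn.
  have dcase := int_sq3 R d; move: dcase mn; set x : R := d%:~R => dcase mn.
  (* Six cases remain, with defects (0,0), (0,1), (0,2), (1,1), (1,2) and (2,2). Whenever a defect
     is 2, its vertex has no residual and [e = 0]. *)
  have [ds|ds|ds] := defect012 gr sC; have [ds'|ds'|ds'] := defect012 gr s'C; move: le;
    rewrite ds ds' // => _.
  - have [hA _] := kd_2 kd sC ds; have [hB _] := kd_2 kd s'C ds'.
    have hA' := a0 ds; have hB' := b0 ds'.
    have := K_minor (res s) (res s'); rewrite -/e => hK.
    have KA0 := K_ge0 (res s); have KB0 := K_ge0 (res s').
    have e0 := eps_ge0.
    have er : e ^+ 2 <= r ^+ 2.
      apply: le_trans hK _; rewrite expr2; apply: ler_pM => //; lra.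
    have xr : (x + e) ^+ 2 <= r ^+ 2.
      by apply: le_trans mn _; rewrite expr2; apply: ler_pM.
    have r0 : 0 <= r by lra.
    have e1 : `|e| <= r by apply: norm_le_sqr.
    have x1 : `|x + e| <= r by apply: norm_le_sqr.
    have xb : x ^+ 2 < 1.
      by rewrite -(expr1n _ 2); apply: sqr_lt_of_norm e1 x1 _ _; lra.
    by case: dcase => [->|[_ h]|h]; [rewrite expr0n mul0r|exfalso; lra|exfalso; lra].
  - have [_ hA] := kd_2 kd sC ds; have [hB hKB] := b1 ds'.
    have [c [y [cC y1 hres]]] := kd_1 kd s'C ds'.
    have eb : `|e| <= kap + kap * u.
      have -> : e = y * K (res s) (rho c).
        by rewrite /e (K_ext (y := res s') (fun=> erefl) hres) K_scaler.
      by rewrite normrM (sqr1_norm y1) mul1r; apply: hA.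
    have hA' := a0 ds.
    have xr : (x + e) ^+ 2 < u ^+ 4.
      by apply: le_lt_trans mn _; rewrite hB; apply: le_lt_trans rt; rewrite ler_pM2r //; lra.
    have eb' : kap + kap * u = 1 - u ^+ 2 by ring.
    rewrite eb' in eb.
    have uu : u ^+ 4 = (u ^+ 2) ^+ 2 by rewrite -exprM.
    have x1 : `|x + e| < u ^+ 2.
      by rewrite -ltr_sqr ?nnegrE ?sqr_ge0 // sqr_normr -uu.
    have xb : x ^+ 2 < 1.
      have := le_lt_trans (ler_normB (x + e) e) (ltr_leD x1 eb).
      rewrite addrK (_ : u ^+ 2 + (1 - u ^+ 2) = 1); last by ring.
      by rewrite -sqr_normr => h; rewrite exprn_ilt1.
    by case: dcase => [->|[_ h]|h]; [rewrite expr0n mul0r|exfalso; lra|exfalso; lra].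
  - have e0 : e = 0 by apply: res0.
    have hA' := a0 ds; have hB' := b2 ds'.
    have xb : x ^+ 2 < 1.
      move: mn; rewrite e0 addr0 hB' => mn; apply: le_lt_trans mn _.
      by apply: le_lt_trans rlam; rewrite ler_pM2r //; lra.
    by case: dcase => [->|[_ h]|h]; [rewrite expr0n mul0r|exfalso; lra|exfalso; lra].
  - have [hA _] := a1 ds; have [hB _] := b1 ds'.
    have [c [y [cC y1 hres]]] := kd_1 kd s'C ds'.
    have [c' [y' [cC' y1' hres']]] := kd_1 kd sC ds.
    have e1 : `|e| <= kap.
      rewrite /e (K_ext hres' hres) K_scaler K_scalel !normrM.
      by rewrite (sqr1_norm y1) (sqr1_norm y1') !mul1r; apply: (rho_le kd).
    have x1 : `|x + e| <= t.
      by apply: norm_le_sqr; [lra|rewrite [leRHS]expr2 -{1}hA -hB].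
    have xb : x ^+ 2 < 2 ^+ 2 by apply: sqr_lt_of_norm e1 x1 _ _; lra.
    rewrite (_ : 2 ^+ 2 = 4) in xb; last by rewrite expr2; lra.
    by case: dcase => [->|[-> h]|h]; [rewrite expr0n|rewrite mulr1|exfalso; lra].
  - have e0 : e = 0 by apply: res0.
    have [hA _] := a1 ds; have hB := b2 ds'.
    have xb : x ^+ 2 < 4.
      move: mn; rewrite e0 addr0 hA hB => mn; apply: le_lt_trans mn _; nra.
    by case: dcase => [->|[-> h]|h]; [rewrite expr0n|rewrite mul1r|exfalso; lra].
  - have e0 : e = 0 by apply: res0.
    have hA := a2 ds; have hB := b2 ds'.
    have xb : x ^+ 2 < 9.
      move: mn; rewrite e0 addr0 hA hB => mn; apply: le_lt_trans mn _; nra.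
    apply: int_sqr_lt9.
    by rewrite -(ltr_int R) rmorphXn.
move=> s s' sC s'C ss'; case/orP: (le_total (defect W s s) (defect W s' s')) => h.
  exact: main.
by rewrite defectC mulrC; apply: main => //; rewrite eq_sym.
Qed.
End Key.

Section StepNumerics.
Variables (R : realType) (u y s k : R).
Hypotheses (u0 : 0 < u) (u1 : u < 1) (y1 : y ^+ 2 = 1) (s1 : s ^+ 2 = 1) (k1 : k ^+ 2 = 1).

(** The case in which both vertices have the same residual up to sign: [X] factors out, with a
    multiplier of absolute value at most [1 + u ^ 2 <= 1 + u]. *)
Lemma step_bound_eq (X : R) : `|X| <= 1 - u ->
  `|y * X - (k + y * s * (1 - u)) * u * (s * X)| <= (1 - u) + (1 - u) * u.
Proof.
move=> hX; have := u0; have := u1 => h1 h0.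
have -> : y * X - (k + y * s * (1 - u)) * u * (s * X) =
    X * (y * (1 - s ^+ 2 * (1 - u) * u) - (k * s) * u) by ring.
have -> : (1 - u) + (1 - u) * u = (1 - u) * (1 + u) by ring.
apply: norm_mul_le => //; rewrite s1 mul1r.
apply: le_trans (ler_normB _ _) _; rewrite !normrM (sqr1_norm y1) (sqr1_norm s1) (sqr1_norm k1).
by rewrite !mul1r (ger0_norm (ltW h0)) ger0_norm; nra.
Qed.

(** The case of two different residuals: a third one coincides with at most one of them, so only one
    of [X] and [Y] can have the full size [1 - u], and the other bound carries a factor [u]. *)
Lemma step_bound_neq (E X Y A B : R) : `|E| <= (1 - u) * u -> `|X| <= A -> `|Y| <= B ->
  (A = 1 - u /\ B = (1 - u) * u) \/ (A = (1 - u) * u /\ B = 1 - u) ->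
  `|y * X - (k + y * s * E) * u * (s * Y)| <= (1 - u) + (1 - u) * u.
Proof.
move=> hE hX hY hAB; have := u0; have := u1 => h1 h0.
apply: le_trans (ler_normB _ _) _; rewrite normrM (sqr1_norm y1) mul1r.
have h : `|(k + y * s * E) * u * (s * Y)| <= (1 + (1 - u) * u) * u * B.
  apply: norm_mul_le; last by rewrite normrM (sqr1_norm s1) mul1r.
  apply: norm_mul_le; last by rewrite ger0_norm // ltW.
  apply: le_trans (ler_normD _ _) _; rewrite (sqr1_norm k1) lerD2l.
  by rewrite !normrM (sqr1_norm y1) (sqr1_norm s1) !mul1r.
apply: le_trans (lerD hX h) _.
have hu : (1 + (1 - u) * u) * u <= 1.
  have : 0 <= (1 - u) * (1 - u) * (1 + u) by rewrite !mulr_ge0 //; lra.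
  by lra.
case: hAB => -[-> ->].
  by rewrite lerD2l -[leRHS]mul1r ler_wpM2r // mulr_ge0 //; lra.
rewrite addrC lerD2r -[leRHS]mul1r ler_wpM2r //; lra.
Qed.
End StepNumerics.

Section KeyStep.
Variables (R : realType) (G : sgraph) (p : G) (t : R).
Hypotheses (t_gt1 : 1 < t) (t6 : t ^+ 6 < t ^+ 2 + 1).
Local Notation u := (t^-1).
Local Notation lam := (t + u).
Local Notation kap := (1 - u).
Local Notation eps := (t + u - 2).
Local Notation r := (t - u ^+ 3).
Hypothesis bqt_ge0 : forall f, 0 <= bqt p t f f.

Lemma key_step (C : {set G}) W a : growing C W -> key_state p t C W -> a \notin C ->
  defect W a a = 1 -> key_state p t (a |: C) (step W a).
Proof.
move=> gr [z [res [rho kd]]] aC a1.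
have t1 := t_gt1; have [u0 u1 tu] := thr_u t_gt1.
pose k s : R := (defect W s a)%:~R; pose e s := K t (res s) (res a).
(* Exact elimination divides the pairing [k s + e s] by the norm [t] of [z a]. When the integer
   defect with [a] is 0 the pairing is pure error, and [z s] is left alone so that its residual does
   not change. *)
pose gm s : R := if defect W s a == 0 then 0 else (k s + e s) * u.
pose z' s := fun x => 1 * z s x + (- gm s) * z a x.
pose base s : vecE R G := fun i => 1 * res s i + (- gm s) * res a i.
pose res' s := ins a (base s) (k s - gm s) (- gm s).
(* A vertex of defect 2 has zero residual, so each one that drops to defect 1 in this step receives
   [k s] times this vector. *)
pose rhoa := ins a (fun i => (- u) * res a i) kap (- u).
pose rho' c := if c == a then rhoa else rho c.
have resa s : s \notin C -> forall d, res s (a, d) = 0.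
  by move=> sC d; apply: (kd_res0 kd).
have rhoa0 c : c \in C -> forall d, rho c (a, d) = 0.
  by move=> cC d; apply: (kd_rho0 kd).
have basea s : s \notin C -> forall d, base s (a, d) = 0.
  by move=> sC d; rewrite /base !resa // !mulr0 addr0.
have notaC s : s \notin a |: C -> (s == a) = false /\ s \notin C.
  by rewrite in_setU1 negb_or => /andP[/negbTE].
have [_ self1 _] := key_self gr kd aC; have [Qaa Kaa] := self1 a1.
have [b [sg [bC sg1 resab]]] := kd_1 kd aC a1.
have Kbase s s' : K t (base s) (base s') =
    K t (res s) (res s') - gm s' * e s - gm s * e s' + gm s * gm s' * kap.
  rewrite /base K_linl !K_linr Kaa (KC _ (res a)) /e; ring.
have k0e s : s \notin C -> defect W s s = 2 -> e s = 0.
  by move=> sC d2; rewrite /e /K big1 // => i _; rewrite (kd_0 kd sC d2) mulr0 mul0r.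
have gm0 s : defect W s a = 0 -> gm s = 0 by rewrite /gm => ->.
have k0 s : defect W s a = 0 -> k s = 0 by rewrite /k => ->.
have gm1 s : defect W s a ^+ 2 = 1 -> gm s = (k s + e s) * u.
  by rewrite /gm; case: eqP => // ->.
have k1 s : defect W s a ^+ 2 = 1 -> k s ^+ 2 = 1.
  by move=> h; rewrite /k -rmorphXn /= h.
have dstep s : s \notin a |: C ->
    defect (step W a) s s = defect W s s - defect W s a ^+ 2.
  by move=> /notaC [sa sC]; rewrite (step_defect gr aC) ?sa // expr2.
have sq_cases s : s \notin a |: C -> [\/ defect W s a = 0 |
    defect W s a ^+ 2 = 1 /\ (defect W s s = 1 \/ defect W s s = 2)].
  move=> /notaC [sa sC].
  have := key_pair_test t_gt1 t6 bqt_ge0 gr (ex_intro _ z (ex_intro _ res (ex_intro _ rho kd))).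
  move=> /(_ s a sC aC (negbT sa)); rewrite a1 mulr1 => h.
  have [d0|d1|d2] := int_sq3 R (defect W s a); first by constructor 1.
    case: d1 => d1 _; constructor 2; split=> //; rewrite d1 in h.
    by case: (defect012 gr sC) h => ->; [|left|right].
  have d4 : 4 <= defect W s a ^+ 2 by rewrite -(ler_int R) rmorphXn.
  by have := le_trans d4 h; case: (defect012 gr sC) => ->.
exists z', res', rho'; split.
- move=> s i /notaC [sa sC]; rewrite in_setU1 negb_or => /andP[ia iC].
  by rewrite /res' /ins /base (negbTE ia) !(kd_res0 kd) // !mulr0 !addr0.
- move=> c i; rewrite in_setU1 /rho' [i.1 \in _]in_setU1 negb_or => cC /andP[ia iC].
  case: ifP cC => [_ _|_ /= cC]; last exact: (kd_rho0 kd).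
  by rewrite /rhoa /ins (negbTE ia) (kd_res0 kd) // mulr0 addr0.
- move=> s s' /notaC [sa sC] /notaC [s'a s'C].
  rewrite (step_defect gr aC) ?sa ?s'a // intrB intrM -/(k s) -/(k s').
  rewrite /res' (K_ins _ _ _ _ _ (basea _ sC) (basea _ s'C)) Kbase /z'.
  rewrite bqt_linl !bqt_linr (bqtC _ _ (z a) (z s')).
  rewrite (kd_gram kd sC s'C) (kd_gram kd sC aC) (kd_gram kd s'C aC) (kd_gram kd aC aC).
  by rewrite sa s'a eqxx a1 Kaa -/(k s) -/(k s') -/(e s) -/(e s') /=; ring.
- move=> c; rewrite in_setU1 /rho'; case: eqP => [_ _|_ /= cC]; last exact: (kd_rr kd).
  have h0 d : (- u) * res a (a, d) = 0 by rewrite resa // mulr0.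
  rewrite /rhoa K_ins // K_scalel K_scaler Kaa.
  have uu : u * t = 1 by rewrite mulrC.
  transitivity (kap - u * (1 - u * t)); first by ring.
  by rewrite uu subrr mulr0 subr0.
- have rd d : d \in C -> `|K t rhoa (rho d)| <= kap * u.
    move=> dC; have h0 f : (- u) * res a (a, f) = 0 by rewrite resa // mulr0.
    rewrite /rhoa (K_insl _ _ _ h0 (rhoa0 _ dC)) K_scalel (K_ext _ resab (fun=> erefl)) K_scalel.
    rewrite !normrM normrN (sqr1_norm sg1) mul1r (ger0_norm (ltW u0)) mulrC ler_wpM2r ?(ltW u0) //.
    exact: (rho_le t_gt1 kd).
  move=> c d; rewrite !in_setU1 /rho'.
  case: (eqVneq c a) => [->|ca] /=; case: (eqVneq d a) => [->|da] //=.
  - by move=> _ dC _; apply: rd.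
  - by move=> cC _ _; rewrite KC; apply: rd.
  - by move=> cC dC; apply: (kd_rd kd).
- move=> s sC; rewrite dstep //; have [sa sC'] := notaC _ sC => d2 i.
  have d0 : defect W s a = 0.
    by case: (sq_cases _ sC) => // -[h [h'|h']]; rewrite h h' in d2.
  have s2 : defect W s s = 2 by move: d2; rewrite d0 expr0n subr0.
  rewrite /res' /ins /base gm0 // k0 // (kd_0 kd sC' s2) !(oppr0, mul0r, mulr0, addr0).
  by repeat case: ifP => _; rewrite ?addr0.
- move=> s sC; rewrite dstep //; have [sa sC'] := notaC _ sC => d1.
  case: (sq_cases _ sC) => [d0|[h [h'|h']]].
  + have s1 : defect W s s = 1 by move: d1; rewrite d0 expr0n subr0.
    have [c [y [cC y1 hres]]] := kd_1 kd sC' s1.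
    exists c, y; split=> //; first by rewrite in_setU1 cC orbT.
    have ca : c != a by apply: contraNneq aC => <-.
    move=> i; rewrite /rho' (negbTE ca) -hres /res' /ins /base gm0 // k0 // !(oppr0, mul0r, mul1r, addr0).
    by repeat case: ifP => _; rewrite ?addr0.
  + by rewrite h h' in d1.
  + exists a, (k s); split; [by rewrite in_setU1 eqxx|exact: k1|].
    move=> i; rewrite /rho' eqxx /rhoa /res' /ins /base gm1 // k0e // (kd_0 kd sC' h').
    by repeat case: ifP => _; ring.
- move=> s sC; rewrite dstep //; have [sa sC'] := notaC _ sC => d0s.
  have h0 f : (- u) * res a (a, f) = 0 by rewrite resa // mulr0.
  have Kres' : K t (res' s) (res' s) =
      K t (base s) (base s) + (k s - gm s) ^+ 2 + eps * gm s ^+ 2.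
    by rewrite /res' (K_ins _ _ _ _ _ (basea _ sC') (basea _ sC')); ring.
  have Krho d : d \in C -> K t (res' s) (rho d) =
      K t (res s) (rho d) - gm s * (sg * K t (rho b) (rho d)).
    move=> dC; rewrite /res' (K_insl _ _ _ (basea _ sC') (rhoa0 _ dC)) /base K_linl mul1r.
    by rewrite (K_ext _ resab (fun=> erefl)) K_scalel; ring.
  have Krhoa : K t (res' s) rhoa = kap * k s - e s * u.
    rewrite /res' /rhoa (K_ins _ _ _ _ _ (basea _ sC') h0) K_scaler /base K_linl Kaa -/(e s).
    have uu : u * t = 1 by rewrite mulrC.
    transitivity (kap * k s - e s * u - gm s * (1 - u * t)); first by ring.
    by rewrite uu subrr mulr0 subr0.
  case: (sq_cases _ sC) => [d0|[h [h'|h']]].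
  + have s0 : defect W s s = 0 by move: d0s; rewrite d0 expr0n subr0.
    have [hK hb] := kd_2 kd sC' s0.
    rewrite Kres' Kbase gm0 // k0 //; split; first by lra.
    move=> d; rewrite in_setU1 /rho'; case: eqP => [_ _|_ /= dC].
      rewrite Krhoa k0 // /e KC (K_ext _ resab (fun=> erefl)) K_scalel KC.
      rewrite mulr0 sub0r normrN !normrM (sqr1_norm sg1) mul1r (ger0_norm (ltW u0)).
      apply: le_trans (hb _ bC); rewrite ler_piMr // ltW //.
    by rewrite Krho // gm0 // mul0r subr0; apply: hb.
  + have [c [y [cC y1 hres]]] := kd_1 kd sC' h'.
    have ks1 := k1 _ h.
    have es : e s = y * sg * K t (rho c) (rho b).
      by rewrite /e (K_ext _ hres resab) K_scalel K_scaler mulrA.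
    have es_le : `|e s| <= kap.
      by rewrite es !normrM (sqr1_norm y1) (sqr1_norm sg1) !mul1r; apply: (rho_le t_gt1 kd).
    have Ks : K t (res s) (res s) = kap by have [_ q _] := key_self gr kd sC'; have [] := q h'.
    split.
      rewrite Kres' Kbase Ks gm1 //.
      have -> : kap - (k s + e s) * u * e s - (k s + e s) * u * e s +
         (k s + e s) * u * ((k s + e s) * u) * kap +
         (k s - (k s + e s) * u) ^+ 2 + eps * ((k s + e s) * u) ^+ 2 =
         kap + k s ^+ 2 - (k s + e s) ^+ 2 * u * (2 - t * u).
        ring.
      rewrite tu ks1.
      (* From [|e s| <= kap] the pairing has absolute value at least [1 - kap = u]. The worst case
         gives [2 - u - u ^ 3 = r - eps], which is the origin of [r]. *)
      have : u ^+ 2 <= (k s + e s) ^+ 2.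
        rewrite -[leRHS]sqr_normr ler_sqr ?nnegrE ?(ltW u0) //.
        have := lerB_normD (k s) (e s); rewrite (sqr1_norm ks1); lra.
      by rewrite exprS => hu; nra.
    move=> d; rewrite in_setU1 /rho'; case: (eqVneq d a) => [_ _|_ /= dC].
      rewrite Krhoa; apply: le_trans (ler_normB _ _) _.
      rewrite !normrM (sqr1_norm ks1) mulr1 (ger0_norm (ltW u0)) ger0_norm; last by lra.
      by rewrite lerD2l ler_wpM2r // ltW.
    rewrite Krho // gm1 // (K_ext _ hres (fun=> erefl)) K_scalel.
    have [cb|cb] := eqVneq c b.
      by rewrite es cb (kd_rr kd bC); apply: step_bound_eq => //; apply: (rho_le t_gt1 kd).
    rewrite es; have [dc|dc] := eqVneq d c.
      apply: (@step_bound_neq _ _ _ _ _ u0 u1 y1 sg1 ks1 _ _ _ kap (kap * u)).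
      * exact: (kd_rd kd).
      * exact: (rho_le t_gt1 kd).
      * by rewrite dc KC; apply: (kd_rd kd).
      * by left.
    apply: (@step_bound_neq _ _ _ _ _ u0 u1 y1 sg1 ks1 _ _ _ (kap * u) kap).
    * exact: (kd_rd kd).
    * by apply: (kd_rd kd) => //; rewrite eq_sym.
    * exact: (rho_le t_gt1 kd).
    * by right.
  + by rewrite h h' in d0s.
Qed.
End KeyStep.

Section KeyMain.
Variables (R : realType) (G : sgraph) (p : G) (t : R).
Hypotheses (t_gt1 : 1 < t) (t6 : t ^+ 6 < t ^+ 2 + 1).
Local Notation u := (t^-1).
Local Notation lam := (t + u).
Local Notation kap := (1 - u).
Hypothesis bqt_ge0 : forall f, 0 <= bqt p t f f.

Let coef (v : G) : int := if v == p then 1 else lab v p.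
(** The root needs norm 2 while its products with the neighbours are only 1 in size; hence one
    coordinate shared with the neighbours and the private coordinate [None]. *)
Let W0 (v : G) : vec G := fun i =>
  match i with Some x => if x == p then coef v else 0 | None => (v == p)%:R end.

Lemma root_dot v w : dot (W0 v) (W0 w) = coef v * coef w + (v == p)%:R * (w == p)%:R.
Proof.
rewrite /dot (bigD1 (Some p)) //= (bigD1 None) //= eqxx big1 ?addr0 //.
case=> [x|] //= /andP[xp _]; rewrite (_ : (x == p) = false) ?mul0r //.
by apply/negbTE; apply: contra xp => /eqP ->.
Qed.

Lemma root_growing : growing [set p] W0.
Proof.
split.
- by move=> v i; rewrite inE /= => /negbTE ->.
- move=> v c; rewrite inE => /eqP ->; rewrite /defect root_dot /coef eqxx.
  by case: (eqVneq v p) => // vp; rewrite mulr1 mul0r addr0 subrr.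
- move=> s; rewrite inE => sp; rewrite /defect root_dot eqxx /coef (negbTE sp) mul0r addr0.
  by case: (labP s p) => ->.
Qed.

Lemma root_state : key_state p t [set p] W0.
Proof.
have t1 := t_gt1; have [u0 u1 tu] := thr_u t_gt1.
pose a s : R := (lab s p)%:~R.
(* Elimination of the root, whose diagonal entry in [bqt] is [t]. It removes [u * a s * a s'] where
   the integer step removes [a s * a s']; the surplus [kap * a s * a s'] is the Gram matrix of the
   residuals. *)
pose z (s : G) := fun x => 1 * dl R s x + (- (a s * u)) * dl R p x.
pose rp : vecE R G := fun i => if i == (p, true) then Num.sqrt kap else 0.
pose res s : vecE R G := fun i => a s * rp i.
have krp : K t rp rp = kap.
  rewrite /K (bigD1 (p, true)) //= big1 => [|i ip]; last by rewrite /rp (negbTE ip) mulr0.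
  by rewrite /rp eqxx /wt mul1r addr0 -expr2 sqr_sqrtr // subr_ge0 ltW.
have kres s s' : K t (res s) (res s') = a s * a s' * kap.
  by rewrite /res K_scalel K_scaler krp mulrA.
exists z, res, (fun=> rp); split.
- move=> s i _; rewrite inE /res /rp => ip.
  by case: eqP => [e|]; rewrite ?mulr0 //; rewrite e eqxx in ip.
- move=> c i _; rewrite inE /rp => ip.
  by case: eqP => [e|] //; rewrite e eqxx in ip.
- move=> s s'; rewrite !inE => sp s'p.
  rewrite kres /z bqt_linl !bqt_linr /bqt !bq_dl2.
  rewrite eqxx /defect root_dot /coef (negbTE sp) (negbTE s'p).
  rewrite /dl ?eqxx ?[p == _]eq_sym ?(negbTE sp) ?(negbTE s'p) (lab_sym p s') -/(a s) -/(a s').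
  rewrite mul0r addr0 intrB intrM -/(a s) -/(a s').
  have uu : u * t = 1 by rewrite mulrC.
  case: (eqVneq s s') => _ /=.
    transitivity (2 - a s * a s' + 1 * (t + u - 2) + a s * a s' * (1 - u) + a s * a s' * u * (u * t - 1)); first ring.
    by rewrite uu subrr mulr0 addr0.
  transitivity ((lab s s')%:~R - a s * a s' + 0 * (t + u - 2) + a s * a s' * (1 - u) + a s * a s' * u * (u * t - 1)); first ring.
  by rewrite uu subrr mulr0 addr0.
- by [].
- by move=> c d; rewrite !inE => /eqP -> /eqP ->; rewrite eqxx.
- move=> s; rewrite inE => sp; rewrite /defect root_dot eqxx /coef (negbTE sp) mul0r addr0.
  by move=> d2 i; rewrite /res /a; case: (labP s p) d2 => -> d2 //; rewrite mul0r.
- move=> s; rewrite inE => sp; rewrite /defect root_dot eqxx /coef (negbTE sp) mul0r addr0.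
  move=> d1; exists p, (a s); split; rewrite ?inE //.
  by rewrite /a; case: (labP s p) d1 => -> // _; rewrite ?expr1n // sqrrN expr1n.
- move=> s; rewrite inE => sp; rewrite /defect root_dot eqxx /coef (negbTE sp) mul0r addr0.
  by case: (labP s p) => ->.
Qed.

Theorem tailed_psd2 : connected G -> @psd R G 2.
Proof.
move=> conn.
have [|C [W [_ _ _ d0]]] := grow (key_pair_test t_gt1 t6 bqt_ge0)
  (key_step t_gt1 t6 bqt_ge0) conn root_growing root_state.
  by apply/set0Pn; exists p; rewrite inE.
exact: psd2_represented d0.
Qed.
End KeyMain.

(** * Induced subgraphs, critical graphs and geodesics *)

Section Embedding.
Variables (R : realType) (H G : sgraph) (phi : H -> G).
Hypotheses (phi_inj : injective phi)
  (phi_lab : forall x y, sg_label (phi x) (phi y) = sg_label x y).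

Definition push (f : H -> R) : G -> R := fun x => \sum_(y | phi y == x) f y.

Lemma push_phi f y : push f (phi y) = f y.
Proof.
rewrite /push (big_pred1 y) // => z; apply/eqP/eqP => [/phi_inj //|->] //.
Qed.

Lemma sum_push f (g : G -> R) : \sum_x push f x * g x = \sum_y f y * g (phi y).
Proof.
rewrite [RHS](partition_big phi predT) //=; apply: eq_bigr => x _.
by rewrite /push mulr_suml; apply: eq_bigr => y /eqP ->.
Qed.

Lemma bq_push l f g : bq l (push f) (push g) = bq l f g.
Proof.
rewrite /bq; congr (_ + _).
  transitivity (\sum_x push f x * (l * push g x)); first by apply: eq_bigr => x _; ring.
  by rewrite sum_push; apply: eq_bigr => y _; rewrite push_phi; ring.
transitivity (\sum_x push f x * (\sum_y push g y * (lab x y)%:~R)).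
  by apply: eq_bigr => x _; rewrite mulr_sumr; apply: eq_bigr => y _; ring.
rewrite sum_push; apply: eq_bigr => x _.
rewrite (sum_push g (fun y => (lab (phi x) y)%:~R)) mulr_sumr.
by apply: eq_bigr => y _; rewrite /lab phi_lab; ring.
Qed.

Lemma push0 f (U : {set H}) : (forall x, x \notin U -> f x = 0) ->
  forall x, x \notin phi @: U -> push f x = 0.
Proof.
move=> hf x xU; rewrite /push big1 // => y /eqP yx; apply: hf.
by apply: contra xU => yU; rewrite -yx imset_f.
Qed.

Lemma push_comp (f : G -> R) : (forall x, x \notin phi @: setT -> f x = 0) ->
  push (fun y => f (phi y)) =1 f.
Proof.
move=> hf x; case: (boolP (x \in phi @: setT)) => [/imsetP[y _ ->]|xn]; first exact: push_phi.
rewrite hf // /push big1 // => y /eqP yx.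
by case/negP: xn; rewrite -yx imset_f.
Qed.

Lemma psd_on_push (l : R) (U : {set H}) : psd_on l (phi @: U) <-> psd_on l U.
Proof.
split=> h f hf; first by rewrite -bq_push; apply: h; apply: push0.
have e : push (fun y => f (phi y)) =1 f.
  apply: push_comp => x xn; apply: hf; apply: contra xn => /imsetP[y _ ->].
  by rewrite imset_f.
rewrite -(bq_ext l e e) bq_push; apply: h => y yU; apply: hf.
by apply: contra yU => /imsetP[z zU /phi_inj ->].
Qed.
End Embedding.

Definition loc_psd (R : realType) (l : R) (N : nat) (G : sgraph) :=
  forall U : {set G}, (#|U| <= N)%N -> psd_on l U.

Lemma loc_psd_induced (R : realType) (l : R) N (H G : sgraph) :
  sg_induced H G -> loc_psd l N G -> loc_psd l N H.
Proof.
move=> [phi [inj hl]] h U hU; apply/(psd_on_push inj hl); apply: h.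
by rewrite card_imset.
Qed.

Section Induced.
Variables (G : sgraph) (U : {set G}).
Let T := {x : G | x \in U}.
Definition induced_label (x y : T) := sg_label (val x) (val y).
Lemma induced_sym x y : induced_label x y = induced_label y x.
Proof. exact: sg_label_sym. Qed.
Lemma induced_irr x : induced_label x x = None.
Proof. exact: sg_label_irrefl. Qed.
Definition induced := SGraph induced_sym induced_irr.

Definition in_induced : induced -> G := val.

Lemma in_induced_inj : injective in_induced. Proof. exact: val_inj. Qed.

Lemma in_induced_lab x y : sg_label (in_induced x) (in_induced y) = sg_label x y.
Proof. by []. Qed.

Lemma sg_induced_induced : sg_induced induced G.
Proof. by exists in_induced; split; [exact: val_inj|]. Qed.

Lemma in_inducedP x : x \in U -> exists y : induced, in_induced y = x.
Proof. by move=> xU; exists (Sub x xU : T); apply: SubK. Qed.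

Lemma imset_induced : in_induced @: setT = U.
Proof.
apply/setP => x; apply/imsetP/idP => [[y _ ->]|/in_inducedP[y <-]]; first exact: valP.
by exists y.
Qed.

Lemma card_induced : #|induced| = #|U|.
Proof. by rewrite -imset_induced card_imset ?cardsT //; apply: val_inj. Qed.

Lemma psd_induced (R : realType) (l : R) : @psd R induced l <-> psd_on l U.
Proof.
by rewrite -psd_onT -(psd_on_push in_induced_inj in_induced_lab) imset_induced.
Qed.
End Induced.

Definition critical (R : realType) (l : R) (G : sgraph) :=
  ~ @psd R G l /\ forall U : {set G}, U != setT -> psd_on l U.

(** A cut without edges would split the form into two forms supported on proper subsets. *)
Lemma critical_connected (R : realType) (l : R) (G : sgraph) : critical l G -> connected G.
Proof.
move=> [nG hU] A A0 AT; apply: contrapT => none; apply: nG => f.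
have lab0 x y : x \in A -> y \notin A -> lab x y = 0.
  move=> xA yA; apply/eqP/negPn/negP => xy; apply: none.
  by exists x, y.
pose fA x := if x \in A then f x else 0; pose fB x := if x \in A then 0 else f x.
have e : f =1 (fun x => 1 * fA x + 1 * fB x).
  by move=> x; rewrite /fA /fB; case: ifP => _; ring.
have ab : bq l fA fB = 0.
  rewrite /bq !big1 ?addr0 // => x _; rewrite /fA /fB; case: ifP => xA.
  - rewrite big1 // => y _; case: ifP => yA; first by rewrite mulr0.
    by rewrite lab0 ?yA // !mul0r.
  - by rewrite big1 // => y _; rewrite mulr0 mul0r.
  - by rewrite mulr0.
  - by rewrite mulr0 mul0r.
rewrite (bq_ext l e e) bq_linl !bq_linr ab (bqC l fB) ab !mul1r addr0 add0r addr_ge0 //.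
  by apply: (hU A) => // x xA; rewrite /fA (negbTE xA).
apply: (hU (~: A)); first by apply: contraNneq A0 => h; rewrite -(setCK A) h setCT.
by move=> x; rewrite inE negbK /fB => ->.
Qed.

Lemma critical_exists (R : realType) (l : R) (G : sgraph) : ~ @psd R G l ->
  exists H, sg_induced H G /\ critical l H.
Proof.
move=> nG.
pose P (U : {set G}) := `[< ~ psd_on l U >].
have PT : P [set: G] by apply/asboolP => /psd_onT.
case: (arg_minnP (fun U : {set G} => #|U|) PT) => U /asboolP nU minU.
exists (induced U); split; first exact: sg_induced_induced.
split=> [/psd_induced //|V VT].
apply/(psd_on_push (@in_induced_inj G U) (@in_induced_lab G U)).
apply: contrapT => nV; have := minU _ (asboolT nV).
rewrite -(card_induced U) card_imset; last exact: val_inj.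
rewrite -cardsT leqNgt => /negP; apply.
by rewrite proper_card // properEneq VT subsetT.
Qed.

Section Homogeneous.
Variables (R : realType) (l : R) (G : sgraph).

Lemma bq_homog (A : {set G}) (c : int) (g : G -> R) :
  (forall x y, x \in A -> y \in A -> x != y -> lab x y = c) ->
  (forall x, x \notin A -> g x = 0) ->
  bq l g g = (l - c%:~R) * \sum_x g x ^+ 2 + c%:~R * (\sum_x g x) ^+ 2.
Proof.
move=> hA hg; rewrite /bq [in RHS]expr2 mulr_suml !mulr_sumr -!big_split /=.
apply: eq_bigr => x _; rewrite mulr_sumr mulr_sumr (bigD1 x) //= [in RHS](bigD1 x) //= lab_irr.
rewrite (eq_bigr (fun y => c%:~R * (g x * g y))); first by ring.
move=> y yx; case: (boolP (x \in A)) => xA; last by rewrite hg // !(mulr0, mul0r).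
case: (boolP (y \in A)) => yA; last by rewrite (hg y) // !(mulr0, mul0r).
by rewrite hA // 1?eq_sym //; ring.
Qed.

Hypothesis l_small : l < 11 / 5.

Lemma no_star5 (v : G) (A : {set G}) : loc_psd l 6 G -> #|A| = 5 ->
  (forall x y, x \in A -> y \in A -> x != y -> lab x y = 0) ->
  (forall x, x \in A -> lab v x != 0) -> False.
Proof.
move=> hl cA hA hv.
pose g x : R := if x \in A then (lab v x)%:~R else 0.
have vA : v \notin A by apply/negP => /hv; rewrite lab_irr eqxx.
have g0 x : x \notin A -> g x = 0 by rewrite /g => /negbTE ->.
have gg x : x \in A -> g x ^+ 2 = 1.
  move=> xA; rewrite /g xA -rmorphXn /=; have := hv _ xA.
  by case: (labP v x) => ->.
have sg : \sum_x g x ^+ 2 = 5.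
  rewrite (bigID (mem A)) /= [X in _ + X]big1 => [|x xA]; last by rewrite g0 // expr0n.
  by rewrite addr0 (eq_bigr (fun=> 1)) // sumr_const cA.
have bg : bq l g g = l * 5.
  by rewrite (bq_homog hA g0) sg subr0 mul0r addr0.
have bv : bq l (dl R v) g = 5.
  rewrite bq_dl g0 // mulr0 add0r -sg; apply: eq_bigr => x _; rewrite /g expr2.
  by case: ifP => // _; rewrite mulr0 mul0r.
(* The leaf weight [2 / 5] is close to the optimal [1 / l]; the value is [9 * l / 5 - 4], negative
   for [l < 20 / 9]. *)
have := hl (v |: A) _ (fun x => 1 * dl R v x + (- (2 / 5)) * g x) _.
rewrite bq_linl !bq_linr (bqC l g) bv bg bq_dl2 eqxx cardsU1 vA cA => h.
have : 0 <= 1 * (1 * l + - (2 / 5) * 5) + - (2 / 5) * (1 * 5 + - (2 / 5) * (l * 5)).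
  apply: h => // x; rewrite !inE negb_or => /andP[xv xA].
  by rewrite /dl (negbTE xv) g0 // !mulr0 addr0.
by have := l_small; lra.
Qed.

Lemma no_negative4 (A : {set G}) : loc_psd l 6 G -> #|A| = 4 ->
  (forall x y, x \in A -> y \in A -> x != y -> lab x y = -1) -> False.
Proof.
move=> hl cA hA; pose g x : R := if x \in A then 1 else 0.
have g0 x : x \notin A -> g x = 0 by rewrite /g => /negbTE ->.
have := hl A _ g g0; rewrite cA (bq_homog hA g0) => h.
have s1 : \sum_x g x = 4 by rewrite -big_mkcond /= sumr_const cA.
have s2 : \sum_x g x ^+ 2 = 4.
  by rewrite -s1; apply: eq_bigr => x _; rewrite /g; case: ifP; rewrite ?expr1n ?expr0n.
by have := h isT; rewrite s1 s2; have := l_small; lra.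
Qed.
End Homogeneous.

(** * Ramsey's theorem and vertices of large degree *)

Lemma pigeonhole_set (T I : finType) (h : T -> I) (S : {set T}) (J : {set I}) (k : nat) :
  (forall x, x \in S -> h x \in J) -> (#|J| * k < #|S|)%N ->
  exists i, (k < #|[set x in S | h x == i]|)%N.
Proof.
move=> hJ hk; apply/existsP; apply: contraLR hk => /existsPn hI; rewrite -leqNgt.
rewrite -sum1_card (partition_big h (mem J)) //= -sum_nat_const leq_sum // => i _.
have := hI i; rewrite -leqNgt; apply: leq_trans; rewrite -sum1_card.
by apply: eq_leq; apply: eq_bigl => x; rewrite inE.
Qed.

(** The three values of a label are the colours. Induction on the sum of the requested sizes: the
    rest of [S] is split by its label to one vertex [x], and the request for the most frequent
    colour drops by one. *)
Lemma ramsey (ks : option bool -> nat) : exists N, forall (G : sgraph) (S : {set G}),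
  (N <= #|S|)%N -> exists c (A : {set G}), [/\ A \subset S, #|A| = ks c &
    forall x y, x \in A -> y \in A -> x != y -> sg_label x y = c].
Proof.
have [n] := ubnP (ks None + ks (Some true) + ks (Some false))%N.
elim: n ks => // n IHn ks /ltnSE hn.
case: (pickP (fun c => ks c == 0%N)) => [c /eqP kc|pos].
  exists 0%N => G S _; exists c, set0; split; rewrite ?sub0set ?cards0 ?kc // => x y.
  by rewrite inE.
pose ks' c := fun c' => if c' == c then (ks c).-1 else ks c'.
have hN c : exists N, forall (G : sgraph) (S : {set G}), (N <= #|S|)%N ->
   exists c' (A : {set G}), [/\ A \subset S, #|A| = ks' c c' &
    forall x y, x \in A -> y \in A -> x != y -> sg_label x y = c'].
  apply: IHn; apply: leq_trans hn; rewrite /ks'.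
  have := pos None; have := pos (Some true); have := pos (Some false).
  by case: c => [[]|] /=; lia.
have [N0 h0] := hN None; have [N1 h1] := hN (Some true); have [N2 h2] := hN (Some false).
exists (3 * (N0 + N1 + N2) + 2)%N => G S hS.
have /set0Pn[x xS] : S != set0 by rewrite -card_gt0 (leq_trans _ hS) // addn_gt0 orbT.
have [||c hc] := @pigeonhole_set G _ (sg_label x) (S :\ x) setT (N0 + N1 + N2).
  by move=> y _; rewrite inE.
  rewrite cardsT card_option card_bool (cardsD1 x S) xS in hS *; lia.
have [c' [A [AS cA hA]]] : exists c' (A : {set G}),
    [/\ A \subset [set y in S :\ x | sg_label x y == c], #|A| = ks' c c' &
    forall x y, x \in A -> y \in A -> x != y -> sg_label x y = c'].
  by case: c hc => [[]|] hc; [apply: h1|apply: h2|apply: h0]; apply: leq_trans (ltnW hc); lia.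
have AS' : A \subset S.
  by apply: subset_trans AS _; apply/subsetP => y; rewrite !inE => /andP[/andP[]].
have [cc|cc] := eqVneq c' c; last first.
  by exists c', A; split=> //; rewrite cA /ks' (negbTE cc).
have xA : x \notin A by apply/negP => /(subsetP AS); rewrite !inE eqxx.
exists c, (x |: A); split.
- by apply/subsetP => y; rewrite in_setU1 => /orP[/eqP ->|/(subsetP AS')].
- by rewrite cardsU1 xA cA cc /ks' eqxx; have := pos c; case: (ks c).
have hx y : y \in A -> sg_label x y = c.
  by move=> /(subsetP AS); rewrite !inE => /andP[_ /eqP].
move=> y z; rewrite !in_setU1 => /orP[/eqP ->|yA] /orP[/eqP ->|zA]; rewrite ?eqxx //.
- by move=> _; apply: hx.
- by move=> _; rewrite sg_label_sym; apply: hx.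
- by move=> yz; rewrite -cc; apply: hA.
Qed.

Definition nbrs (G : sgraph) (x : G) : {set G} := [set y | lab x y != 0].

(** Among the neighbours of one vertex, five pairwise non-adjacent ones or a negative clique on four
    would contradict local positivity, so Ramsey's theorem can only produce a positive clique. *)
Lemma large_degree_clique (M : nat) : exists D, forall (R : realType) (l : R) (G : sgraph) (v : G) (S : {set G}),
  l < 11 / 5 -> loc_psd l 6 G -> S \subset nbrs v -> (D <= #|S|)%N ->
  exists A : {set G}, [/\ A \subset S, #|A| = M &
    forall x y, x \in A -> y \in A -> x != y -> lab x y = 1].
Proof.
have [D hD] := ramsey (fun c => match c with None => 5 | Some false => 4 | Some true => M end).
exists D => R l G v S l1 hl Sv /hD[c [A [AS cA hA]]].
case: c cA hA => [[]|] cA hA.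
- by exists A; split=> // x y xA yA xy; rewrite /lab hA.
- by case: (no_negative4 l1 hl cA) => x y xA yA xy; rewrite /lab hA.
- case: (no_star5 (v := v) l1 hl cA) => [x y xA yA xy|x xA]; first by rewrite /lab hA.
  by have := subsetP Sv _ (subsetP AS _ xA); rewrite inE.
Qed.

(** * Balls and geodesics *)

Section Balls.
Variables (G : sgraph) (W : {set G}).

Definition grow_set (S : {set G}) : {set G} := S :|: \bigcup_(x in S) nbrs x.
Definition ball k := iter k grow_set W.

Lemma ballS k : ball k \subset ball k.+1.
Proof. exact: subsetUl. Qed.

Lemma ball_mono i j : (i <= j)%N -> ball i \subset ball j.
Proof.
move/subnK <-; elim: (j - i)%N => // n IH; apply: subset_trans IH _; exact: ballS.
Qed.

Lemma ball_nbr k x y : x \in ball k -> lab x y != 0 -> y \in ball k.+1.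
Proof.
move=> xb xy; rewrite /= in_setU; apply/orP; right; apply/bigcupP; exists x => //.
by rewrite inE.
Qed.

Lemma card_ball (D k : nat) : (forall x, x \in ball k -> (#|nbrs x| <= D)%N) ->
  (#|ball k.+1| <= #|W| * D.+1 ^ k.+1)%N.
Proof.
have step (S : {set G}) : (forall x, x \in S -> (#|nbrs x| <= D)%N) -> (#|grow_set S| <= #|S| * D.+1)%N.
  move=> h; apply: leq_trans (leq_card_setU _ _) _; rewrite mulnS leq_add2l.
  apply: leq_trans (_ : (\sum_(x in S) #|nbrs x| <= _)%N).
    elim/big_rec2: _ => [|x n A xS h']; first by rewrite cards0.
    by apply: leq_trans (leq_card_setU _ _) _; rewrite leq_add2l.
  by rewrite -sum_nat_const leq_sum.
elim: k => [|k IHk] h; first by rewrite expn1; apply: step.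
apply: leq_trans (step _ h) _; rewrite [(_ ^ k.+2)%N]expnSr mulnA leq_mul2r IHk ?orbT //.
by move=> x xb; apply: h; apply: (subsetP (ballS k)).
Qed.

(* [p i] is at distance exactly [i] from [W]. *)
Definition geodesic (k : nat) (p : nat -> G) :=
  (forall i, (0 < i <= k)%N -> p i \in ball i /\ p i \notin ball i.-1) /\
  (forall i, (0 < i < k)%N -> lab (p i) (p i.+1) != 0).

Lemma geodesic_to k y : y \in ball k.+1 -> y \notin ball k ->
  exists p, geodesic k.+1 p /\ p k.+1 = y.
Proof.
elim: k y => [|k IHk] y yb yn.
  exists (fun=> y); split=> //; split=> [i|i].
    by case: i => // -[].
  by case: i => // i; rewrite ltnS ltn0 andbF.
move: (yb); rewrite [ball _]/= /grow_set in_setU (negbTE yn) /= => /bigcupP[x xb]; rewrite inE => xy.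
have xn : x \notin ball k.
  by apply: contra yn => h; apply: ball_nbr h xy.
have [p [[p1 p2] px]] := IHk _ xb xn.
exists (fun i => if i == k.+2 then y else p i); rewrite eqxx; split=> //; split=> i /=.
  case: eqP => [->|/eqP ik] //= /andP[i0 ik']; apply: p1; rewrite i0 /=.
  by rewrite -ltnS ltn_neqAle ik.
case: (eqVneq i k.+2) => [->|ik] /andP[i0 ik']; first by rewrite ltnn in ik'.
have [ik2|ik2] := eqVneq i k.+1.
  by rewrite ik2 eqxx px.
rewrite eqSS (negbTE ik2); apply: p2; rewrite i0 /= ltn_neqAle ik2 /=.
by rewrite -ltnS.
Qed.

Lemma geodesic_exists k : connected G -> W != set0 -> ball k != setT ->
  exists p, geodesic k.+1 p.
Proof.
move=> conn W0 bT.
have b0 : ball k != set0.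
  case/set0Pn: W0 => w wW; apply/set0Pn; exists w; exact: (subsetP (ball_mono (leq0n k))).
have [x [y [xb yb xy]]] := conn _ b0 bT.
by have [p [hp _]] := geodesic_to (ball_nbr xb xy) yb; exists p.
Qed.

Lemma geodesic_sep k p i j : geodesic k p -> (0 < j <= k)%N -> (i.+1 < j)%N ->
  forall x, x \in ball i -> lab x (p j) = 0 /\ x != p j.
Proof.
move=> [p1 _] hj ij x xb; have [_ pj] := p1 j hj.
split.
  apply/eqP/negPn/negP => h; case/negP: pj.
  by apply: (subsetP (ball_mono _)) (ball_nbr xb h); rewrite -ltnS prednK //; case/andP: hj.
apply: contraNneq pj => <-; apply: (subsetP (ball_mono _)) xb.
by case/andP: hj => j0 _; rewrite -ltnS prednK // ltnW.
Qed.
End Balls.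

(** * Gluing cliques *)

Lemma sum_minor (R : realType) (I : finType) (P : {pred I}) (f g : I -> R) :
  (\sum_(i in P) f i * g i) ^+ 2 <= (\sum_(i in P) f i ^+ 2) * (\sum_(i in P) g i ^+ 2).
Proof.
apply: minor2 => x y.
suff -> : (\sum_(i in P) f i ^+ 2) * x ^+ 2 + 2 * (\sum_(i in P) f i * g i) * x * y +
    (\sum_(i in P) g i ^+ 2) * y ^+ 2 = \sum_(i in P) (f i * x + g i * y) ^+ 2.
  by apply: sumr_ge0 => i _; apply: sqr_ge0.
rewrite [RHS](eq_bigr (fun i => x ^+ 2 * f i ^+ 2 + (2 * x * y * (f i * g i) + y ^+ 2 * g i ^+ 2))).
  by rewrite !big_split /= -!mulr_sumr; ring.
by move=> i _; ring.
Qed.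

Lemma sqr_sum_le (R : realType) (I : finType) (P : {pred I}) (v : I -> R) :
  (\sum_(i in P) v i) ^+ 2 <= #|P|%:R * \sum_(i in P) v i ^+ 2.
Proof.
have := sum_minor P (fun=> 1) v; rewrite sumr_const expr1n.
by rewrite (eq_bigr v) // => i _; rewrite mul1r.
Qed.

Section Glue.
Variables (G H : sgraph) (r : G) (S : {pred H}).

Definition glue_label (x y : G + H) : option bool :=
  match x, y with
  | inl a, inl b => sg_label a b
  | inr a, inr b => sg_label a b
  | inl a, inr b | inr b, inl a => if (a == r) && (b \in S) then Some true else None
  end.

Lemma glue_sym x y : glue_label x y = glue_label y x.
Proof. by case: x => x; case: y => y //=; apply: sg_label_sym. Qed.

Lemma glue_irr x : glue_label x x = None.
Proof. by case: x => x /=; apply: sg_label_irrefl. Qed.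

Definition glue := SGraph glue_sym glue_irr.

Lemma bq_glue (R : realType) (l : R) (f : glue -> R) : bq l f f =
  bq l (fun x : G => f (inl x)) (fun x : G => f (inl x)) +
  bq l (fun x : H => f (inr x)) (fun x : H => f (inr x)) +
  2 * f (inl r) * \sum_(y in S) f (inr y).
Proof.
rewrite /bq big_sumType /= [X in _ + _ + X = _]big_sumType /=.
under [X in _ + (X + _) = _]eq_bigr do rewrite big_sumType.
under [X in _ + (_ + X) = _]eq_bigr do rewrite big_sumType.
rewrite !big_split /=.
have e1 : \sum_(x : G) \sum_(y : H) (@lab glue (inl x) (inr y))%:~R * f (inl x) * f (inr y) =
    f (inl r) * \sum_(y in S) f (inr y).
  rewrite (bigD1 r) //= [X in _ + X]big1 ?addr0 => [|x /negbTE xr].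
    rewrite mulr_sumr [RHS]big_mkcond /=; apply: eq_bigr => y _.
    by rewrite /lab /= eqxx /=; case: ifP => _; rewrite ?mul1r ?mul0r.
  by rewrite big1 // => y _; rewrite /lab /= xr !mul0r.
have e2 : \sum_(x : H) \sum_(y : G) (@lab glue (inr x) (inl y))%:~R * f (inr x) * f (inl y) =
    f (inl r) * \sum_(y in S) f (inr y).
  rewrite -e1 exchange_big; apply: eq_bigr => x _; apply: eq_bigr => y _.
  by rewrite lab_sym -!mulrA [f (inr y) * _]mulrC.
rewrite e1 e2 /lab /=; ring.
Qed.
End Glue.

Section Clique.
Variable n : nat.
Definition clique_label (x y : 'I_n) : option bool := if x == y then None else Some true.
Lemma clique_sym x y : clique_label x y = clique_label y x.
Proof. by rewrite /clique_label eq_sym. Qed.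
Lemma clique_irr x : clique_label x x = None.
Proof. by rewrite /clique_label eqxx. Qed.
Definition clique := SGraph clique_sym clique_irr.

Lemma bq_clique (R : realType) (l : R) (f : clique -> R) :
  bq l f f = (l - 1) * \sum_x f x ^+ 2 + (\sum_x f x) ^+ 2.
Proof.
rewrite (@bq_homog R l clique setT 1) ?mul1r // => x; last by rewrite inE.
by move=> y _ _ xy; rewrite /lab /= /clique_label (negbTE xy).
Qed.
End Clique.

Section Decorate.
Variable G : sgraph.
Definition leafy_label (x y : G * bool) : option bool :=
  match x.2, y.2 with
  | false, false => sg_label x.1 y.1
  | true, true => None
  | _, _ => if x.1 == y.1 then Some true else None
  end.
Lemma leafy_sym x y : leafy_label x y = leafy_label y x.
Proof. by case: x => x [] ; case: y => y []; rewrite /leafy_label //= 1?eq_sym // sg_label_sym. Qed.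
Lemma leafy_irr x : leafy_label x x = None.
Proof. by case: x => x [] //=; rewrite /leafy_label /= sg_label_irrefl. Qed.
Definition leafy := SGraph leafy_sym leafy_irr.

Lemma sum_leafy (R : realType) (F : leafy -> R) :
  \sum_x F x = \sum_(x : G) (F (x, false) + F (x, true)).
Proof.
transitivity (\sum_(x : G) \sum_(b : bool) F (x, b)).
  by rewrite pair_bigA; apply: eq_bigr => -[].
by apply: eq_bigr => x _; rewrite big_bool addrC.
Qed.

Lemma bq_leafy (R : realType) (l : R) (f : leafy -> R) : bq l f f =
  bq l (fun x : G => f (x, false)) (fun x : G => f (x, false)) +
  \sum_(x : G) (l * f (x, true) ^+ 2 + 2 * f (x, false) * f (x, true)).
Proof.
rewrite /bq !sum_leafy.
under [X in _ + X = _]eq_bigr do rewrite !sum_leafy.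
have e (x : G) : \sum_(y : G) ((@lab leafy (x, false) (y, false))%:~R * f (x, false) * f (y, false) +
      (@lab leafy (x, false) (y, true))%:~R * f (x, false) * f (y, true)) +
   \sum_(y : G) ((@lab leafy (x, true) (y, false))%:~R * f (x, true) * f (y, false) +
      (@lab leafy (x, true) (y, true))%:~R * f (x, true) * f (y, true)) =
   \sum_(y : G) (lab x y)%:~R * f (x, false) * f (y, false) + 2 * f (x, false) * f (x, true).
  rewrite !big_split /=.
  have d (a b : bool) : a != b ->
     \sum_(y : G) (@lab leafy (x, a) (y, b))%:~R * f (x, a) * f (y, b) = f (x, a) * f (x, b).
    move=> ab; rewrite (bigD1 x) //= big1 => [|y yx].
      by rewrite /lab /= /leafy_label; case: a b ab => [] [] //= _; rewrite eqxx addr0 mul1r.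
    rewrite /lab /= /leafy_label; case: a b ab => [] [] //= _;
    by rewrite eq_sym (negbTE yx) !mul0r.
  rewrite (d false true isT) (d true false isT) [X in _ + (_ + X)]big1 => [|y _]; last by rewrite /lab /= /leafy_label /= !mul0r.
  by rewrite /lab /= /leafy_label /=; ring.
under [X in _ + X = _]eq_bigr do rewrite e.
rewrite !big_split /= -!addrA; congr (_ + _).
rewrite addrC -!addrA; congr (_ + _).
rewrite addrC; congr (_ + _).
by apply: eq_bigr => x _; ring.
Qed.
End Decorate.

Lemma sum_clique_all (R : realType) m (F : clique m -> R) :
  \sum_(y in mem (clique m)) F y = \sum_y F y.
Proof. by apply: eq_bigl => y; rewrite inE. Qed.

(** * Pivots of rooted graphs *)

Section Rooted.
Variables (R : realType) (l : R).

(* [d] is the Schur complement of the form at the root [r]. *)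
Definition pivot (G : sgraph) (r : G) (d : R) :=
  (forall f : G -> R, d * f r ^+ 2 <= bq l f f) /\
  exists2 f : G -> R, f r = 1 & bq l f f = d.

Lemma bq_scale (G : sgraph) (c : R) (f : G -> R) :
  bq l (fun x => c * f x) (fun x => c * f x) = c ^+ 2 * bq l f f.
Proof.
have e : (fun x : G => c * f x) =1 (fun x => c * f x + 0 * f x) by move=> x; rewrite mul0r addr0.
by rewrite (bq_ext l e e) bq_linl !bq_linr; ring.
Qed.

Definition has_pivot d := exists (G : sgraph) (r : G), pivot r d.

Lemma pivot_single : has_pivot l.
Proof.
exists (clique 1), ord0; split=> [f|].
  suff -> : bq l f f = l * f ord0 ^+ 2 by [].
  by rewrite bq_clique !big_ord1; ring.
by exists (fun=> 1) => //; rewrite bq_clique !big_ord1; ring.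
Qed.

Lemma pivot_join d d' : has_pivot d -> has_pivot d' -> 0 < d' -> has_pivot (d - d'^-1).
Proof.
move=> [G [r [hG [g g1 gd]]]] [H [s [hH [h h1 hd]]]] d'0.
exists (glue r (pred1 s)), (inl r); split=> [f|].
  rewrite bq_glue big_pred1_eq.
  have := hG (fun x => f (inl x)); have := hH (fun x => f (inr x)).
  move: (bq _ _ _) (bq _ _ _) (f (inl r)) (f (inr s)) => B A x y hB hA.
  have : 0 <= d' * (y + x / d') ^+ 2 by rewrite mulr_ge0 ?sqr_ge0 // ltW.
  have -> : d' * (y + x / d') ^+ 2 = d' * y ^+ 2 + 2 * x * y + d'^-1 * x ^+ 2.
    by field; rewrite gt_eqF.
  lra.
exists (fun x => match x with inl a => g a | inr b => - d'^-1 * h b end) => //.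
rewrite bq_glue big_pred1_eq /= bq_scale gd hd g1 h1.
by field; rewrite gt_eqF.
Qed.

(** Eliminating [G] leaves [mu * sum f y ^ 2 - c * (sum f y) ^ 2] on the clique, with [mu = l - 1]
    and [c = 1 / d - 1]. The pivot is the minimum of this form when one clique vertex, the new root,
    has value 1. *)
Lemma pivot_clique (G : sgraph) (r : G) (d : R) (m : nat) : 1 <= l - 1 -> pivot r d ->
  0 < d -> d < 1 -> m%:R * (d^-1 - 1) < l - 1 ->
  @pivot (glue r (mem (clique m.+1))) (inr ord0)
    ((l - 1) * (1 - (d^-1 - 1) / ((l - 1) - (d^-1 - 1) * m%:R))).
Proof.
set mu := l - 1 => mu1 [hG [g g1 gd]] d0 d1.
have di : d * d^-1 = 1 by rewrite divff // gt_eqF.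
set c := d^-1 - 1 => mc; have c0 : 0 < c by rewrite /c subr_gt0 invf_gt1.
have cd : d * (1 + c) = 1 by rewrite /c addrC subrK.
have dinv : d^-1 = 1 + c by rewrite /c addrC subrK.
set D := mu - c * m%:R; have D0 : 0 < D by rewrite /D subr_gt0 mulrC.
have Dn0 : D != 0 by rewrite gt_eqF.
have Dm : mu = D + c * m%:R by rewrite /D subrK.
clearbody D c; split=> [f|].
  rewrite bq_glue bq_clique.
  have := hG (fun x => f (inl x)); move: (bq _ _ _) (f (inl r)) => A x hA.
  rewrite -/mu (sum_clique_all (fun y => f (inr y))) /=; set Sm := \sum_(y : clique m.+1) f (inr y).
  set z := f (inr ord0).
  have h1 : - c * Sm ^+ 2 <= A + Sm ^+ 2 + 2 * x * Sm.
    have : 0 <= d * (x + (1 + c) * Sm) ^+ 2 by rewrite mulr_ge0 ?sqr_ge0 // ltW.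
    have -> : d * (x + (1 + c) * Sm) ^+ 2 =
       d * x ^+ 2 + d * (1 + c) * (2 * x * Sm + Sm ^+ 2) + d * (1 + c) * c * Sm ^+ 2 by ring.
    by rewrite cd; lra.
  suff h2 : mu * (1 - c / D) * z ^+ 2 <= mu * \sum_(y : clique m.+1) f (inr y) ^+ 2 - c * Sm ^+ 2.
    by lra.
  have -> : Sm = z + \sum_(i < m) f (inr (lift ord0 i)).
    by rewrite /Sm big_ord_recl.
  rewrite (big_ord_recl m) /= -/z.
  (* Deviation from the minimizer, in which the other clique vertices all take the value
     [c / D * z]. *)
  pose v (i : 'I_m) := f (inr (lift ord0 i)) - c / D * z.
  have := sqr_sum_le predT v; rewrite card_ord.
  have -> : \sum_(i in predT) v i = \sum_(i < m) f (inr (lift ord0 i)) - m%:R * (c / D * z).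
    by rewrite /v big_split /= sumrN sumr_const card_ord mulr_natl.
  have -> : \sum_(i in predT) v i ^+ 2 = \sum_(i < m) f (inr (lift ord0 i)) ^+ 2 +
     (m%:R * (c / D * z) ^+ 2 - 2 * (c / D * z) * \sum_(i < m) f (inr (lift ord0 i))).
    rewrite (eq_bigr (fun i => f (inr (lift ord0 i)) ^+ 2 + ((c / D * z) ^+ 2 +
       (- (2 * (c / D * z))) * f (inr (lift ord0 i))))); last by move=> i _; rewrite /v; ring.
    by rewrite !big_split /= sumr_const card_ord -mulr_sumr -[_ *+ m]mulr_natl mulNr.
  set V := \sum_(i < m) f (inr (lift ord0 i)); set V2 := \sum_(i < m) _ ^+ 2.
  set q := c / D * z => hV.
  have qD : q * D = c * z by rewrite /q; field.
  have cDz : mu * (1 - c / D) * z ^+ 2 = mu * z ^+ 2 - mu * q * z by rewrite /q; ring.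
  rewrite cDz.
  have hW : 0 <= V2 + (m%:R * q ^+ 2 - 2 * q * V).
    have -> : V2 + (m%:R * q ^+ 2 - 2 * q * V) = \sum_(i < m) v i ^+ 2.
      rewrite (eq_bigr (fun i => f (inr (lift ord0 i)) ^+ 2 + (q ^+ 2 +
         (- (2 * q)) * f (inr (lift ord0 i))))); last by move=> i _; rewrite /v /q; ring.
      by rewrite !big_split /= sumr_const card_ord -mulr_sumr -[q ^+ 2 *+ m]mulr_natl mulNr.
    by apply: sumr_ge0 => i _; apply: sqr_ge0.
  (* The difference is [D] times the squared length of the deviations plus [c] times their
     Cauchy-Schwarz gap. *)
  have key : mu * (z ^+ 2 + V2) - c * (z + V) ^+ 2 - (mu * z ^+ 2 - mu * q * z) =
     D * (V2 + (m%:R * q ^+ 2 - 2 * q * V)) +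
     c * (m%:R * (V2 + (m%:R * q ^+ 2 - 2 * q * V)) - (V - m%:R * q) ^+ 2).
    transitivity ((D + c * m%:R) * V2 - c * (z + V) ^+ 2 + (D + c * m%:R) * q * z).
      by rewrite -Dm; ring.
    have cz : c * z = D * q by rewrite /q; field.
    rewrite [LHS](_ : _ = (D + c * m%:R) * V2 - (c * z) * (z + 2 * V) - c * V ^+ 2 + D * q * z
       + (c * z) * (m%:R * q)); last by ring.
    by rewrite cz; ring.
  rewrite -subr_ge0 key addr_ge0 //; first by rewrite mulr_ge0 // ltW.
  by rewrite mulr_ge0 ?(ltW c0) // subr_ge0.
pose q := c / D.
exists (fun x => match x with
  inl a => (- (d^-1 * (1 + m%:R * q))) * g a | inr i => if i == ord0 then 1 else q end) => //.
rewrite bq_glue bq_clique /= bq_scale gd g1.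
rewrite (sum_clique_all (fun y => if y == ord0 then 1 else q)) !big_ord_recl /=.
rewrite !sumr_const card_ord -[q ^+ 2 *+ m]mulr_natl -[q *+ m]mulr_natl -/mu -/q.
rewrite dinv.
set a := 1 + m%:R * q.
have aD : a * D = mu by rewrite Dm /a /q; field.
have cqD : c = q * D by rewrite /q; field.
transitivity (d * (1 + c) * (1 + c) * a ^+ 2 + mu * (1 + m%:R * q ^+ 2) + a ^+ 2
  - 2 * (1 + c) * a ^+ 2); first by ring.
rewrite cd; transitivity (mu * (1 + m%:R * q ^+ 2) - c * a ^+ 2); first by ring.
rewrite {1}cqD; transitivity (mu * (1 + m%:R * q ^+ 2) - q * a * (a * D)); first by ring.
by rewrite aD /a; ring.
Qed.

(** The test function is 1 on the clique and the best response to it on [G]; its value is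
    [m * (l - 1 - m * (1 / d - 1))]. *)
Lemma pivot_kill (G : sgraph) (r : G) (d : R) (m : nat) : pivot r d -> 0 < d -> d < 1 ->
  (0 < m)%N -> l - 1 < m%:R * (d^-1 - 1) -> ~ @psd R (glue r (mem (clique m))) l.
Proof.
move=> [hG [g g1 gd]] d0 d1 m0 hm h.
have := h (fun x => match x with inl a => (- (d^-1 * m%:R)) * g a | inr i => 1 end).
rewrite bq_glue bq_clique /= bq_scale gd g1 (sum_clique_all (fun=> 1)).
under eq_bigr do rewrite expr1n.
rewrite !sumr_const card_ord.
have -> : (- (d^-1 * m%:R)) ^+ 2 * d + ((l - 1) * m%:R + m%:R ^+ 2) +
   2 * (- (d^-1 * m%:R) * 1) * m%:R = m%:R * ((l - 1) - m%:R * (d^-1 - 1)).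
  by field; rewrite gt_eqF.
by rewrite pmulr_rge0 ?ltr0n // subr_ge0 leNgt hm.
Qed.
End Rooted.

(** * Locally positive graphs above the threshold *)

Definition support (R : realType) (G : sgraph) (f : G -> R) := [set x | f x != 0].

Lemma support0 (R : realType) (G : sgraph) (f : G -> R) :
  (#|support f| <= 0)%N -> forall x, f x = 0.
Proof.
rewrite leqn0 cards_eq0 => /eqP h x; apply/eqP/negPn/negP => fx.
by have := in_set0 x; rewrite -h inE fx.
Qed.

Lemma card_support_glue (R : realType) (G H : sgraph) r S (f : @glue G H r S -> R) :
  #|support f| = (#|support (fun x : G => f (inl x))| + #|support (fun x : H => f (inr x))|)%N.
Proof.
rewrite -!sum1_card big_mkcond big_sumType /=.
by congr addn; rewrite [RHS]big_mkcond; apply: eq_bigr => x _; rewrite !inE.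
Qed.

Definition locally_psd_not_psd (R : realType) (l : R) := forall N : nat,
  exists G : sgraph, ~ @psd R G l /\
    forall f : G -> R, (#|support f| <= N)%N -> 0 <= bq l f f.

(* Eliminating a pendant vertex at every vertex of [G] turns [l] into [l - 1 / l]. *)
Lemma leafy_transfer (R : realType) (l : R) : 2 <= l ->
  locally_psd_not_psd (l - l^-1) -> locally_psd_not_psd l.
Proof.
move=> l2 h N; have [G [nG hG]] := h N; have l0 : 0 < l by lra.
have shift (x y : R) : l * y ^+ 2 + 2 * x * y = l * (y + l^-1 * x) ^+ 2 - l^-1 * (x * x).
  by field; rewrite gt_eqF.
have bqs (g : G -> R) : bq (l - l^-1) g g = bq l g g - l^-1 * \sum_x g x * g x.
  by rewrite (bq_shift l); ring.
exists (leafy G); split.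
  move=> hp; apply: nG => g.
  have := hp (fun x => if x.2 then - l^-1 * g x.1 else g x.1).
  rewrite bq_leafy /= bqs; congr (0 <= _ + _).
  rewrite mulr_sumr -sumrN; apply: eq_bigr => x _.
  by rewrite shift; ring.
move=> f hf; rewrite bq_leafy.
have -> : \sum_(x : G) (l * f (x, true) ^+ 2 + 2 * f (x, false) * f (x, true)) =
   \sum_(x : G) l * (f (x, true) + l^-1 * f (x, false)) ^+ 2
   - l^-1 * \sum_(x : G) f (x, false) * f (x, false).
  rewrite mulr_sumr -sumrN -big_split /=; apply: eq_bigr => x _; exact: shift.
rewrite addrCA addr_ge0 //.
  by apply: sumr_ge0 => x _; rewrite mulr_ge0 ?sqr_ge0 // ltW.
rewrite -bqs; apply: hG; apply: leq_trans hf.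
have inj : injective (fun x : G => (x, false) : leafy G) by move=> x y [].
rewrite -(card_imset (mem (support (fun x : G => f (x, false)))) inj) subset_leq_card //.
by apply/subsetP => _ /imsetP[x + ->]; rewrite !inE.
Qed.

Section GreedyChain.
Variables (R : realType) (t : R).
Hypotheses (t_gt1 : 1 < t) (t_le2 : t <= 2).
Local Notation l := (t + t^-1).

(** The last clause says that vectors of small support see a pivot of at least 1. Such a root
    tolerates cliques of every size, while the true pivot [d < 1] does not. *)
Definition chain (N : nat) := exists (G : sgraph) (r : G) (d : R),
  [/\ t^-1 <= d, d < 1, pivot l r d &
      forall f : G -> R, (#|support f| <= N)%N -> f r ^+ 2 <= bq l f f].

Let l2 : 1 <= l - 1.
Proof. by have t1 := t_gt1; have [u0 u1 tu] := thr_u t1; nra. Qed.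

(** With [f r ^ 2] available at the root, the edges to the clique and the square of the clique sum
    complete the square [(x + S) ^ 2], and [l - 1 >= 1] times the squares is left. *)
Lemma glue_clique_ge (G : sgraph) (r : G) (m : nat) (f : glue r (mem (clique m)) -> R) :
  f (inl r) ^+ 2 <= bq l (fun x : G => f (inl x)) (fun x : G => f (inl x)) ->
  \sum_(y : clique m) f (inr y) ^+ 2 <= bq l f f.
Proof.
move=> h; rewrite bq_glue bq_clique (sum_clique_all (fun y => f (inr y))).
move: h; set A := bq _ _ _; set x := f (inl r); set S := \sum_(y : clique m) f (inr y); set Q := \sum_(y : clique m) f (inr y) ^+ 2 => h.
have Q0 : 0 <= Q by apply: sumr_ge0 => y _; apply: sqr_ge0.
have := sqr_ge0 (x + S); have := ler_wpM2r Q0 l2; rewrite mul1r.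
have -> : (x + S) ^+ 2 = x ^+ 2 + S ^+ 2 + 2 * x * S by ring.
move: h; lra.
Qed.

(* The next clique is taken as large as the pivot permits, and [t <= 2] keeps the new pivot in
   [[1/t, 1)]. A vector that misses the last clique is handled by the pivot, one that meets it
   has fewer vertices left for the rest of the chain. *)
Lemma chain_step N : chain N -> chain N.+1.
Proof.
have t1 := t_gt1; have t2 := t_le2; have [u0 u1 tu] := thr_u t1.
move=> [G [r [d [d1 d2 pv hN]]]].
have d0 : 0 < d by apply: lt_le_trans d1.
pose mu := l - 1; pose c := d^-1 - 1.
have c0 : 0 < c by rewrite /c subr_gt0 invf_gt1.
have ct : c <= t - 1 by rewrite /c lerD2r -[leRHS]invrK lef_pV2 ?posrE ?invr_gt0 //; lra.
have mu1 : 1 <= mu := l2.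
(* With [z = y - m] the new pivot is [mu - mu / z]. It is at least [1 / t] exactly when [z >= ys],
   and rounding [y - ys] down to [m] puts [z] into [[ys, ys + 1)]. *)
pose y := mu / c; pose ys := mu / (t - 1).
have yys : 0 <= y - ys.
  by rewrite subr_ge0 /y /ys ler_pM2l ?lef_pV2 ?posrE //; lra.
have /andP[m1 m2] := truncn_itv yys; set m := Num.truncn _ in m1 m2.
have yc : y * c = mu by rewrite /y divfK // gt_eqF.
have yst : ys * (t - 1) = mu by rewrite /ys divfK // gt_eqF //; lra.
have z1 : ys <= y - m%:R by lra.
have z2 : y - m%:R < ys + 1 by move: m2; rewrite -natr1; lra.
have ys0 : 0 < ys by rewrite /ys divr_gt0 //; lra.
set z := y - m%:R in z1 z2; have z0 : 0 < z by lra.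
have Dz : mu - c * m%:R = c * z by rewrite -yc /z; ring.
have mc : m%:R * c < mu.
  by rewrite -subr_gt0 [m%:R * c]mulrC Dz mulr_gt0.
have pv' := pivot_clique l2 pv d0 d2 mc.
have e : (l - 1) * (1 - (d^-1 - 1) / (l - 1 - (d^-1 - 1) * m%:R)) = mu - mu / z.
  by rewrite -/mu -/c Dz; field; rewrite !gt_eqF.
rewrite e in pv'.
have muz : mu / z <= t - 1.
  by rewrite ler_pdivrMr // mulrC -yst ler_pM2r //; lra.
have d1' : t^-1 <= mu - mu / z by rewrite /mu in muz *; lra.
have d2' : mu - mu / z < 1.
  rewrite ltrBlDr -ltrBlDl ltr_pdivlMr //.
  have h1 : (mu - 1) * z < (mu - 1) * (ys + 1) by rewrite ltr_pM2l // /mu; nra.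
  apply: lt_le_trans h1 _.
  have mt : (mu - 1) * t = (t - 1) ^+ 2.
    by transitivity (t * t + t * t^-1 - 2 * t); [rewrite /mu; ring|rewrite tu; ring].
  have : (mu - 1) * (ys + 1) * t <= mu * t.
    rewrite mulrAC mt expr2 -mulrA mulrDr mulr1 [_ * ys]mulrC yst.
    nra.
  by rewrite ler_pM2r //; lra.
exists (glue r (mem (clique m.+1))), (inr ord0), (mu - mu / z); split=> // f.
rewrite card_support_glue => hf.
have [hG|hG] := leqP #|support (fun x : G => f (inl x))| N.
  apply: le_trans (glue_clique_ge (hN _ hG)).
  by rewrite (bigD1 ord0) //= lerDl; apply: sumr_ge0 => i _; apply: sqr_ge0.
have f0 : forall i : clique m.+1, f (inr i) = 0.
  apply: (support0 (f := fun x : clique m.+1 => f (inr x))).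
  by rewrite -(leq_add2l N.+1) addn0 (leq_trans _ hf) // leq_add2r.
have [h _] := pv'; apply: le_trans (h f).
by rewrite f0 expr0n mulr0.
Qed.

Lemma chain_all : chain 0 -> forall N, chain N.
Proof. by move=> h; elim=> // N; apply: chain_step. Qed.

Lemma chain_bad : chain 0 -> locally_psd_not_psd l.
Proof.
have t1 := t_gt1; have [u0 u1 tu] := thr_u t1.
move=> h0 N; have [G [r [d [d1 d2 pv hN]]]] := chain_all h0 N.
have d0 : 0 < d by apply: lt_le_trans d1.
have c0 : 0 < d^-1 - 1 by rewrite subr_gt0 invf_gt1.
have y0 : 0 <= (l - 1) / (d^-1 - 1) by rewrite divr_ge0 ?ltW //; have := l2; lra.
have hm := archi_boundP y0; set m := Num.Def.archi_bound _ in hm.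
exists (glue r (mem (clique m.+1))); split.
  apply: pivot_kill pv d0 d2 _ _ => //.
  rewrite -ltr_pdivrMr // (lt_trans hm) // ltr_nat //.
move=> f; rewrite card_support_glue => hf.
have h := hN (fun x => f (inl x)) (leq_trans (leq_addr _ _) hf).
apply: le_trans (glue_clique_ge h).
by apply: sumr_ge0 => i _; apply: sqr_ge0.
Qed.
End GreedyChain.

(** * Starting trees with an admissible pivot *)

Section Gadgets.
Variables (R : realType) (t : R).
Hypotheses (t_gt1 : 1 < t) (t_le2 : t <= 2).
Local Notation l := (t + t^-1).

Lemma add_inv_mono (a b : R) : 1 <= a -> a <= b -> a + a^-1 <= b + b^-1.
Proof.
move=> a1 ab; have a0 : 0 < a by lra.
have b0 : 0 < b by lra.
rewrite -subr_ge0; have -> : b + b^-1 - (a + a^-1) = (b - a) * (a * b - 1) / (a * b).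
  by field; rewrite !gt_eqF.
by rewrite divr_ge0 ?mulr_ge0 //; nra.
Qed.

Lemma chain0 (d : R) : has_pivot l d -> t^-1 <= d -> d < 1 -> chain t 0.
Proof.
move=> [G [r pv]] d1 d2; exists G, r, d; split=> // f /support0 f0.
rewrite f0 expr0n /bq [X in _ <= X + _]big1 ?add0r => [|x _]; last by rewrite f0 mulr0.
by rewrite /= big1 // => x _; rewrite big1 // => y _; rewrite !f0 !mulr0.
Qed.

Let arm2 : has_pivot l (l - l^-1).
Proof.
have t1 := t_gt1; have [u0 u1 tu] := thr_u t1.
apply: pivot_join; rewrite ?addr_gt0 //; [exact: pivot_single|exact: pivot_single|lra].
Qed.

Let l_gt2 : 2 < l.
Proof. by have t1 := t_gt1; have [u0 u1 tu] := thr_u t1; nra. Qed.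

Let arm2_gt0 : 0 < l - l^-1.
Proof.
have h := l_gt2; have : l^-1 < 1 by rewrite invf_lt1 //; lra.
lra.
Qed.

Lemma add_leaf d : has_pivot l d -> has_pivot l (d - l^-1).
Proof. by move=> h; apply: pivot_join (pivot_single l) _ => //; have := l_gt2; lra. Qed.

Lemma add_arm2 d : has_pivot l d -> has_pivot l (d - (l - l^-1)^-1).
Proof. by move=> h; apply: pivot_join arm2 arm2_gt0. Qed.

(* The root carries [a] pendant vertices and [b] pendant paths of length 2; the
   inequality says that its pivot is at least [t^-1], with [w = t^2]. *)
Lemma gadget (a b : nat) :
  (a%:R * (t ^+ 4 + t ^+ 2 + 1) + b%:R * (t ^+ 2 + 1) ^+ 2 <=
     (t ^+ 2 + 1) * (t ^+ 4 + t ^+ 2 + 1)) ->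
  l ^+ 2 * (l ^+ 2 - 1) < a%:R * (l ^+ 2 - 1) + b%:R * l ^+ 2 + l * (l ^+ 2 - 1) ->
  chain t 0.
Proof.
have t1 := t_gt1; have [u0 u1 tu] := thr_u t1; have h2 := l_gt2; have harm := arm2_gt0.
have t0 : 0 < t by lra.
move=> h1 h3; have l0 : 0 < l by lra.
have l21 : 0 < l ^+ 2 - 1 by nra.
apply: (@chain0 (l - a%:R * l^-1 - b%:R * (l - l^-1)^-1)).
- elim: b {h1 h3} => [|b]; last by move/add_arm2; congr has_pivot; rewrite -natr1; ring.
  elim: a => [|a]; last by move/add_leaf; congr has_pivot; rewrite -natr1; ring.
  by rewrite !mul0r !subr0; apply: pivot_single.
- rewrite -subr_ge0.
  have -> : l - a%:R / l - b%:R / (l - l^-1) - t^-1 =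
     t * ((t ^+ 2 + 1) * (t ^+ 4 + t ^+ 2 + 1) - (a%:R * (t ^+ 4 + t ^+ 2 + 1) +
        b%:R * (t ^+ 2 + 1) ^+ 2)) / ((t ^+ 2 + 1) * (t ^+ 4 + t ^+ 2 + 1)).
    have n1 : t ^+ 2 + 1 != 0 by rewrite gt_eqF //; nra.
    have n2 : t ^+ 4 + t ^+ 2 + 1 != 0 by rewrite gt_eqF // !exprS expr0; nra.
    by field; rewrite n1 n2 gt_eqF.
  by rewrite divr_ge0 ?mulr_ge0 ?subr_ge0 ?(ltW t0) ?addr_ge0 ?exprn_ge0 ?(ltW t0).
- rewrite -subr_gt0.
  have -> : 1 - (l - a%:R / l - b%:R / (l - l^-1)) =
    (a%:R * (l ^+ 2 - 1) + b%:R * l ^+ 2 + l * (l ^+ 2 - 1) - l ^+ 2 * (l ^+ 2 - 1)) / (l * (l ^+ 2 - 1)).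
    have n1 : l ^+ 2 - 1 != 0 by rewrite gt_eqF.
    by move: l l0 n1 => x x0 n1; field; rewrite n1 gt_eqF.
  by rewrite divr_gt0 ?subr_gt0 // mulr_gt0.
Qed.

Lemma quartic_mono (s x B : R) : 0 <= s -> s <= 4 -> 2 <= x -> x <= B ->
  x ^+ 4 - x ^+ 3 - (1 + s) * x ^+ 2 + x <= B ^+ 4 - B ^+ 3 - (1 + s) * B ^+ 2 + B.
Proof.
move=> s0 s4 x2 xB.
(* Expansion at 2: for [0 <= s <= 4] all coefficients in [h = y - 2] are nonnegative, whence
   monotonicity. *)
pose q (h : R) := (17 - 4 * s) * h + (17 - s) * h ^+ 2 + 7 * h ^+ 3 + h ^+ 4.
have e y : y ^+ 4 - y ^+ 3 - (1 + s) * y ^+ 2 + y = 6 - 4 * s + q (y - 2) by rewrite /q; ring.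
have h0 : 0 <= x - 2 by lra.
have hB : x - 2 <= B - 2 by lra.
have hX n : (x - 2) ^+ n <= (B - 2) ^+ n.
  by apply: lerXn2r; rewrite ?nnegrE //; lra.
rewrite !e lerD2l /q; repeat apply: lerD; rewrite ?hX //; apply: ler_wpM2l; rewrite ?hX //; lra.
Qed.

Lemma gadget_upto (a b : nat) (d B : R) : (a + b <= 4)%N -> t <= d -> d + d^-1 <= B ->
  B ^+ 4 - B ^+ 3 - (1 + (a + b)%:R) * B ^+ 2 + B + a%:R < 0 ->
  (a%:R * (t ^+ 4 + t ^+ 2 + 1) + b%:R * (t ^+ 2 + 1) ^+ 2 <=
     (t ^+ 2 + 1) * (t ^+ 4 + t ^+ 2 + 1)) ->
  chain t 0.
Proof.
move=> ab td dB hB h; have t1 := t_gt1; apply: gadget h _.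
have lB : l <= B by apply: le_trans dB; apply: add_inv_mono => //; lra.
have := @quartic_mono (a + b)%:R l B (ler0n _ _) _ (ltW l_gt2) lB.
rewrite ler_nat => /(_ ab); move: hB; rewrite natrD; move: l => x hB hx.
rewrite -subr_lt0; apply: le_lt_trans hB.
have -> : x ^+ 2 * (x ^+ 2 - 1) - (a%:R * (x ^+ 2 - 1) + b%:R * x ^+ 2 + x * (x ^+ 2 - 1)) =
  x ^+ 4 - x ^+ 3 - (1 + (a%:R + b%:R)) * x ^+ 2 + x + a%:R by ring.
by rewrite lerD2r.
Qed.

(** The pivot of a gadget increases with [t], so the gadget serves the interval from where the pivot
    reaches [1 / t] to where it reaches 1. Five such intervals overlap and cover everything up to 2;
    the first one starts exactly at [w ^ 3 = w + 1]. *)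
Lemma gadget_exists : t ^+ 2 + 1 <= t ^+ 6 -> chain t 0.
Proof.
have t1 := t_gt1; have t2 := t_le2.
have e4 : t ^+ 4 = t ^+ 2 * t ^+ 2 by rewrite -exprD.
have e6 : t ^+ 6 = t ^+ 2 * t ^+ 2 * t ^+ 2 by rewrite -!exprD.
rewrite e6 => h6.
have wlow (c : R) : 1 <= c -> c < t -> c ^+ 2 <= t ^+ 2.
  by move=> c1 ct; apply: lerXn2r; rewrite ?nnegrE; lra.
case: (lerP t (33 / 25)) => c1.
  apply: (@gadget_upto 1 1 (33 / 25) (52 / 25)) => //; first by lra.
    by lra.
  by rewrite e4; move: (t ^+ 2) h6 => w; rewrite !expr2; nra.
have w1 := wlow _ _ c1; case: (lerP t (147 / 100)) => c2.
  apply: (@gadget_upto 0 2 (147 / 100) (54 / 25)) => //; first by lra.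
    by lra.
  by rewrite e4; move: (t ^+ 2) w1 => w; rewrite !expr2; nra.
have w2 := wlow _ _ c2; case: (lerP t (42 / 25)) => c3.
  apply: (@gadget_upto 3 0 (42 / 25) (57 / 25)) => //; first by lra.
    by lra.
  by rewrite e4; move: (t ^+ 2) w2 => w; rewrite !expr2; nra.
have w3 := wlow _ _ c3; case: (lerP t (177 / 100)) => c4.
  apply: (@gadget_upto 2 1 (177 / 100) (117 / 50)) => //; first by lra.
    by lra.
  by rewrite e4; move: (t ^+ 2) w3 => w; rewrite !expr2; nra.
have w4 := wlow _ _ c4.
apply: (@gadget_upto 4 0 2 (5 / 2)) => //; first by lra.
  by lra.
by rewrite e4; move: (t ^+ 2) w4 => w; rewrite !expr2; nra.
Qed.
End Gadgets.

Section NecessaryCondition.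
Variables (R : realType) (s : R).
Hypotheses (s_gt1 : 1 < s) (s6 : s ^+ 6 = s ^+ 2 + 1).

Lemma bad_small l : s + s^-1 <= l -> l <= 5 / 2 -> locally_psd_not_psd l.
Proof.
have s1 := s_gt1; have [v0 v1 sv] := thr_u s1 => h1 h2.
have l2 : 2 < l by nra.
(* [t] is the larger root of [t + 1 / t = l], and [l <= 5 / 2] amounts to [t <= 2]. *)
pose D := Num.sqrt (l ^+ 2 - 4); pose t := (l + D) / 2.
have D2 : D ^+ 2 = l ^+ 2 - 4 by rewrite sqr_sqrtr //; nra.
have D0 : 0 <= D by apply: sqrtr_ge0.
have t1 : 1 < t by rewrite /t; lra.
have tl : t + t^-1 = l.
  have t0 : t != 0 by rewrite gt_eqF //; lra.
  apply: (mulIf t0); rewrite mulrDl mulVf // /t.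
  have -> : (l + D) / 2 * ((l + D) / 2) = (l ^+ 2 + 2 * l * D + D ^+ 2) / 4 by field.
  by rewrite D2; field.
have t2 : t <= 2 by rewrite /t; nra.
clearbody t; have st : s <= t.
  rewrite leNgt; apply/negP => ts.
  have st1 : 1 < s * t by nra.
  have : 0 < (s - t) * (s * t - 1) / (s * t).
    by apply: divr_gt0; apply: mulr_gt0; lra.
  have -> : (s - t) * (s * t - 1) / (s * t) = s + s^-1 - (t + t^-1).
    by field; rewrite !gt_eqF //; lra.
  by rewrite tl; lra.
rewrite -tl; apply: chain_bad => //; apply: gadget_exists => //.
have w : s ^+ 2 <= t ^+ 2 by apply: lerXn2r; rewrite ?nnegrE; lra.
have s21 : 1 <= s ^+ 2 by rewrite expr_ge1 // ltW; lra.
have e6 (x : R) : x ^+ 6 = x ^+ 2 * x ^+ 2 * x ^+ 2 by rewrite -!exprD.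
move: s6 w s21; rewrite !e6; move: (s ^+ 2) (t ^+ 2) => x y hx xy x1.
have : 0 <= (y - x) * (y * y + x * y + (x * x - 1)).
  have xx : 1 <= x * x by nra.
  have yy : 0 <= y * y by apply: mulr_ge0; lra.
  have xy0 : 0 <= x * y by apply: mulr_ge0; lra.
  by apply: mulr_ge0; lra.
have -> : (y - x) * (y * y + x * y + (x * x - 1)) = y * y * y - y - (x * x * x - x) by ring.
lra.
Qed.

Theorem bad_above l : s + s^-1 <= l -> locally_psd_not_psd l.
Proof.
move=> sl0; have s1 := s_gt1; have [v0 v1 sv] := thr_u s1.
have s65 : s + s^-1 <= 21 / 10.
  have h : s <= 6 / 5 by rewrite ltW // sextic_lt // s6.
  by have := add_inv_mono (ltW s1) h; lra.
have s2 : 2 < s + s^-1 by nra.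
have : l ^+ 2 <= (Num.Def.archi_bound (l ^+ 2))%:R.
  by apply/ltW/archi_boundP/sqr_ge0.
(* Induction on a bound for [l ^ 2]: replacing [l] by [l - 1 / l] lowers the square by more than 1,
   and for [l > 5 / 2] the new value exceeds [21 / 10], so it is still above the threshold. *)
move: (Num.Def.archi_bound _) sl0 => n sl ln; elim: n l ln sl => [|n IHn] l ln sl.
  have : 0 < l ^+ 2 by rewrite exprn_gt0 //; lra.
  by rewrite ltNge ln.
have [l5|l5] := lerP l (5 / 2); first exact: bad_small.
have lv : l * l^-1 = 1 by rewrite divff // gt_eqF //; lra.
have lv0 : 0 < l^-1 by rewrite invr_gt0; lra.
have lv1 : l^-1 < 2 / 5 by nra.
apply: leafy_transfer; first by lra.
apply: IHn; last by lra.
by move: ln; rewrite -natr1 !expr2; nra.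
Qed.
End NecessaryCondition.

(** * Smallest eigenvalue and semidefiniteness *)

Section Spectral.
Variables (R : realType) (n : nat).
Implicit Types (A B : 'M[R]_n) (x y : 'rV[R]_n).

Definition bil B x y : R := (x *m B *m y^T) 0 0.
Definition sqn x : R := (x *m x^T) 0 0.

Lemma bilE B x y : bil B x y = \sum_i \sum_j B i j * x 0 i * y 0 j.
Proof.
rewrite /bil mxE exchange_big /=; apply: eq_bigr => j _; rewrite !mxE mulr_suml.
by apply: eq_bigr => i _; ring.
Qed.

Lemma sqnE x : sqn x = \sum_i x 0 i ^+ 2.
Proof. by rewrite /sqn mxE; apply: eq_bigr => i _; rewrite mxE expr2. Qed.

Lemma sqn_ge0 x : 0 <= sqn x.
Proof. by rewrite sqnE; apply: sumr_ge0 => i _; apply: sqr_ge0. Qed.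

Lemma sqn_eq0 x : sqn x = 0 -> x = 0.
Proof.
move=> /eqP; rewrite sqnE psumr_eq0 => [/allP h|i _]; last exact: sqr_ge0.
apply/rowP => i; rewrite mxE; apply/eqP.
by have := h i (mem_index_enum _); rewrite /= sqrf_eq0.
Qed.

Lemma sqn_gt0 x : x != 0 -> 0 < sqn x.
Proof.
move=> x0; rewrite lt_neqAle sqn_ge0 andbT eq_sym; apply: contraNneq x0 => /sqn_eq0 ->.
exact: eqxx.
Qed.

Lemma bil_linl B a b x x' y : bil B (a *: x + b *: x') y = a * bil B x y + b * bil B x' y.
Proof. by rewrite /bil mulmxDl mulmxDl -!scalemxAl !mxE. Qed.

Lemma bil_linr B a b x y y' : bil B x (a *: y + b *: y') = a * bil B x y + b * bil B x y'.
Proof. by rewrite /bil linearD /= !linearZ /= mulmxDr -!scalemxAr !mxE. Qed.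

Lemma bilC B x y : B^T = B -> bil B x y = bil B y x.
Proof.
move=> hB; have -> : bil B x y = (x *m B *m y^T)^T 0 0 by rewrite mxE.
by rewrite !trmx_mul trmxK hB mulmxA.
Qed.

Definition entry_bound B : R := \sum_i \sum_j `|B i j|.

Lemma bil_bound B x : `|bil B x x| <= entry_bound B * sqn x.
Proof.
have hx i : x 0 i ^+ 2 <= sqn x.
  by rewrite sqnE (bigD1 i) //= lerDl; apply: sumr_ge0 => j _; apply: sqr_ge0.
rewrite bilE /entry_bound mulr_suml; apply: le_trans (ler_norm_sum _ _ _) _.
apply: ler_sum => i _; rewrite mulr_suml; apply: le_trans (ler_norm_sum _ _ _) _.
apply: ler_sum => j _; rewrite -mulrA normrM ler_wpM2l //.
have := hx i; have := hx j; rewrite ler_norml.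
have := sqr_ge0 (x 0 i + x 0 j); have := sqr_ge0 (x 0 i - x 0 j).
by move: (x 0 i) (x 0 j) (sqn x) => a b s; rewrite !expr2; nra.
Qed.

(* Cauchy-Schwarz for [B], applied to [x] and [x B^-1]. *)
Lemma psd_unit_gap B : B^T = B -> (forall x, 0 <= bil B x x) -> B \in unitmx ->
  exists2 c : R, 0 < c & forall x, c * sqn x <= bil B x x.
Proof.
move=> hB psdB uB; set C := entry_bound (invmx B).
have C0 : 0 <= C by apply: sumr_ge0 => i _; apply: sumr_ge0.
exists (C + 1)^-1; first by rewrite invr_gt0; lra.
move=> x; rewrite mulrC ler_pdivrMr; last by lra.
pose y := x *m invmx B.
have hBi : (invmx B)^T = invmx B by rewrite trmx_inv hB.
have e1 : bil B x y = sqn x.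
  by rewrite /bil /y trmx_mul hBi mulmxA -(mulmxA x) mulmxV // mulmx1.
have e2 : bil B y y = bil (invmx B) x x.
  by rewrite /bil /y trmx_mul hBi -(mulmxA x) mulVmx // mulmx1 mulmxA.
have mn : bil B x y ^+ 2 <= bil B x x * bil B y y.
  apply: minor2 => a b; have := psdB (a *: x + b *: y).
  rewrite bil_linl !bil_linr (bilC y x hB).
  by move=> h; apply: le_trans h _; rewrite le_eqVlt; apply/orP; left; apply/eqP; ring.
have := bil_bound (invmx B) x; rewrite -/C ler_norml => /andP[_ hC].
have [->|x0] := eqVneq x 0.
  have -> : sqn 0 = 0 by rewrite sqnE big1 // => i _; rewrite mxE expr0n.
  by rewrite mulr_ge0 // ?addr_ge0.
have s0 := sqn_gt0 x0; have b0 := psdB x.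
move: mn; rewrite e1 e2 => mn.
have : sqn x ^+ 2 <= bil B x x * (C * sqn x) by apply: le_trans mn _; rewrite ler_wpM2l.
rewrite expr2 mulrA ler_pM2r // => h; apply: le_trans h _.
by rewrite ler_wpM2l // lerDl.
Qed.

Lemma bil_shift A (c : R) x : bil (A - c%:M) x x = bil A x x - c * sqn x.
Proof.
by rewrite /bil /sqn mulmxBr mulmxBl mul_mx_scalar -scalemxAl !mxE.
Qed.

(** In place of compactness: the supremum of all lower bounds of the Rayleigh quotient is again a
    lower bound. If it were not an eigenvalue, the shifted matrix would be positive and invertible,
    and [psd_unit_gap] would improve the bound. *)
Theorem smallest_eigenvalue_exists A : (0 < n)%N -> A^T = A ->
  exists2 mu, smallest_eigenvalue A mu & forall x, mu * sqn x <= bil A x x.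
Proof.
move=> n0 hA; pose S : classical_sets.set R := fun c => forall x, c * sqn x <= bil A x x.
pose i0 : 'I_n := Ordinal n0.
have d1 : sqn (delta_mx 0 i0) = 1.
  rewrite sqnE (bigD1 i0) //= big1 => [|i ii]; first by rewrite mxE !eqxx expr1n addr0.
  by rewrite mxE (negbTE ii) andbF expr0n.
have ub : classical_sets.has_ubound S.
  by exists (bil A (delta_mx 0 i0) (delta_mx 0 i0)) => c /(_ (delta_mx 0 i0)); rewrite d1 mulr1.
have ne : exists c, S c.
  exists (- entry_bound A) => x; have := bil_bound A x; rewrite ler_norml mulNr.
  by case/andP.
have inS : S (sup S).
  move=> x; have [->|x0] := eqVneq x 0.
    have -> : sqn 0 = 0 by rewrite sqnE big1 // => i _; rewrite mxE expr0n.
    by rewrite mulr0 /bil !mul0mx mxE.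
  rewrite -ler_pdivlMr ?sqn_gt0 //; apply: ge_sup => // c /(_ x).
  by rewrite ler_pdivlMr // sqn_gt0.
exists (sup S) => //; split; last first.
  move=> nu /eigenvalueP[v hv v0]; have := inS v.
  by rewrite /bil hv -scalemxAl mxE -/(sqn v) ler_pM2r ?sqn_gt0.
rewrite /eigenvalue /eigenspace kermx_eq0 row_free_unit; apply/negP => uB.
have hB : (A - (sup S)%:M)^T = A - (sup S)%:M by rewrite linearB /= hA tr_scalar_mx.
have pB x : 0 <= bil (A - (sup S)%:M) x x by rewrite bil_shift subr_ge0.
have [c c0 hc] := psd_unit_gap hB pB uB.
have : S (sup S + c).
  by move=> x; have := hc x; rewrite bil_shift; lra.
by move=> /(ub_le_sup ub); lra.
Qed.
End Spectral.

Section FamilyPsd.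
Variables (R : realType) (G : sgraph) (l : R).

Let vec_of (f : G -> R) : 'rV[R]_#|G| := \row_i f (enum_val i).

Lemma bq_bil (f : G -> R) :
  bq l f f = bil (signed_adjacency R G) (vec_of f) (vec_of f) + l * sqn (vec_of f).
Proof.
rewrite /bq addrC bilE sqnE mulr_sumr; congr (_ + _); last first.
  rewrite (reindex (@enum_val _ (mem G))) /=; last by apply: onW_bij; apply: enum_val_bij.
  by apply: eq_bigr => i _; rewrite mxE; ring.
rewrite (reindex (@enum_val _ (mem G))) /=; last by apply: onW_bij; apply: enum_val_bij.
apply: eq_bigr => i _.
rewrite (reindex (@enum_val _ (mem G))) /=; last by apply: onW_bij; apply: enum_val_bij.
apply: eq_bigr => j _; rewrite !mxE /lab; congr (_ * _ * _).
by case: (sg_label _ _) => [[]|].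
Qed.

Lemma vec_ofK (x : 'rV[R]_#|G|) : exists f, vec_of f = x.
Proof.
exists (fun v => x 0 (enum_rank v)); apply/rowP => i.
by rewrite mxE enum_valK.
Qed.

Theorem family_psd : smallest_eigenvalue_family l G <-> @psd R G l.
Proof.
have hA : (signed_adjacency R G)^T = signed_adjacency R G.
  by apply/matrixP => i j; rewrite !mxE sg_label_sym.
split.
  (* Without vertices there is no eigenvalue to use, but then the form is 0. *)
  move=> h f; rewrite bq_bil; have [n0|] := posnP #|G|.
    suff -> : vec_of f = 0.
      by rewrite /bil /sqn !mul0mx mxE mulr0 addr0.
    apply/rowP => i; have := ltn_ord i; by rewrite {2}n0.
  move=> n0; have [mu hmu hq] := smallest_eigenvalue_exists n0 hA.
  have := h mu hmu; have := hq (vec_of f); have := sqn_ge0 (vec_of f); nra.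
move=> h mu [/eigenvalueP[v hv v0] _].
have [f hf] := vec_ofK v; have := h f; rewrite bq_bil hf {1}/bil hv -scalemxAl mxE -/(sqn v).
by have := sqn_gt0 v0; nra.
Qed.
End FamilyPsd.

(** * Long tails of small subgraphs *)

Definition connected_on (G : sgraph) (W : {set G}) := forall A : {set G},
  A \subset W -> A != set0 -> A != W -> exists x y, [/\ x \in A, y \in W :\: A & lab x y != 0].

Lemma connected_induced (G : sgraph) (W : {set G}) :
  connected_on W -> connected (induced W).
Proof.
move=> conn A A0 AT; pose B := @in_induced G W @: A.
have memB x : (in_induced x \in B) = (x \in A) by rewrite mem_imset //; apply: val_inj.
have [|||x [y [xB]]] := conn B.
- by apply/subsetP => _ /imsetP[z _ ->]; apply: valP.
- by case/set0Pn: A0 => z zA; apply/set0Pn; exists (in_induced z); rewrite memB.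
- apply: contra AT => /eqP BW.
  by apply/eqP/setP => z; rewrite -memB BW inE; apply: valP.
rewrite inE => /andP[yB yW] xy; case/imsetP: xB xy => x' x'A -> xy.
have [y' hy'] := in_inducedP yW; rewrite -hy' memB in yB.
by exists x', y'; split=> //; rewrite -hy' in xy.
Qed.

Lemma connected_onU1 (G : sgraph) (W : {set G}) (x w : G) : connected_on W ->
  w \in W -> lab w x != 0 -> connected_on (x |: W).
Proof.
move=> conn wW wx A AW A0 AN; have xw : lab x w != 0 by rewrite lab_sym.
have [xW|xW] := boolP (x \in W).
  have e : x |: W = W by apply/setUidPr; rewrite sub1set.
  by rewrite e in AW AN *; apply: conn.
have [xA|xA] := boolP (x \in A).
  have [wA|wA] := boolP (w \in A); last first.
    by exists x, w; split=> //; rewrite !inE wA wW orbT.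
  have [|||y [z [yA zW yz]]] := conn (A :\ x).
  - by rewrite subDset.
  - by apply/set0Pn; exists w; rewrite !inE wA andbT; apply: contraNneq xW => <-.
  - by apply: contraNneq AN => h; rewrite -h setD1K.
  exists y, z; split=> //; first by move: yA; rewrite inE => /andP[].
  move: zW; rewrite !inE negb_and negbK => /andP[/orP[/eqP zx|->] zW]; last by rewrite zW orbT.
  by rewrite zx (negbTE xW) in zW.
have AW' : A \subset W.
  apply/subsetP => y yA; have := subsetP AW y yA; rewrite in_setU1 => /orP[/eqP yx|//].
  by rewrite -yx yA in xA.
have [AeW|AneW] := eqVneq A W.
  by exists w, x; rewrite AeW !inE wW xW eqxx.
have [y [z [yA zW yz]]] := conn A AW' A0 AneW.
by exists y, z; split=> //; move: zW; rewrite !inE => /andP[-> ->]; rewrite orbT.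
Qed.

Lemma critical_subset (R : realType) (l : R) (G : sgraph) (U : {set G}) : ~ psd_on l U ->
  exists W : {set G}, [/\ W \subset U, ~ psd_on l W, W != set0 & connected_on W].
Proof.
move=> nU; have [|H [[phi [inj hl]] cr]] := @critical_exists R l (induced U).
  by move/psd_induced.
have conn := critical_connected cr; case: cr => nH _.
pose psi x := in_induced (phi x).
have psi_inj : injective psi by move=> x y /val_inj /inj.
have psi_lab x y : sg_label (psi x) (psi y) = sg_label x y.
  by rewrite /psi in_induced_lab hl.
have nW : ~ psd_on l (psi @: setT).
  by move/(psd_on_push psi_inj psi_lab)/psd_onT.
exists (psi @: setT); split=> //.
- by apply/subsetP => _ /imsetP[x _ ->]; apply: valP.
- apply/negP => /eqP h; apply: nW => f hf.
  have f0 x : f x = 0 by apply: hf; rewrite h inE.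
  rewrite /bq [X in _ <= X + _]big1 ?add0r => [|x _]; last by rewrite f0 mulr0.
  by rewrite big1 // => x _; rewrite big1 // => y _; rewrite !f0 !mulr0.
move=> A AW A0 AN.
have memA x : (x \in psi @^-1: A) = (psi x \in A) by rewrite inE.
have [||x [y [xA yA xy]]] := conn (psi @^-1: A).
- case/set0Pn: A0 => a aA; have /imsetP[b _ ab] := subsetP AW a aA.
  by apply/set0Pn; exists b; rewrite memA -ab.
- apply: contraNneq AN => h; rewrite eqEsubset AW; apply/subsetP => _ /imsetP[x _ ->].
  by rewrite -memA h.
exists (psi x), (psi y); split; rewrite ?inE -?memA ?yA ?imset_f //.
by rewrite /lab psi_lab.
Qed.

Section Tails.
Variables (R : realType) (t l0 : R).
Hypotheses (t_gt1 : 1 < t) (t6 : t ^+ 6 < t ^+ 2 + 1).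
Local Notation u := (t^-1).
Local Notation l := (t + u).
Hypothesis l0_lt : l0 < l.

Lemma tailed_set (G : sgraph) (W : {set G}) (p : G) : p \in W -> connected_on W ->
  (forall f : G -> R, (forall x, x \notin W -> f x = 0) -> 0 <= bq l f f - u * f p ^+ 2) ->
  psd_on (2 : R) W.
Proof.
move=> pW conn h; apply/psd_induced; have [p' hp'] := in_inducedP pW.
apply: (@tailed_psd2 R _ p' t t_gt1 t6 _ (connected_induced conn)) => f.
rewrite /bqt -(bq_push (@in_induced_inj _ W) (@in_induced_lab _ W)) -mulrA -expr2.
rewrite -(push_phi (@in_induced_inj _ W) f p') hp'; apply: h => x xW.
by apply: (push0 (U := setT)); rewrite ?imset_induced // => y; rewrite inE.
Qed.

(* The weights decay by [-/+ 1 / t] along the geodesic, so that all its vertices but the first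
   and last ones contribute nothing. *)
Lemma path_tail (G : sgraph) (W : {set G}) (k : nat) (p : nat -> G) (f : G -> R) (j : nat) :
  geodesic W k p -> (j < k)%N -> (forall x, x \notin p 1%N |: W -> f x = 0) ->
  exists F : G -> R, [/\ F (p 1%N) = f (p 1%N),
    F (p j.+1) ^+ 2 = f (p 1%N) ^+ 2 * u ^+ (2 * j),
    forall x, x \notin W :|: [set p i.+1 | i : 'I_j.+1] -> F x = 0 &
    bq l F F = bq l f f + f (p 1%N) ^+ 2 * (u ^+ (2 * j).+1 - u)].
Proof.
have t1 := t_gt1; have [u0 u1 tu] := thr_u t1.
move=> geo jk hf; have [g1 g2] := geo.
elim: j jk => [|j IHj] jk.
  exists f; split=> //; rewrite ?muln0 ?mulr1 ?expr1 ?subrr ?mulr0 ?addr0 // => x xn.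
  apply: hf; apply: contra xn; rewrite in_setU1 in_setU => /orP[/eqP ->|->] //.
  by apply/orP; right; apply/imsetP; exists ord0.
have [F [F1 Fj Fs FQ]] := IHj (ltnW jk).
set q := p j.+1 in Fj; set q' := p j.+2.
have Sb x : F x != 0 -> x != q -> x \in ball W j.
  move=> Fx xq; have : x \in W :|: [set p i.+1 | i : 'I_j.+1].
    by apply: contraNT Fx => /Fs ->.
  rewrite in_setU => /orP[xW|/imsetP[i _ xi]].
    by apply: (subsetP (ball_mono W (leq0n j))).
  have ij : (i < j)%N.
    rewrite ltn_neqAle -ltnS ltn_ord andbT; apply: contraNneq xq => ij.
    by rewrite xi ij.
  have [|pb _] := g1 i.+1; first by rewrite /= (leq_trans ij) // ltnW // ltnW.
  by rewrite xi; apply: (subsetP (ball_mono W ij)).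
have hj2 : (0 < j.+2 <= k)%N by [].
have sep x : x \in ball W j -> lab x q' = 0 /\ x != q' by apply: (geodesic_sep geo hj2).
have qq' : lab q q' != 0 by apply: g2.
have qn : q != q' by apply: contraNneq qq' => <-; rewrite lab_irr.
have Fq' : F q' = 0.
  apply/eqP/negPn/negP => h; have h' : q' != q by rewrite eq_sym.
  by have [_] := sep _ (Sb _ h h'); rewrite eqxx.
pose c := - (lab q q')%:~R * u * F q : R.
have lab2 : ((lab q q')%:~R : R) ^+ 2 = 1.
  by rewrite -rmorphXn /=; case: (labP q q') qq' => ->.
have cross : bq l F (dl R q') = (lab q q')%:~R * F q.
  rewrite bqC bq_dl Fq' mulr0 add0r (bigD1 q) //= lab_sym big1 ?addr0 // => y yq.
  have [->|Fy] := eqVneq (F y) 0; first by rewrite mulr0.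
  by have [e _] := sep _ (Sb _ Fy yq); rewrite lab_sym e mul0r.
exists (fun x => 1 * F x + c * dl R q' x); split.
- rewrite -F1 /dl; case: (eqVneq (p 1%N) q') => [e|_]; last by rewrite mul1r mulr0 addr0.
  exfalso; have [|_] := g1 j.+2; first by [].
  rewrite /= -/q' -e => /negP; apply; have [|h _] := g1 1%N; first by rewrite /= (leq_trans _ jk).
  exact: (subsetP (ball_mono W (ltn0Sn j))).
- rewrite -/q' Fq' /dl eqxx mulr0 add0r mulr1 /c !exprMn sqrrN lab2 mul1r Fj.
  by rewrite mulnS addnC exprD mulrCA mulrC -mulrA [_ * u ^+ 2]mulrC mulrA; ring.
- move=> x; rewrite in_setU negb_or => /andP[xW xi].
  rewrite Fs; last first.
    rewrite in_setU (negbTE xW) /=; apply: contra xi => /imsetP[i _ ->].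
    by apply/imsetP; exists (widen_ord (leqnSn _) i).
  rewrite /dl; case: (eqVneq x q') => [e|_]; last by rewrite !mulr0 addr0.
  by case/negP: xi; apply/imsetP; exists ord_max.
- rewrite bq_linl !bq_linr (bqC l (dl R q')) cross bq_dl2 eqxx FQ /c.
  transitivity (bq l f f + f (p 1%N) ^+ 2 * (u ^+ (2 * j).+1 - u) +
    ((lab q q')%:~R ^+ 2 * u ^+ 2 * (t + u) - 2 * u * (lab q q')%:~R ^+ 2) * F q ^+ 2); first by ring.
  rewrite lab2 Fj.
  have e1 : u ^+ (2 * j.+1).+1 = u ^+ (2 * j) * u ^+ 3 by rewrite -exprD; congr (_ ^+ _); lia.
  have e2 : u ^+ (2 * j).+1 = u ^+ (2 * j) * u by rewrite exprSr.
  have ut : u ^+ 2 * (t + u) = u + u ^+ 3 by rewrite mulrDr expr2 -mulrA [u * t]mulrC tu; ring.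
  by rewrite e1 e2 mul1r ut; ring.
Qed.

Lemma exp_small (c : R) : 0 < c -> exists k : nat, u ^+ k <= c.
Proof.
have t1 := t_gt1; have [u0 u1 tu] := thr_u t1 => c0.
have [n hn] : exists n : nat, c^-1 <= n%:R * (t - 1) + 1.
  have h : 0 <= c^-1 / (t - 1) by rewrite divr_ge0 ?invr_ge0 ?ltW // subr_gt0.
  exists (Num.Def.archi_bound (c^-1 / (t - 1))).
  have := archi_boundP h; rewrite ltr_pdivrMr ?subr_gt0 //; lra.
exists n; have bern : n%:R * (t - 1) + 1 <= t ^+ n.
  elim: (n) => [|m IH]; first by rewrite mul0r add0r expr0.
  have m0 : 0 <= m%:R * ((t - 1) * (t - 1)) by rewrite mulr_ge0 ?ler0n // -expr2 sqr_ge0.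
  have := ler_wpM2l (_ : 0 <= t) IH; rewrite exprS -natr1 => /(_ _) h.
  by apply: le_trans (h _); lra.
by rewrite exprVn -[leRHS]invrK lef_pV2 ?posrE ?exprn_gt0 ?invr_gt0 // ?(le_trans hn) //; lra.
Qed.

(** Cutting the infinite tail after [k + 1] vertices leaves the error [u ^ (2 k + 1) * f (p 1) ^ 2];
    the slack [l - l0] on the same vertex [p 1] pays for it. *)
Lemma path_tail_psd2 (k : nat) : u ^+ (2 * k).+1 <= l - l0 ->
  forall (G : sgraph) (W : {set G}) (p : nat -> G) N, geodesic W k.+1 p ->
    connected_on W -> loc_psd l0 N G -> (#|W| + k.+1 <= N)%N -> psd_on (2 : R) W.
Proof.
move=> hk G W p N geo conn loc hN; have [g1 g2] := geo.
have [|p1b p1n] := g1 1%N; first by [].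
apply: (psd_on_sub (V := p 1%N |: W)); first exact: subsetUr.
apply: (@tailed_set _ _ (p 1%N)); first by rewrite in_setU1 eqxx.
  move: p1b; rewrite /= /grow_set in_setU (negbTE p1n) /= => /bigcupP[w wW].
  by rewrite inE; apply: connected_onU1.
move=> f hf; have [F [F1 _ Fs FQ]] := path_tail geo (ltnSn k) hf.
have cS : (#|W :|: [set p i.+1 | i : 'I_k.+1]| <= N)%N.
  apply: leq_trans hN; apply: leq_trans (leq_card_setU _ _) _; rewrite leq_add2l.
  by apply: leq_trans (leq_imset_card _ _) _; rewrite card_ord.
have := loc _ cS F Fs; have := bq_shift l0 l F F; rewrite FQ.
set q := f (p 1%N) => e h0.
have Fq : q ^+ 2 <= \sum_x F x * F x.
  rewrite (bigD1 (p 1%N)) //= F1 -expr2 lerDl; apply: sumr_ge0 => x _.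
  by rewrite -expr2 sqr_ge0.
have q0 := sqr_ge0 q.
have h1 : q ^+ 2 * u ^+ (2 * k).+1 <= q ^+ 2 * (l - l0) by rewrite ler_wpM2l.
have h2 : (l - l0) * q ^+ 2 <= (l - l0) * \sum_x F x * F x.
  by rewrite ler_wpM2l // subr_ge0 ltW.
by move: e h0 h1 h2; rewrite mulrBr; lra.
Qed.

(* Spreading the value at [p] evenly over [A] gives it the effective weight [(l - 1) / n + 1 <= t]. *)
Lemma clique_tail_psd2 (n : nat) : (0 < n)%N -> l - 1 <= n%:R * (t - 1) ->
  forall (G : sgraph) (W A : {set G}) (x : G) N, x \in W -> connected_on W ->
    A \subset nbrs x -> [disjoint A & W] -> #|A| = n ->
    (forall y z, y \in A -> z \in A -> y != z -> lab y z = 1) ->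
    (forall y z w, y \in A -> z \in A -> w \in W -> lab w y = lab w z) ->
    loc_psd l0 N G -> (#|W| + n <= N)%N -> psd_on (2 : R) W.
Proof.
move=> n0 hn G W A x N xW conn Ax disj cA hA hom loc hN.
have t1 := t_gt1; have [u0 u1 tu] := thr_u t1.
have /set0Pn[p pA] : A != set0 by rewrite -card_gt0 cA.
have pW : p \notin W by rewrite (disjointFr disj pA).
apply: (psd_on_sub (V := p |: W)); first exact: subsetUr.
apply: (@tailed_set _ _ p); first by rewrite in_setU1 eqxx.
  by apply: connected_onU1 xW _ => //; have := subsetP Ax p pA; rewrite inE.
move=> f hf.
pose g y := if y \in W then f y else 0.
pose a y : R := if y \in A then 1 else 0.
have g0 y : y \in A -> g y = 0 by move=> yA; rewrite /g (disjointFr disj yA).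
have a0 y : y \notin A -> a y = 0 by rewrite /a => /negbTE ->.
have ef : f =1 (fun y => 1 * g y + f p * dl R p y).
  move=> y; rewrite /g /dl; have [->|yp] := eqVneq y p.
    by rewrite (negbTE pW) mul1r add0r mulr1.
  rewrite mulr0 addr0 mul1r; case: ifP => // yW; apply: hf.
  by rewrite in_setU1 negb_or yp yW.
have sa : \sum_y a y = n%:R by rewrite -big_mkcond /= sumr_const cA.
have sa2 : \sum_y a y ^+ 2 = n%:R.
  by rewrite -sa; apply: eq_bigr => y _; rewrite /a; case: ifP; rewrite ?expr1n ?expr0n.
have Qa : bq l a a = (l - 1) * n%:R + n%:R ^+ 2.
  by rewrite (bq_homog l hA a0) sa sa2 mul1r.
have Qgy y : y \in A -> bq l g (dl R y) = bq l g (dl R p).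
  move=> yA; rewrite ![bq l g _]bqC !bq_dl !g0 //; congr (_ + _).
  apply: eq_bigr => w _; have [wW|wW] := boolP (w \in W).
    by rewrite ![lab _ w]lab_sym (hom y p w).
  by rewrite /g (negbTE wW) !mulr0.
have Qga : bq l g a = n%:R * bq l g (dl R p).
  rewrite bqC bq_expand -sa mulr_suml; apply: eq_bigr => y _.
  have [yA|yA] := boolP (y \in A); last by rewrite a0 // !mul0r.
  by rewrite bqC Qgy.
have key : 0 <= bq l (fun y => 1 * g y + (f p / n%:R) * a y) (fun y => 1 * g y + (f p / n%:R) * a y).
  apply: (psd_on_mono (ltW l0_lt) (loc (W :|: A) _)).
    by apply: leq_trans (leq_card_setU _ _) _; rewrite cA.
  move=> y; rewrite in_setU negb_or => /andP[yW yA].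
  by rewrite /g (negbTE yW) a0 // !mulr0 addr0.
have nR : n%:R != 0 :> R by rewrite pnatr_eq0 -lt0n.
rewrite (bq_ext l ef ef) bq_linl !bq_linr (bqC l (dl R p)) bq_dl2 eqxx.
move: key; rewrite bq_linl !bq_linr (bqC l a) Qga Qa.
set Qg := bq l g g; set Qgp := bq l g _; set q := f p.
have -> : 1 * (1 * Qg + q / n%:R * (n%:R * Qgp)) + q / n%:R * (1 * (n%:R * Qgp) +
  q / n%:R * ((l - 1) * n%:R + n%:R ^+ 2)) = Qg + 2 * q * Qgp + q ^+ 2 * ((l - 1) / n%:R + 1).
  have tn0 : t != 0 by rewrite gt_eqF //; lra.
  by field; rewrite nR tn0.
have h : (l - 1) / n%:R <= t - 1 by rewrite ler_pdivrMr ?ltr0n // mulrC.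
have := ler_wpM2l (sqr_ge0 q) h.
by move: ((l - 1) / n%:R) => v; lra.
Qed.

Lemma connected_hull (G : sgraph) (W : {set G}) i x : connected_on W -> x \in ball W i ->
  exists W' : {set G}, [/\ W \subset W', x \in W', connected_on W' & (#|W'| <= #|W| + i)%N].
Proof.
move=> conn; elim: i x => [|i IHi] x; first by exists W; rewrite addn0.
rewrite /= /grow_set in_setU => /orP[xb|/bigcupP[y yb]].
  have [W' [h1 h2 h3 h4]] := IHi _ xb; exists W'; split=> //.
  by apply: leq_trans h4 _; rewrite addnS.
rewrite inE => yx; have [W' [h1 h2 h3 h4]] := IHi _ yb; exists (x |: W'); split.
- by apply: subset_trans h1 _; apply: subsetUr.
- by rewrite in_setU1 eqxx.
- exact: connected_onU1 h3 h2 yx.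
- by apply: leq_trans (leq_card_setU _ _) _; rewrite cards1 addnS add1n ltnS.
Qed.

(** If the degrees near [W] are bounded, a ball around [W] cannot exhaust a large graph and a
    geodesic leaves it. Otherwise a vertex of high degree is joined to [W] by at most [k] further
    vertices, and among its neighbours with equal labels towards the enlarged set there is a large
    positive clique. *)
Lemma exists_tail_psd2 (h : nat) : l0 < 11 / 5 -> exists N M, forall G : sgraph,
  connected G -> loc_psd l0 N G -> (M < #|G|)%N ->
  forall U : {set G}, (#|U| <= h)%N -> psd_on (2 : R) U.
Proof.
move=> l0s; have t1 := t_gt1.
have [k hk0] : exists k, u ^+ k <= l - l0 by apply: exp_small; rewrite subr_gt0.
have hk : u ^+ (2 * k).+1 <= l - l0.
  apply: le_trans hk0; have [u0 u1 tu] := thr_u t1.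
  apply: ler_wiXn2l; rewrite ?(ltW u0) ?(ltW u1) //; lia.
have [n n0 hn] : exists2 n : nat, (0 < n)%N & l - 1 <= n%:R * (t - 1).
  have [u0 u1 tu] := thr_u t1.
  have hpos : 0 <= (l - 1) / (t - 1) by rewrite divr_ge0 //; lra.
  exists (Num.Def.archi_bound ((l - 1) / (t - 1))).+1 => //.
  have := archi_boundP hpos; rewrite ltr_pdivrMr ?subr_gt0 // => hb.
  apply: le_trans (ltW hb) _; rewrite ler_wpM2r ?subr_ge0 ?ler_nat // ltW //.
have [D hD] := large_degree_clique n.
pose b := (h + k)%N.
(* [D] neighbours for each pattern of labels towards [b] vertices, plus the [b] that may lie inside
   that set. *)
pose DD := (2 ^ b * 2 ^ b * D + b)%N.
exists (h + k + n + 7)%N, (h * DD.+1 ^ k.+1)%N => G conn loc big U hU.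
apply: contrapT => nU; have [W [WU nW W0 connW]] := critical_subset nU.
have cW : (#|W| <= h)%N by apply: leq_trans (subset_leq_card WU) hU.
apply: nW.
have [/existsP[x /andP[xb hx]]|small] := boolP [exists x in ball W k, (DD < #|nbrs x|)%N]; last first.
  have [|p geo] := @geodesic_exists G W k conn W0.
    apply/negP => /eqP bT; have := @card_ball G W DD k.
    have -> : ball W k.+1 = setT by apply/eqP; rewrite -subTset -bT ballS.
    rewrite cardsT => hc; move: big; rewrite ltnNge => /negP; apply.
    apply: leq_trans (hc _) _; last by rewrite leq_mul2r cW orbT.
    move=> x xb; rewrite leqNgt; apply: contra small => hx.
    by apply/existsP; exists x; rewrite xb.
  by apply: (path_tail_psd2 hk geo connW loc); lia.
have [W' [WW' xW' connW' cW']] := connected_hull connW xb.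
have cWb : (#|W'| <= b)%N by rewrite /b; apply: leq_trans cW' _; rewrite leq_add2r.
apply: (psd_on_sub WW').
pose sig y := ([set w in W' | sg_label w y == Some true], [set w in W' | sg_label w y == Some false]).
have [||sg hsg] := @pigeonhole_set G _ sig (nbrs x :\: W') (setX (powerset W') (powerset W')) D.
- move=> y _; rewrite inE !powersetE /sig /=.
  by apply/andP; split; apply/subsetP => w; rewrite inE => /andP[].
- rewrite cardsX !card_powerset; apply: leq_ltn_trans (_ : 2 ^ b * 2 ^ b * D < _)%N.
    by rewrite leq_mul2r leq_mul ?orbT // leq_exp2l.
  rewrite -(ltn_add2l b) addnC (leq_trans hx) // -(cardsID W' (nbrs x)) leq_add2r.
  exact: leq_trans (subset_leq_card (subsetIr _ _)) cWb.
set F := [set y in _ | _] in hsg.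
have Fn y : y \in F -> y \in nbrs x /\ y \notin W'.
  by rewrite inE => /andP[]; rewrite inE => /andP[].
have loc6 : loc_psd l0 6 G 
  by move=> V hV; apply: loc; apply: leq_trans hV _; apply: leq_trans (_ : 6 <= 7)%N (leq_addl _ _).
have [|A [AF cA hA]] := hD R l0 G x F l0s loc6 _ (ltnW hsg).
  by apply/subsetP => y /Fn[].
apply: (clique_tail_psd2 n0 hn xW' connW' _ _ cA hA _ loc); last 1 first.
- exact: leq_trans (leq_add cWb (leqnn n)) (leq_addr _ _).
- by apply/subsetP => y /(subsetP AF) /Fn[].
- apply/pred0P => y /=; apply/negbTE/negP => /andP[/(subsetP AF) /Fn[_ yW] yW'].
  by rewrite yW' in yW.
move=> y z w /(subsetP AF) yF /(subsetP AF) zF wW.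
have : sig y = sig z.
  by move: yF zF; rewrite !inE => /andP[_ /eqP ->] /andP[_ /eqP ->].
case=> /setP /(_ w) h1 /setP /(_ w) h2; move: h1 h2; rewrite !inE wW /= /lab.
by case: (sg_label w y) => [[]|]; case: (sg_label w z) => [[]|].
Qed.
End Tails.

(** * Growing from a large base *)

Section Transport.
Variables (R : realType) (G : sgraph).
Implicit Types (W : G -> vec G) (D : {set G}) (i j : option G).

(** In a base the vertices act like edges between coordinates; this is a unit flow between two
    coordinates that uses only vertices of [D]. *)
Definition transport W D i j := exists w : G -> R, (forall v, v \notin D -> w v = 0) /\
  forall k, img W w k = (k == i)%:R - (k == j)%:R.

Lemma img_lin W (a b : R) (f g : G -> R) k :
  img W (fun v => a * f v + b * g v) k = a * img W f k + b * img W g k.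
Proof. by rewrite /img !mulr_sumr -big_split /=; apply: eq_bigr => v _; ring. Qed.

Lemma img_sum W (I : finType) (P : pred I) (a : I -> R) (f : I -> G -> R) k :
  img W (fun v => \sum_(i | P i) a i * f i v) k = \sum_(i | P i) a i * img W (f i) k.
Proof.
rewrite /img; under eq_bigr do rewrite mulr_suml.
rewrite exchange_big /=; apply: eq_bigr => i _; rewrite mulr_sumr.
by apply: eq_bigr => v _; ring.
Qed.

Lemma img_dl W (v : G) k : img W (dl R v) k = (W v k)%:~R.
Proof. exact: (sum_dl v (fun v => (W v k)%:~R)). Qed.

Lemma transport_refl W D i : transport W D i i.
Proof.
exists (fun=> 0); split=> // k.
by rewrite subrr /img big1 // => v _; rewrite mul0r.
Qed.

Lemma transport_sym W D i j : transport W D i j -> transport W D j i.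
Proof.
move=> [w [h1 h2]]; exists (fun v => (-1) * w v + 0 * w v); split=> [v /h1 ->|k].
  by rewrite !mulr0 addr0.
by rewrite img_lin h2; ring.
Qed.

Lemma transport_trans W D j i k : transport W D i j -> transport W D j k -> transport W D i k.
Proof.
move=> [w [h1 h2]] [w' [h1' h2']]; exists (fun v => 1 * w v + 1 * w' v); split=> [v vD|q].
  by rewrite h1 // h1' // !mulr0 addr0.
by rewrite img_lin h2 h2'; ring.
Qed.

Lemma transport_ext W W' D i j : (forall c, c \in D -> W c =1 W' c) ->
  transport W D i j -> transport W' D i j.
Proof.
move=> hW [w [h1 h2]]; exists w; split=> // k; rewrite -h2; apply: eq_bigr => v _.
by have [vD|vD] := boolP (v \in D); [rewrite hW|rewrite h1 // !mul0r].
Qed.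

(** Averaging the transports to all points of [S] replaces a unit charge by charges [1 / #|S|],
    whose squares add up to only [1 / #|S|]. *)
Lemma dissipate W D i (S : {set option G}) : (0 < #|S|)%N ->
  (forall j, j \in S -> transport W D i j) ->
  exists w : G -> R, (forall v, v \notin D -> w v = 0) /\
    forall k, img W w k = (k == i)%:R - (k \in S)%:R / #|S|%:R.
Proof.
move=> S0 h.
have /choice [w hw] : forall j, exists w : G -> R, j \in S ->
    (forall v, v \notin D -> w v = 0) /\ forall k, img W w k = (k == i)%:R - (k == j)%:R.
  move=> j; have [jS|jS] := boolP (j \in S); last by exists (fun=> 0).
  by have [w hw] := h j jS; exists w.
have S0R : #|S|%:R != 0 :> R by rewrite pnatr_eq0 -lt0n.
exists (fun v => \sum_(j in S) #|S|%:R^-1 * w j v); split=> [v vD|k].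
  by rewrite big1 // => j jS; have [-> //] := hw j jS; rewrite mulr0.
rewrite img_sum (eq_bigr (fun j => #|S|%:R^-1 * (k == i)%:R + (- #|S|%:R^-1) * (k == j)%:R)).
  rewrite big_split /= sumr_const -mulr_sumr -[X in X + _]mulr_natl mulrA divff // mul1r mulNr mulrC.
  congr (_ - _ * _); have [kS|kS] := boolP (k \in S).
    rewrite (bigD1 k) //= eqxx big1 ?addr0 // => j /andP[_ jk].
    by rewrite eq_sym (negbTE jk).
  by rewrite big1 // => j jS; case: eqP => // kj; rewrite kj jS in kS.
by move=> j jS; have [_ ->] := hw j jS; ring.
Qed.
End Transport.

Lemma dot1P (G : sgraph) (w : vec G) : dot w w = 1 ->
  exists b (s : int), s ^+ 2 = 1 /\ forall i, w i = s * (i == b)%:R.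
Proof.
move=> w1; have [b wb|w0] := pickP (fun b => w b != 0); last first.
  by move: w1; rewrite /dot big1 // => i _; have := w0 i => /negbFE/eqP ->.
exists b, (w b); move: w1; rewrite /dot (bigD1 b) //= -expr2.
set S := \sum_(_ | _) _ => h.
have S0 : 0 <= S by apply: sumr_ge0 => i _; rewrite -expr2 sqr_ge0.
have wb1 : 1 <= w b ^+ 2 by rewrite expr2; move: wb; nia.
have Se : S = 0 by lia.
split; first by rewrite -h Se addr0.
move=> i; case: (eqVneq i b) => [->|ib]; first by rewrite mulr1.
rewrite mulr0; move/eqP: Se; rewrite psumr_eq0 => [/allP /(_ i (mem_index_enum _))|j _].
  by rewrite ib /= mulf_eq0 orbb => /eqP.
by rewrite -expr2 sqr_ge0.
Qed.

Lemma card_vec_supp (G : sgraph) (w : vec G) : #|[set i | w i != 0]|%:R <= dot w w.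
Proof.
rewrite -sum1_card natr_sum /dot [leLHS]big_mkcond /=; apply: ler_sum => i _.
rewrite inE; case: (eqVneq (w i) 0) => [->|w0] //=; nia.
Qed.

(** With errors up to [1 / 10] the smaller defect [n = 0, 1, 2] still forces [|d|] below 1, 2 and 3
    respectively, and integrality does the rest. *)
Lemma pair_test_numeric (R : realType) (d n n' : int) (e A B : R) :
  0 <= n -> n <= n' -> n' <= 2 -> 0 <= A -> A <= 1 / 10 -> 0 <= B -> B <= 1 / 10 ->
  e ^+ 2 <= A * B -> (d%:~R + e) ^+ 2 <= (n%:~R + A) * (n'%:~R + B) -> d ^+ 2 <= n * n'.
Proof.
move=> n0 nn n2 A0 A1 B0 B1 he hd.
have e1 : `|e| <= 1 / 10.
  apply: norm_le_sqr; first lra.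
  apply: le_trans he _; rewrite expr2; apply: ler_pM => //.
have ub (x y c : R) : 0 <= c -> n%:~R <= x -> n'%:~R <= y -> (x + 1 / 10) * (y + 1 / 10) <= c ^+ 2 ->
    `|d%:~R + e| <= c.
  move=> c0 hx hy hc; apply: norm_le_sqr => //; apply: le_trans hd _; apply: le_trans hc.
  have n0R : 0 <= n%:~R :> R by rewrite ler0z.
  have n'0R : 0 <= n'%:~R :> R by rewrite ler0z (le_trans n0).
  by apply: ler_pM; lra.
have d3 := int_sq3 R d.
have small c : `|d%:~R + e| <= c -> forall x, 1 / 10 + c < x -> d%:~R ^+ 2 < x ^+ 2 :> R.
  by move=> hc x hx; apply: sqr_lt_of_norm e1 hc _ hx.
have [nE|[nE|nE]] : n = 0 \/ n = 1 \/ n = 2 by lia.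
- have h : `|d%:~R + e| <= 1 / 2.
    apply: (ub 0 2); rewrite ?nE ?ler0z //; first by lra.
      by rewrite (_ : 2 = (2 : int)%:~R) // ler_int.
    by rewrite expr2; lra.
  have := small _ h 1; rewrite expr1n => /(_ _) hs.
  have {}hs : (d%:~R : R) ^+ 2 < 1 by apply: hs; lra.
  case: d3 hs => [-> _|[_ ->]|hd4 hs]; first by rewrite nE mul0r expr0n.
    by rewrite ltxx.
  by have := le_lt_trans hd4 hs; rewrite (ltr_nat R 4 1).
- have h : `|d%:~R + e| <= 8 / 5.
    apply: (ub 1 2); rewrite ?nE //; first by lra.
      by rewrite (_ : 2 = (2 : int)%:~R) // ler_int.
    by rewrite expr2; lra.
  have hs : (d%:~R : R) ^+ 2 < 2 ^+ 2 by apply: small h _ _; lra.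
  have n'1 : 1 <= n' by rewrite -nE.
  case: d3 hs => [-> _|[-> _] _|hd4 hs]; last by have := le_lt_trans hd4 hs; rewrite -natrX (ltr_nat R 4 4).
    by rewrite nE mul1r expr0n (le_trans _ n'1).
  by rewrite nE mul1r.
- have n'2 : n' = 2 by lia.
  have h : `|d%:~R + e| <= 21 / 10.
    apply: (ub 2 2); rewrite ?nE ?n'2 //; first by lra.
    by rewrite expr2; lra.
  have hs : (d%:~R : R) ^+ 2 < 3 ^+ 2 by apply: small h _ _; lra.
  rewrite nE n'2; apply: int_sqr_lt9.
  by rewrite -(ltr_int R) rmorphXn; apply: lt_le_trans hs _; rewrite expr2; lra.
Qed.

(** * Bases in which charges dissipate *)

Section Based.
Variables (R : realType) (G : sgraph) (C0 : {set G}) (W0 : G -> vec G).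

Definition coord_in (C : {set G}) (i : option G) : bool := if i is Some x then x \in C else true.
Definition base_coord (i : option G) := coord_in C0 i.

(* [base_drop] says that charges can be dissipated even after deleting a suitable vertex of the
   base, so that only proper subsets of [G] are needed. *)
Record base : Prop := Base {
  base_supp : forall c x, c \in C0 -> x \notin C0 -> W0 c (Some x) = 0;
  base_dot : forall c d, c \in C0 -> d \in C0 ->
    dot (W0 c) (W0 d) = if c == d then 2 else lab c d;
  base_solve : forall s, s \notin C0 -> exists Y : vec G,
    (forall x, x \notin C0 -> Y (Some x) = 0) /\
    forall c, c \in C0 -> dot Y (W0 c) = lab s c;
  base_zero : forall c, c \in C0 -> \sum_i W0 c i = 0;
  base_full : forall i, base_coord i -> transport R W0 C0 None i;
  base_drop : forall A : {set option G}, (#|A| <= 4)%N -> exists2 x, x \in C0 &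
    forall i, i \in A -> base_coord i -> exists S : {set option G},
      (40 <= #|S|)%N /\ forall j, j \in S -> transport R W0 (C0 :\ x) i j }.

Hypothesis bs : base.

(* Every coordinate of a grown vertex can be transported to a coordinate of the base. *)
Definition anchored (C : {set G}) (W : G -> vec G) :=
  [/\ C0 \subset C, forall c, c \in C0 -> W c =1 W0 c &
   forall i, coord_in C i ->
     exists b (s : R) (z : G -> R), [/\ base_coord b, s ^+ 2 = 1,
       forall v, v \notin C :\: C0 -> z v = 0 &
       forall k, img W z k = (k == i)%:R - s * (k == b)%:R]].

Lemma anchored_step C W a : growing C W -> anchored C W -> a \notin C ->
  defect W a a = 1 -> anchored (a |: C) (step W a).
Proof.
move=> gr [sub hW hz] aC a1.
have stepC c : c \in C -> step W a c =1 W c.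
  move=> cC k; rewrite /step /step_coef; case: eqP => [ca|_]; first by rewrite -ca cC in aC.
  by rewrite defectC (gr_cons gr a cC) mul0r addr0.
have aC0 : a \notin C0 by apply: contra aC => /(subsetP sub).
have imgC z : (forall v, v \notin C :\: C0 -> z v = 0) -> forall k, img (step W a) z k = img W z k :> R.
  move=> z0 k; apply: eq_bigr => v _; have [vC|vC] := boolP (v \in C); first by rewrite stepC.
  by rewrite z0 ?mul0r // in_setD (negbTE vC) andbF.
split.
- by apply: subset_trans sub _; apply: subsetUr.
- by move=> c cC0 k; rewrite stepC ?hW //; apply: (subsetP sub).
have old i : coord_in C i ->
     exists b (s : R) (z : G -> R), [/\ base_coord b, s ^+ 2 = 1,
       forall v, v \notin (a |: C) :\: C0 -> z v = 0 &
       forall k, img (step W a) z k = (k == i)%:R - s * (k == b)%:R].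
  move=> /hz [b [s [z [h1 h2 h3 h4]]]]; exists b, s, z; split=> // [v vn|k]; last by rewrite imgC.
  by apply: h3; apply: contra vn; rewrite !inE => /andP[-> ->]; rewrite orbT.
case=> [x|] hx; last exact: old.
move: hx; rewrite /= in_setU1 => /orP[/eqP -> {x}|xC]; last exact: old.
have [|b [sg [sg1 hWa]]] := @dot1P G (W a).
  by move: a1; rewrite /defect eqxx; lia.
have bC : coord_in C b.
  case: b hWa => // b hWa; apply: contraT => bC.
  have := gr_supp gr a bC; rewrite hWa eqxx mulr1 => s0; rewrite s0 in sg1.
  by rewrite expr0n in sg1.
have [b' [s [z [h1 h2 h3 h4]]]] := hz b bC.
exists b', (- (sg%:~R * s)), (fun v => 1 * dl R a v + (- sg%:~R) * z v); split=> //.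
- by rewrite sqrrN exprMn h2 mulr1 -rmorphXn /= sg1.
- move=> v vn; have va : v != a by apply: contraNneq vn => ->; rewrite !inE aC0 eqxx.
  rewrite /dl (negbTE va) h3 ?mulr0 ?addr0 //.
  by apply: contra vn; rewrite !inE => /andP[-> ->]; rewrite orbT.
move=> k; rewrite img_lin (imgC z) // img_dl h4 /step /step_coef eqxx hWa mul1r.
rewrite intrD intrM !mulrz_nat; ring.
Qed.

(* Transport the coordinates of [s] to the base and dissipate them there. *)
Lemma residual C W s x (b : option G -> option G) (sg : option G -> R) (z : option G -> G -> R) :
  growing C W -> anchored C W -> s \notin C -> x \in C0 ->
  (forall i, W s i != 0 -> [/\ sg i ^+ 2 = 1,
     forall v, v \notin C :\: C0 -> z i v = 0,
     forall k, img W (z i) k = (k == i)%:R - sg i * (k == b i)%:R &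
     exists S : {set option G}, (40 <= #|S|)%N /\
       forall j, j \in S -> transport R W0 (C0 :\ x) (b i) j]) ->
  exists f : G -> R, [/\ f s = 1, f x = 0, forall v, v \notin C -> v != s -> f v = 0 &
    \sum_k img W f k ^+ 2 <= 1 / 10].
Proof.
move=> gr [sub hW _] sC xC0 hb.
have /choice [y hy] : forall i, exists y : G -> R, exists u : option G -> R, W s i != 0 ->
    [/\ forall v, v \notin C -> y v = 0, y x = 0,
       forall k, img W y k = (k == i)%:R - sg i * u k & \sum_k u k ^+ 2 <= 1 / 40].
  move=> i; have [i0|i0] := eqVneq (W s i) 0; first by exists (fun=> 0), (fun=> 0).
  have [s1 z1 z2 [S [cS hS]]] := hb i i0.
  have S0 : (0 < #|S|)%N by apply: leq_trans cS.
  have [|w [w1 w2]] := @dissipate R G W (C0 :\ x) (b i) S S0.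
    move=> j /hS; apply: transport_ext => c; rewrite in_setD1 => /andP[_ cC0].
    by move=> k; rewrite hW.
  exists (fun v => 1 * z i v + sg i * w v), (fun k => (k \in S)%:R / #|S|%:R) => _; split.
  - move=> v vC; rewrite z1 ?w1 ?mulr0 ?addr0 //.
      by apply: contra vC => /setD1P[_ /(subsetP sub)].
    by rewrite in_setD (negbTE vC) andbF.
  - by rewrite z1 ?w1 ?mulr0 ?addr0 // in_setD ?eqxx ?xC0 // in_set1 eqxx.
  - by move=> k; rewrite img_lin z2 w2; ring.
  have cR : 40 <= #|S|%:R :> R by rewrite (ler_nat R 40).
  rewrite (eq_bigr (fun k => (k \in S)%:R * #|S|%:R ^- 2)); last first.
    by move=> k _; rewrite expr_div_n; case: (k \in S); rewrite ?expr1n ?expr0n.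
  rewrite -mulr_suml -natr_sum -big_mkcond /= sum1_card.
  rewrite -exprVn expr2 mulrA divff ?pnatr_eq0 -?lt0n // mul1r div1r lef_pV2 // posrE; lra.
have {hy} /choice [u hu] := hy.
exists (fun v => 1 * dl R s v + (-1) * \sum_(i | W s i != 0) (W s i)%:~R * y i v).
have xs : x != s by apply: contraNneq sC => <-; apply: (subsetP sub).
have sum0 v : v \notin C \/ v = x -> \sum_(i | W s i != 0) (W s i)%:~R * y i v = 0.
  move=> vCx; apply: big1 => i /hu[u1 u2 _ _].
  by case: vCx => [/u1 ->|->]; rewrite ?u2 mulr0.
split.
- by rewrite sum0 ?mulr0 ?addr0 /dl ?eqxx ?mulr1 //; left.
- by rewrite sum0 ?mulr0 ?addr0 /dl ?(negbTE xs) ?mulr0 //; right.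
- by move=> v vC vs; rewrite sum0 ?mulr0 ?addr0 /dl ?(negbTE vs) ?mulr0 //; left.
have imgE k : img W (fun v => 1 * dl R s v + (-1) * \sum_(i | W s i != 0) (W s i)%:~R * y i v) k
    = \sum_(i | W s i != 0) (W s i)%:~R * (sg i * u i k).
  rewrite img_lin img_dl img_sum mul1r.
  have -> : (W s k)%:~R = \sum_(i | W s i != 0) (W s i)%:~R * (k == i)%:R :> R.
    have [k0|k0] := eqVneq (W s k) 0.
      rewrite k0 big1 // => i i0; case: (eqVneq k i) => [ki|]; last by rewrite mulr0.
      by rewrite -ki k0 in i0.
    rewrite (bigD1 k) //= eqxx mulr1 big1 ?addr0 // => i /andP[_ ik].
    by rewrite eq_sym (negbTE ik) mulr0.
  rewrite mulr_sumr -big_split /=; apply: eq_bigr => i i0.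
  by have [_ _ -> _] := hu i i0; ring.
under eq_bigr do rewrite imgE.
have W2 : dot (W s) (W s) <= 2.
  by have := gr_small gr sC; rewrite /defect eqxx; lia.
have c2 : (#|[set i | W s i != 0]|%:R <= 2 :> R).
  have := le_trans (card_vec_supp (W s)) W2.
  by rewrite (ler_nat _ _ 2) -(ler_nat R _ 2).
have d2 : \sum_(i | W s i != 0) ((W s i)%:~R : R) ^+ 2 <= 2.
  have -> : \sum_(i | W s i != 0) ((W s i)%:~R : R) ^+ 2 = (dot (W s) (W s))%:~R.
    rewrite /dot rmorph_sum /= [LHS]big_mkcond; apply: eq_bigr => i _.
    by case: eqP => [->|_]; rewrite ?mul0r // rmorphM expr2.
  by rewrite (ler_int R _ 2).
(* At most two coordinates of [W s] are nonzero, their squares sum to at most 2, and each unit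
   dissipates to squared length at most [1 / 40]: in total [2 * 2 / 40 = 1 / 10]. *)
apply: le_trans (_ : \sum_k 2 * \sum_(i | W s i != 0) ((W s i)%:~R * (sg i * u i k)) ^+ 2 <= _).
  apply: ler_sum => k _.
  have h := @sqr_sum_le R _ [set i | W s i != 0] (fun i => (W s i)%:~R * (sg i * u i k)).
  have inW (F : option G -> R) : \sum_(i in [set i | W s i != 0]) F i = \sum_(i | W s i != 0) F i.
    by apply: eq_bigl => i; rewrite inE.
  rewrite !inW in h.
  apply: le_trans h _; apply: ler_wpM2r c2; apply: sumr_ge0 => i _; exact: sqr_ge0.
rewrite -mulr_sumr exchange_big /=.
apply: le_trans (_ : 2 * \sum_(i | W s i != 0) ((W s i)%:~R ^+ 2 * (1 / 40)) <= _).
  apply: ler_wpM2l => //; apply: ler_sum => i i0.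
  have [_ _ _ u2] := hu i i0; have [s1 _ _ _] := hb i i0.
  rewrite (eq_bigr (fun k => (W s i)%:~R ^+ 2 * u i k ^+ 2)); last first.
    by move=> k _; rewrite !exprMn s1 mul1r.
  by rewrite -mulr_sumr; apply: ler_wpM2l => //; apply: sqr_ge0.
by rewrite -mulr_suml; lra.
Qed.

Hypothesis proper_psd : forall U : {set G}, U != setT -> psd_on (2 : R) U.

Lemma bq2_residual (C : {set G}) W s s' (f g : G -> R) : (forall v c, c \in C -> defect W v c = 0) ->
  f s = 1 -> g s' = 1 -> (forall v, v \notin C -> v != s -> f v = 0) ->
  (forall v, v \notin C -> v != s' -> g v = 0) ->
  bq 2 f g = (defect W s s')%:~R + \sum_k img W f k * img W g k.
Proof.
move=> gr fs gs hf hg; rewrite (bq2_img W) addrC; congr (_ + _).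
rewrite (bigD1 s) //= [X in _ + X]big1 ?addr0 => [|v vs].
  rewrite (bigD1 s') //= [X in _ + X]big1 ?addr0 ?fs ?gs ?mul1r // => w ws.
  have [wC|wC] := boolP (w \in C); first by rewrite gr // mulr0.
  by rewrite hg // mulr0 mul0r.
rewrite big1 // => w _; have [vC|vC] := boolP (v \in C).
  by rewrite defectC gr // mulr0.
by rewrite hf // !mul0r.
Qed.

(** Two vectors with at most two nonzero coordinates each account for the bound 4 in [base_drop].
    The residual functions vanish at the dropped vertex, so the approximate minor only needs
    positivity on a proper subset. *)
Lemma anchored_pair_test C W : growing C W -> anchored C W -> pair_test C W.
Proof.
move=> gr anc; have [sub hW hz] := anc; move=> s s' sC s'C ss'.
have /choice [b hb] : forall i, exists b, exists sz : R * (G -> R),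
    coord_in C i ->
    [/\ base_coord b, sz.1 ^+ 2 = 1, forall v, v \notin C :\: C0 -> sz.2 v = 0 &
       forall k, img W sz.2 k = (k == i)%:R - sz.1 * (k == b)%:R].
  move=> i; have [iC|iC] := boolP (coord_in C i); last first.
    by exists None, (0, fun=> 0) => h; case/negP: iC.
  by have [b [sg [z h]]] := hz i iC; exists b, (sg, z).
have {hb} /choice [sz hb] := hb.
have suppC t i : W t i != 0 -> coord_in C i.
  by case: i => // x; apply: contraR => /(gr_supp gr t) ->.
pose A t := b @: [set i | W t i != 0].
have cA t : t \notin C -> (#|A t| <= 2)%N.
  move=> tC; apply: leq_trans (leq_imset_card _ _) _.
  have := gr_small gr tC; rewrite /defect eqxx => h.
  have := card_vec_supp (W t); move: (dot _ _) h => d h1 h2.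
  by rewrite -(ler_nat int); apply: le_trans h2 _; rewrite -subr_ge0.
have [|x xC0 hx] := base_drop bs (A := A s :|: A s').
  by apply: leq_trans (leq_card_setU _ _) _; rewrite (leq_add (n1 := 2) (n2 := 2)) ?cA.
have res t : t \notin C -> A t \subset A s :|: A s' ->
   exists f : G -> R, [/\ f t = 1, f x = 0, forall v, v \notin C -> v != t -> f v = 0 &
    \sum_k img W f k ^+ 2 <= 1 / 10].
  move=> tC At.
  apply: (@residual _ _ _ _ b (fun i => (sz i).1) (fun i => (sz i).2) gr anc tC xC0) => i i0.
  have [h1 h2 h3 h4] := hb i (suppC _ _ i0); split=> //.
  have [|//|S hS] := hx (b i); first by apply: (subsetP At); apply: imset_f; rewrite inE.
  by exists S.
have [f [f1 f2 f3 f4]] := res s sC (subsetUl _ _).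
have [g [g1 g2 g3 g4]] := res s' s'C (subsetUr _ _).
have xT : ~: [set x] != [set: G].
  by apply/eqP => /setP /(_ x); rewrite !inE eqxx.
have nx (h : G -> R) : h x = 0 -> forall v, v \notin ~: [set x] -> h v = 0.
  by move=> h0 v; rewrite inE negbK inE => /eqP ->.
have mn := psd_on_minor (proper_psd xT) (nx f f2) (nx g g2).
move: mn; rewrite (bq2_residual (gr_cons gr) f1 g1 f3 g3) (bq2_residual (gr_cons gr) f1 f1 f3 f3).
rewrite (bq2_residual (gr_cons gr) g1 g1 g3 g3) => mn.
have cs := sum_minor predT (img W f) (img W g).
have sqE (h : G -> R) : \sum_k img W h k * img W h k = \sum_k img W h k ^+ 2 by [].
rewrite !sqE in mn.
have sq0 (h : G -> R) : 0 <= \sum_k img W h k ^+ 2 by apply: sumr_ge0 => k _; apply: sqr_ge0.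
have n2 t : t \notin C -> 0 <= defect W t t <= 2.
  by move=> tC; rewrite (gr_small gr tC) /= /defect eqxx gerBl dot_ge0.
have /andP[a0 a2] := n2 _ sC; have /andP[b0 b2] := n2 _ s'C.
have [le|lt] := leP (defect W s s) (defect W s' s').
  exact: pair_test_numeric a0 le b2 (sq0 f) f4 (sq0 g) g4 cs mn.
rewrite mulrC; apply: pair_test_numeric b0 (ltW lt) a2 (sq0 g) g4 (sq0 f) f4 _ _.
  by rewrite mulrC; exact: cs.
by rewrite mulrC.
Qed.

Hypothesis room : (#|C0|.+1 < #|G|)%N.

Let B : {set option G} := [set i | base_coord i].

Lemma card_base_coords : #|B| = #|C0|.+1.
Proof.
have -> : B = None |: Some @: C0.
  apply/setP => -[x|]; rewrite !inE //=; apply/idP/imsetP => [xC|[y yC [->]] //].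
  by exists x.
rewrite cardsU1 card_imset => [|x y [] //].
by case: imsetP => // -[x].
Qed.

Definition based (W : G -> vec G) := [/\ forall c, c \in C0 -> W c =1 W0 c,
  forall v i, i \notin B -> W v i = 0 & forall v c, c \in C0 -> defect W v c = 0].

(* Averaging the coordinates of [s] over the base by a flow inside [C0]. *)
Lemma based_norm W s : based W -> s \notin C0 ->
  (dot (W s) (W s))%:~R <= 2 + (\sum_i W s i)%:~R ^+ 2 / #|B|%:R :> R.
Proof.
move=> [hW hB hd] sC.
have /choice [w hw] : forall i, exists w : G -> R, base_coord i ->
    (forall v, v \notin C0 -> w v = 0) /\ forall k, img W w k = (k == None)%:R - (k == i)%:R.
  move=> i; have [iB|iB] := boolP (base_coord i); last by exists (fun=> 0).
  have [|w hw] := @transport_ext R G W0 W C0 None i _ (base_full bs iB); last by exists w.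
  by move=> c cC k; rewrite hW.
pose m : R := #|B|%:R; pose q : R := (\sum_i W s i)%:~R / m.
have m0 : m != 0 by rewrite /m card_base_coords pnatr_eq0.
have sumB : \sum_(i in B) (W s i)%:~R = q * m.
  rewrite /q divfK // rmorph_sum /= [LHS]big_mkcond; apply: eq_bigr => i _.
  by case: (boolP (i \in B)) => [//|/hB ->].
pose f v := 1 * dl R s v + 1 * \sum_(i in B) ((W s i)%:~R - q) * w i v.
have f1 : f s = 1.
  rewrite /f /dl eqxx big1 ?mulr0 ?addr0 ?mulr1 // => i; rewrite inE => /hw[-> //].
  by rewrite mulr0.
have f0 v : v \notin C0 -> v != s -> f v = 0.
  move=> vC vs; rewrite /f /dl (negbTE vs) big1 ?mulr0 ?addr0 // => i; rewrite inE => /hw[-> //].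
  by rewrite mulr0.
have imgf k : img W f k = q * (k \in B)%:R.
  rewrite /f img_lin img_dl img_sum !mul1r.
  rewrite (eq_bigr (fun i => (k == None)%:R * ((W s i)%:~R - q) + (-1) * (((W s i)%:~R - q) * (k == i)%:R))).
    rewrite big_split /= -!mulr_sumr sumrB sumB sumr_const -[q *+ _]mulr_natr subrr mulr0 add0r.
    have [kB|kB] := boolP (k \in B).
      rewrite (bigD1 k) //= eqxx big1 => [|i /andP[_ ik]]; first by rewrite [true%:R]mulr1n; ring.
      by rewrite eq_sym (negbTE ik) mulr0.
    rewrite hB // big1 => [|i iB]; first by rewrite !mulr0 addr0.
    by case: eqP => [ki|]; [rewrite ki iB in kB|rewrite mulr0].
  by move=> i; rewrite inE => /hw[_ ->]; ring.
have U0 : s |: C0 != [set: G].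
  by apply: contraTneq room => h; rewrite -cardsT -h cardsU1 sC ltnn.
have := proper_psd U0 (f := f); rewrite (bq2_residual hd f1 f1 f0 f0) /defect eqxx => h.
have {}h : 0 <= (2 - dot (W s) (W s))%:~R + \sum_k img W f k * img W f k.
  by apply: h => v; rewrite in_setU1 negb_or => /andP[vs vC]; apply: f0.
have e : \sum_k img W f k * img W f k = (\sum_i W s i)%:~R ^+ 2 / #|B|%:R.
  rewrite (eq_bigr (fun k => q ^+ 2 * (k \in B)%:R)).
    rewrite -mulr_sumr -natr_sum -big_mkcond /= sum1_card -/m /q -/m; field.
    exact: m0.
  by move=> k _; rewrite imgf; case: (k \in B); rewrite ?mulr1 ?mulr0 ?expr2.
by move: h; rewrite e intrB; lra.
Qed.

(** Base vectors have coordinate sum 0, so subtracting a constant on [B] from the other vectors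
    keeps all products with the base. *)
Lemma based_shift W (j : G -> option G) : based W ->
  based (fun v k => W v k - if (v \in C0) || (k \notin B) then 0 else W v (j v)).
Proof.
move=> [hW hB hd]; split=> [c cC k|v i iB|v c cC].
- by rewrite cC subr0 hW.
- by rewrite iB orbT subr0 hB.
rewrite -[RHS](hd v c cC) /defect; congr (_ - _).
rewrite /dot; have [vC|vC] := boolP (v \in C0); first by apply: eq_bigr => i _; rewrite cC !subr0.
apply/eqP; rewrite -subr_eq0 -sumrB.
rewrite (eq_bigr (fun i => - W v (j v) * W c i)).
  by rewrite -mulr_sumr (eq_bigr (W0 c)) ?(base_zero bs cC) ?mulr0 // => i _; rewrite hW.
move=> i _; rewrite cC subr0 /=.
have [iB|iB] := boolP (i \in B); first by rewrite /=; ring.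
by rewrite (hB c) // !mulr0 subrr.
Qed.

Hypothesis big_base : (16 <= #|C0|)%N.

(** Summed over [j] in [B], the left sides give [2 * #|B|] times the squared norm minus twice the
    square of the coordinate sum, which [based_norm] bounds by [4 * #|B|]; some [j] is at most
    average. *)
Lemma small_shift W s : based W -> s \notin C0 -> exists2 j, j \in B &
  \sum_(i in B) (W s i - W s j) ^+ 2 <= 4.
Proof.
move=> bW sC; have [_ hB _] := bW; have nb := based_norm bW sC.
apply: contrapT => none.
have big j : j \in B -> 5 <= \sum_(i in B) (W s i - W s j) ^+ 2.
  move=> jB; rewrite leNgt; apply/negP => h; apply: none; exists j => //.
have h1 : (5 * #|B|%:R : int) <= \sum_(j in B) \sum_(i in B) (W s i - W s j) ^+ 2.
  by rewrite mulr_natr -sumr_const; apply: ler_sum => j; apply: big.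
have inB (F : option G -> int) : (forall i, i \notin B -> F i = 0) -> \sum_(i in B) F i = \sum_i F i.
  move=> h; rewrite big_mkcond; apply: eq_bigr => i _.
  by case: (boolP (i \in B)) => // /h ->.
have e : \sum_(j in B) \sum_(i in B) (W s i - W s j) ^+ 2 =
   2 * #|B|%:R * dot (W s) (W s) - 2 * (\sum_i W s i) ^+ 2.
  have dE : dot (W s) (W s) = \sum_(i in B) W s i * W s i.
    by rewrite inB // => i iB; rewrite hB // mulr0.
  have sE : \sum_i W s i = \sum_(i in B) W s i by rewrite inB // => i /hB.
  rewrite (eq_bigr (fun j => dot (W s) (W s) + ((- 2 * \sum_i W s i) * W s j + #|B|%:R * (W s j * W s j)))).
    rewrite !big_split /= -!mulr_sumr -dE -sE sumr_const -[dot _ _ *+ _]mulr_natl; ring.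
  move=> j _; rewrite (eq_bigr (fun i => W s i * W s i + ((- 2 * W s j) * W s i + W s j * W s j))).
    rewrite !big_split /= -!mulr_sumr -dE -sE sumr_const -[W s j *+ _]mulr_natl; ring.
  by move=> i _; ring.
rewrite e in h1.
have m0 : 0 < #|B|%:R :> R by rewrite card_base_coords ltr0n.
have h2 : (5 * #|B|%:R : R) <= 2 * #|B|%:R * (dot (W s) (W s))%:~R - 2 * (\sum_i W s i)%:~R ^+ 2.
  move: h1; rewrite -(ler_int R) rmorphB !rmorphM expr2 /= !mulrz_nat => h1; exact: h1.
have h3 : (dot (W s) (W s))%:~R * #|B|%:R <= 2 * #|B|%:R + (\sum_i W s i)%:~R ^+ 2 :> R.
  rewrite -ler_pdivlMr // mulrDl mulfK ?gt_eqF //.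
move: (_%:~R ^+ 2) h2 h3 => X h2 h3; move: (_%:~R) h2 h3 => D h2 h3.
by lra.
Qed.

(** An integer vector of squared norm at most 4 has coordinate sum at most 4 in size. The correction
    in [based_norm] is then at most [16 / 17], too small for the integer norm to reach 3. *)
Lemma based_small_norm W s : based W -> s \notin C0 ->
  dot (W s) (W s) <= 4 -> dot (W s) (W s) <= 2.
Proof.
move=> bW sC h; have := based_norm bW sC.
have : `|\sum_i W s i| <= 4.
  apply: le_trans h; apply: le_trans (ler_norm_sum _ _ _) _; apply: ler_sum => i _; nia.
move: (\sum_i _) (dot _ _) => S d hS nb; rewrite leNgt; apply/negP => h3.
have d3 : 3 <= d%:~R :> R by rewrite (ler_int R 3).
have S2 : S%:~R ^+ 2 <= 16 :> R.
  rewrite -rmorphXn /= (ler_int R _ 16); move: hS; nia.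
have m0 : 0 < #|B|%:R :> R by rewrite card_base_coords ltr0n.
have m17 : 17 <= #|B|%:R :> R by rewrite card_base_coords (ler_nat R 17).
have : 1 <= S%:~R ^+ 2 / #|B|%:R :> R by lra.
by rewrite ler_pdivlMr // mul1r; lra.
Qed.

(** The vectors outside the base are chosen from their products with the base alone, then shifted by
    a constant to bring their norms down to 2; from there [grow] applies. [Q] carries a further
    invariant along. *)
Theorem base_grow (Q : {set G} -> (G -> vec G) -> Prop) :
  (forall W, (forall c, c \in C0 -> W c =1 W0 c) -> growing C0 W -> Q C0 W) ->
  (forall C W a, growing C W -> growing (a |: C) (step W a) -> Q C W -> a \notin C ->
     defect W a a = 1 -> Q (a |: C) (step W a)) ->
  connected G -> exists C W, [/\ growing C W, Q C W & forall v w, defect W v w = 0].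
Proof.
move=> Q0 Qstep conn.
have /choice [Y hY] : forall s, exists Y : vec G, s \notin C0 ->
    (forall x, x \notin C0 -> Y (Some x) = 0) /\ forall c, c \in C0 -> dot Y (W0 c) = lab s c.
  move=> s; have [sC|sC] := boolP (s \in C0); first by exists (fun=> 0).
  by have [Y hY] := base_solve bs sC; exists Y.
pose W1 v := if v \in C0 then W0 v else Y v.
have b1 : based W1.
  split=> [c cC k|v i iB|v c cC]; first by rewrite /W1 cC.
    case: i iB => [x|]; rewrite inE //= => xC; rewrite /W1.
    case: ifPn => vC; first exact: (base_supp bs).
    by have [-> //] := hY v vC.
  rewrite /defect /W1 cC /=; case: (boolP (v \in C0)) => vC; first by rewrite (base_dot bs) // subrr.
  have [_ ->//] := hY v vC; case: eqP => [vc|]; last by rewrite subrr.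
  by rewrite vc cC in vC.
have /choice [j hj] : forall s, exists j, s \notin C0 ->
    j \in B /\ \sum_(i in B) (W1 s i - W1 s j) ^+ 2 <= 4.
  move=> s; have [sC|sC] := boolP (s \in C0); first by exists None.
  by have [j jB h] := small_shift b1 sC; exists j.
have := based_shift j b1; set W2 := fun v k => _ => b2.
have [hW hB hd] := b2.
have gr : growing C0 W2.
  split=> [v i iC|//|s sC]; first by apply: hB; rewrite inE.
  rewrite /defect eqxx subr_ge0; apply: (based_small_norm b2 sC).
  have [jB h] := hj s sC; apply: le_trans h; rewrite le_eqVlt; apply/orP; left; apply/eqP.
  rewrite /dot [RHS]big_mkcond; apply: eq_bigr => i _.
  have [iB|iB] := boolP (i \in B); last by rewrite hB // mulr0.
  by rewrite /W2 (negbTE sC) iB expr2.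
have anc : anchored C0 W2.
  split=> // i iC; exists i, 1, (fun=> 0); split=> //; first by rewrite expr1n.
  by move=> k; rewrite mul1r subrr /img big1 // => v _; rewrite mul0r.
have C0n : C0 != set0 by rewrite -card_gt0 (leq_trans _ big_base).
have [||||C' [W' [gr' [_ Q'] _ h]]] := @grow G (fun C W => anchored C W /\ Q C W) _ _ conn C0 W2 gr.
- by move=> C W grC [ancC _]; apply: anchored_pair_test.
- move=> C W a grC [ancC QC] aC a1; split; first exact: anchored_step.
  by apply: Qstep => //; apply: step_growing => //; apply: anchored_pair_test.
- by split=> //; apply: Q0.
- exact: C0n.
by exists C', W'.
Qed.

Corollary base_psd : connected G -> @psd R G 2.
Proof.
by move=> /(base_grow (Q := fun _ _ => True))[//|//|C [W [_ _ /psd2_represented h]]].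
Qed.
End Based.

(** * Cliques and paths as bases *)

Section Star.
Variables (R : realType) (G : sgraph) (C0 : {set G}).
Hypothesis clique : forall x y, x \in C0 -> y \in C0 -> x != y -> lab x y = 1.
Hypothesis large : (45 <= #|C0|)%N.

Definition star_vec (v : G) : vec G :=
  fun k => if v \in C0 then (k == Some v)%:R - (k == None)%:R else 0.

Lemma dot_star (Y : vec G) c : c \in C0 -> dot Y (star_vec c) = Y (Some c) - Y None.
Proof.
move=> cC; rewrite /dot (bigD1 (Some c)) //= (bigD1 None) //= big1 => [|i /andP[i1 i2]].
  by rewrite /star_vec cC !eqxx /=; ring.
by rewrite /star_vec cC (negbTE i1) (negbTE i2) subrr mulr0.
Qed.

Lemma star_transport (D : {set G}) c : c \in D -> c \in C0 -> transport R star_vec D None (Some c).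
Proof.
move=> cD cC; apply: transport_sym; exists (dl R c); split=> [v vC|k].
  by rewrite /dl; case: eqP => // vc; rewrite vc cD in vC.
by rewrite img_dl /star_vec cC intrB !mulrz_nat.
Qed.

Lemma star_base : base R C0 star_vec.
Proof.
split.
- move=> c x cC xC; rewrite /star_vec cC; case: eqP => [[xc]|]; last by rewrite subr0.
  by rewrite xc cC in xC.
- move=> c d cC dC; rewrite dot_star // /star_vec cC !eqxx /=.
  have [-> //|cd] := eqVneq c d.
    by rewrite eqxx.
  rewrite clique //; case: eqP => [[dc]|//]; by rewrite dc eqxx in cd.
- move=> s sC; exists (fun k => if k is Some x then (if x \in C0 then lab s x else 0) else 0).
  by split=> [x /negbTE -> //|c cC]; rewrite dot_star // cC subr0.
- move=> c cC; transitivity (dot (fun=> 1) (star_vec c)).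
    by apply: eq_bigr => i _; rewrite mul1r.
  by rewrite dot_star // subrr.
- case=> [c cC|_]; last exact: transport_refl.
  exact: star_transport.
move=> A cA.
have [x xC xA] : exists2 x, x \in C0 & Some x \notin A.
  have : ~~ (Some @: C0 \subset A).
    apply/negP => /subset_leq_card; rewrite card_imset => [h|y z [] //].
    by have := leq_trans large (leq_trans h cA).
  by case/subsetPn => _ /imsetP[x xC ->] xA; exists x.
exists x => // i iA iB; exists (Some @: (C0 :\ x)).
have cD : #|C0| = #|C0 :\ x|.+1 by rewrite (cardsD1 x) xC.
split.
  by rewrite card_imset => [|y z [] //]; rewrite -ltnS -cD; exact: leq_trans large.
move=> j /imsetP[y yC ->]; apply: (@transport_trans _ _ _ _ None); last first.
  by apply: (star_transport yC); case/setD1P: yC.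
case: i iA iB => [z|] iA iB; last exact: transport_refl.
apply: transport_sym; apply: star_transport => //; rewrite in_setD1 (_ : z \in C0) // andbT.
by apply: contraNneq xA => <-.
Qed.
End Star.

Section Path.
Variables (R : realType) (G : sgraph) (p : nat -> G) (M m : nat).
Hypothesis adj : forall i, (0 < i < M)%N -> lab (p i) (p i.+1) != 0.
Hypothesis sep : forall i j, (0 < i <= M)%N -> (0 < j <= M)%N -> (i.+1 < j)%N -> lab (p i) (p j) = 0.
Hypothesis inj : forall i j, (0 < i <= M)%N -> (0 < j <= M)%N -> p i = p j -> i = j.

Definition path_set : {set G} := [set p (i : 'I_M).+1 | i : 'I_M].
Definition path_coord (i : nat) : option G := if i is i'.+1 then Some (p i) else None.
(** Consecutive path vectors share one coordinate with opposite orientations, so their product is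
    minus the product of their signs; the recursion makes it equal to the label. *)
Fixpoint path_sign (i : nat) : int :=
  if i is i'.+1 then - path_sign i' * lab (p i) (p i.+1) else 1.
Definition path_vec (v : G) : vec G := fun k =>
  \sum_(i < M | p i.+1 == v) path_sign i * ((k == path_coord i.+1)%:R - (k == path_coord i)%:R).

Lemma path_setP v : reflect (exists2 i, (i < M)%N & v = p i.+1) (v \in path_set).
Proof.
apply: (iffP imsetP) => [[i _ ->]|[i iM ->]]; first by exists (i : nat).
by exists (Ordinal iM).
Qed.

Lemma card_path_set : #|path_set| = M.
Proof.
rewrite card_imset ?card_ord // => i j /inj h; apply/val_inj/succn_inj/h => //=.
Qed.

Lemma path_vecE i k : (i < M)%N -> path_vec (p i.+1) k =
  path_sign i * ((k == path_coord i.+1)%:R - (k == path_coord i)%:R).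
Proof.
move=> iM; rewrite /path_vec (big_pred1 (Ordinal iM)) // => j /=.
apply/eqP/eqP => [h|-> //]; apply/val_inj/succn_inj/inj => //=.
Qed.

Lemma path_sign2 i : (i < M)%N -> path_sign i ^+ 2 = 1.
Proof.
elim: i => [_|i IH iM /=]; first by rewrite expr1n.
rewrite exprMn sqrrN IH ?(ltnW iM) // mul1r.
by have := @adj i.+1 iM; case: (labP (p i.+1) (p i.+2)) => ->.
Qed.

Lemma path_coord_inj i j : (i <= M)%N -> (j <= M)%N -> path_coord i = path_coord j -> i = j.
Proof.
by case: i => [|i]; case: j => [|j] //= iM jM [/inj h]; apply: h.
Qed.

Lemma dot_path (Y : vec G) i : (i < M)%N -> dot Y (path_vec (p i.+1)) =
  path_sign i * (Y (path_coord i.+1) - Y (path_coord i)).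
Proof.
move=> iM; rewrite /dot (eq_bigr (fun k => path_sign i * ((k == path_coord i.+1)%:R * Y k) +
   (- path_sign i) * ((k == path_coord i)%:R * Y k))); last first.
  by move=> k _; rewrite path_vecE //; ring.
have one (j : option G) : \sum_k (k == j)%:R * Y k = Y j.
  rewrite (bigD1 j) //= eqxx mul1r big1 ?addr0 // => k /negbTE ->.
  by rewrite mul0r.
by rewrite big_split /= -!mulr_sumr !one; ring.
Qed.

Lemma path_base_coord i : (i <= M)%N -> base_coord path_set (path_coord i).
Proof. by case: i => // i iM; apply/path_setP; exists i. Qed.

Lemma path_coord_surj k : base_coord path_set k -> exists2 i, (i <= M)%N & k = path_coord i.
Proof.
case: k => [v /path_setP[i iM ->]|_]; first by exists i.+1.
by exists 0%N.
Qed.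

Lemma path_step (D : {set G}) i : (i < M)%N -> p i.+1 \in D ->
  transport R path_vec D (path_coord i) (path_coord i.+1).
Proof.
move=> iM pD; exists (fun v => (- (path_sign i)%:~R) * dl R (p i.+1) v + 0 * dl R (p i.+1) v).
split=> [v vD|k].
  by rewrite /dl; case: eqP => [vp|]; [rewrite vp pD in vD|rewrite !mulr0 addr0].
rewrite img_lin img_dl path_vecE // intrM intrB !mulrz_nat.
have := path_sign2 iM => /(congr1 (fun z : int => z%:~R : R)); rewrite rmorphXn /= => s2.
transitivity ((path_sign i)%:~R ^+ 2 * ((k == path_coord i)%:R - (k == path_coord i.+1)%:R) : R).
  by ring.
by rewrite s2 mul1r.
Qed.

Lemma path_transport (D : {set G}) i j : (i <= j)%N -> (j <= M)%N ->
  (forall l, (i <= l < j)%N -> p l.+1 \in D) ->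
  transport R path_vec D (path_coord i) (path_coord j).
Proof.
move=> ij; elim: j ij => [|j IH] ij jM h.
  by move: ij; rewrite leqn0 => /eqP ->; apply: transport_refl.
move: ij; rewrite leq_eqVlt => /orP[/eqP ->|ij]; first exact: transport_refl.
apply: (@transport_trans _ _ _ _ (path_coord j)).
  by apply: IH => // [|l /andP[l1 l2]]; [exact: ltnW|apply: h; rewrite l1 ltnW].
by apply: path_step => //; apply: h; rewrite -ltnS ij /=.
Qed.

Hypothesis left_half : (40 <= m)%N.
Hypothesis right_half : (m + 40 <= M)%N.

(** Dropping the vertex [p (m + 1)] cuts the line of coordinates into two halves of at least 40
    coordinates each, and within a half charges still move freely. *)
Lemma path_base : base R path_set path_vec.
Proof.
have mM : (m < M)%N by apply: leq_trans right_half; rewrite -[ltnLHS]addn0 ltn_add2l.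
have bE : (true%:R = 1 :> int) * (false%:R = 0 :> int) by [].
split.
- move=> _ x /path_setP[i iM ->] xC; rewrite path_vecE //.
  have xc j : (j <= M)%N -> (Some x == path_coord j) = false.
    move=> jM; apply: contraNF xC => /eqP h.
    by have := path_base_coord jM; rewrite -h.
  by rewrite !xc // ?(ltnW iM) // subrr mulr0.
- move=> _ _ /path_setP[i iM ->] /path_setP[j jM ->].
  have eqc a b : (a <= M)%N -> (b <= M)%N -> (path_coord a == path_coord b) = (a == b).
    by move=> aM bM; apply/eqP/eqP => [/path_coord_inj -> //|-> //].
  have -> : (p i.+1 == p j.+1) = (i == j).
    by apply/eqP/eqP => [/inj h|-> //]; apply/succn_inj/h.
  rewrite dot_path // !path_vecE // !eqc ?(ltnW iM) ?(ltnW jM) //.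
  have [->|ij] := eqVneq i j.
    rewrite !eqxx (gtn_eqF (ltnSn j)) (ltn_eqF (ltnSn j)) !bE.
    have := path_sign2 jM; rewrite expr2 => s2.
    transitivity (2 * (path_sign j * path_sign j)); first by ring.
    by rewrite s2.
  have ji : (j == i) = false by rewrite eq_sym (negbTE ij).
  rewrite ?eqSS ?ji ?bE.
  have [jE|jn] := eqVneq j i.+1.
    rewrite jE in jM *; rewrite ?(gtn_eqF (ltnSn i)) ?(gtn_eqF (ltnW (ltnSn i.+1))) ?bE.
    have := path_sign2 iM; rewrite expr2 => s2.
    transitivity ((path_sign i * path_sign i) * lab (p i.+1) (p i.+2)); first by rewrite [path_sign i.+1]/=; ring.
    by rewrite s2 mul1r.
  have [iE|inn] := eqVneq i j.+1.
    rewrite iE in iM ij *; rewrite ?(ltn_eqF (ltnSn j)) ?(ltn_eqF (ltnW (ltnSn j.+1))) ?bE.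
    have := path_sign2 jM; rewrite expr2 => s2.
    transitivity ((path_sign j * path_sign j) * lab (p j.+1) (p j.+2)); first by rewrite [path_sign j.+1]/=; ring.
    by rewrite s2 mul1r lab_sym.
  rewrite !bE subrr mulr0.
  case: (ltngtP i j) => [ltij|gtij|eij]; last by rewrite eij eqxx in ij.
    by rewrite sep // ltnS ltn_neqAle eq_sym jn.
  by rewrite lab_sym sep // ltnS ltn_neqAle eq_sym inn.
- move=> s sC.
  (* The products with the path vectors prescribe the successive differences of [Y], so partial sums
     solve for it. *)
  pose y j : int := \sum_(i < j) path_sign i * lab s (p i.+1).
  exists (fun k => \sum_(j < M.+1 | path_coord j == k) y j).
  have yE j : (j <= M)%N -> \sum_(i < M.+1 | path_coord i == path_coord j) y i = y j.
    move=> jM; rewrite (big_pred1 (Ordinal (jM : j < M.+1)%N)) // => i /=.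
    apply/eqP/eqP => [/path_coord_inj h|-> //]; apply/val_inj/h => //=.
    by rewrite -ltnS.
  split=> [x xC|_ /path_setP[i iM ->]].
    rewrite big1 // => j /eqP jx; have := path_base_coord (ltn_ord j : (j <= M)%N).
    by rewrite jx /= (negbTE xC).
  rewrite dot_path // !yE // ?(ltnW iM) // /y big_ord_recr /= addrAC subrr add0r mulrA -expr2.
  by rewrite path_sign2 // mul1r.
- move=> _ /path_setP[i iM ->].
  transitivity (dot (fun=> 1) (path_vec (p i.+1))); first by apply: eq_bigr => k _; rewrite mul1r.
  by rewrite dot_path // subrr mulr0.
- move=> k /path_coord_surj[i iM ->]; apply: (path_transport (i := 0)) => // l /andP[_ li].
  by apply/path_setP; exists l => //; apply: leq_trans li iM.
move=> A _; exists (p m.+1); first by apply/path_setP; exists m.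
have inD l : (l < M)%N -> l != m -> p l.+1 \in path_set :\ p m.+1.
  move=> lM lm; rewrite in_setD1; apply/andP; split; last by apply/path_setP; exists l.
  by apply: contraNneq lm => /inj h; apply/eqP/succn_inj/h.
have tr i j : (i <= M)%N -> (j <= M)%N -> (i <= m)%N = (j <= m)%N ->
    transport R path_vec (path_set :\ p m.+1) (path_coord i) (path_coord j).
  wlog ij : i j / (i <= j)%N => [W iM jM e|iM jM e].
    case: (leqP i j) => ij; first exact: W.
    by apply: transport_sym; apply: W => //; exact: ltnW.
  apply: path_transport => // l /andP[il lj]; apply: inD; first exact: leq_trans lj jM.
  apply/eqP => lm; move: e; rewrite -lm il; move/esym/(leq_trans lj); by rewrite ltnn.
move=> k _ /path_coord_surj[i iM ->].
have sideC a n : (forall l, (l < n)%N -> (a + l <= M)%N) -> #|[set path_coord (a + (l : 'I_n)) | l : 'I_n]| = n.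
  move=> h; rewrite card_imset ?card_ord // => l l' /path_coord_inj h'.
  by apply/val_inj/eqP; rewrite -(eqn_add2l a); apply/eqP/h'; apply: h.
have [im|im] := leqP i m.
  have h l : (l < m.+1)%N -> (0 + l <= M)%N by rewrite add0n ltnS => lm; apply: leq_trans lm (ltnW mM).
  exists [set path_coord (0 + (l : 'I_m.+1)) | l : 'I_m.+1]; split.
    by rewrite sideC // ltnW.
  move=> _ /imsetP[l _ ->]; apply: tr => //; first exact: h.
  by rewrite im add0n -ltnS ltn_ord.
have h l : (l < 40)%N -> (m.+1 + l <= M)%N.
  by move=> l40; apply: leq_trans right_half; rewrite addSnnS leq_add2l.
exists [set path_coord (m.+1 + (l : 'I_40)) | l : 'I_40]; split.
  by rewrite sideC.
move=> _ /imsetP[l _ ->]; apply: tr => //; first exact: h.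
by rewrite leqNgt im addSn ltnNge leq_addr.
Qed.
End Path.

Definition induced_path (G : sgraph) (p : nat -> G) (M : nat) :=
  [/\ forall i, (0 < i < M)%N -> lab (p i) (p i.+1) != 0,
   forall i j, (0 < i <= M)%N -> (0 < j <= M)%N -> (i.+1 < j)%N -> lab (p i) (p j) = 0 &
   forall i j, (0 < i <= M)%N -> (0 < j <= M)%N -> p i = p j -> i = j].

Lemma clique_or_path (m M : nat) : (0 < M)%N -> exists N, forall (R : realType) (l : R) (G : sgraph),
  l < 11 / 5 -> connected G -> loc_psd l 6 G -> (N < #|G|)%N ->
  (exists A : {set G}, #|A| = m /\ forall x y, x \in A -> y \in A -> x != y -> lab x y = 1) \/
  (exists p : nat -> G, induced_path p M).
Proof.
move=> M0; have [D hD] := large_degree_clique m.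
exists (D.+1 ^ M)%N => R l G l1 conn loc big.
have /card_gt0P[v _] : (0 < #|G|)%N by exact: leq_trans big.
case: (pickP (fun v : G => D <= #|nbrs v|)%N) => [u hu|small].
  by have [A [_ cA hA]] := hD R l G u (nbrs u) l1 loc (subxx _) hu; left; exists A.
have hball : ball [set v] M.-1 != setT.
  apply: contraTneq big => bT; rewrite -leqNgt -cardsT -bT.
  apply: leq_trans (subset_leq_card (ballS _ _)) _.
  have := @card_ball G [set v] D M.-1; rewrite cards1 mul1n prednK //; apply=> x _.
  by have := small x; rewrite leqNgt => /negbT; rewrite negbK => /ltnW.
have v0 : [set v] != set0 by apply/set0Pn; exists v; rewrite inE.
have [p] := geodesic_exists conn v0 hball; rewrite prednK // => gp.
have gsep := geodesic_sep gp; have [gb gadj] := gp.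
right; exists p; split=> // [i j hi hj ij|i j hi hj pij].
  by have [pi _] := gb i hi; have [] := gsep i j hj ij _ pi.
have lt a b : (0 < a <= M)%N -> (0 < b <= M)%N -> (a < b)%N -> p a != p b.
  move=> ha hb ab; have [pa _] := gb a ha; have [_ pb] := gb b hb.
  apply: contraNneq pb => <-; apply: (subsetP (ball_mono _ _)) pa.
  by case: b ab {hb}.
case: (ltngtP i j) => // h.
  by have := lt i j hi hj h; rewrite pij eqxx.
by have := lt j i hj hi h; rewrite pij eqxx.
Qed.

Lemma critical_loc (R : realType) (l : R) (G : sgraph) N :
  critical l G -> (N < #|G|)%N -> loc_psd l N G.
Proof.
move=> [_ proper] big U cU; apply: proper; apply: contraTneq big => UT.
by rewrite -cardsT -UT -leqNgt.
Qed.

Theorem critical2_bounded (R : realType) :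
  exists N, forall G : sgraph, critical (2 : R) G -> (#|G| <= N)%N.
Proof.
(* 45 is the size required by [star_base], and 80 gives 40 on each side of the dropped path
   vertex. *)
have [N hN] := @clique_or_path 45 80 isT.
exists (maxn 100 N) => G crit; rewrite leqNgt; apply/negP; rewrite gtn_max => /andP[big1 big2].
have [nG proper] := crit; have conn := critical_connected crit; apply: nG.
have [||[A [cA hA]]|[p [padj psep pinj]]] := hN R 2 G _ conn _ big2.
- by lra.
- by apply: critical_loc crit _; apply: leq_trans big1.
- apply: (base_psd (star_base R hA _) proper) => //; rewrite cA //.
  exact: leq_trans big1.
apply: (base_psd (path_base (m := 40) R padj psep pinj _ _) proper) => //.
  by rewrite (card_path_set pinj); apply: leq_trans big1.
by rewrite (card_path_set pinj).
Qed.

(** * Finitely many small graphs *)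

Section FiniteTypes.
Variables (k : nat) (M : {ffun 'I_k * 'I_k -> option bool}).
(** Only entries above the diagonal are read, so every table is a signed graph. *)
Definition table_label (x y : 'I_k) : option bool :=
  if (x < y)%N then M (x, y) else if (y < x)%N then M (y, x) else None.
Lemma table_sym x y : table_label x y = table_label y x.
Proof. by rewrite /table_label; case: ltngtP. Qed.
Lemma table_irr x : table_label x x = None.
Proof. by rewrite /table_label ltnn. Qed.
Definition table_graph := SGraph table_sym table_irr.
End FiniteTypes.

Lemma finite_types (J : nat) : exists (K : nat) (Gs : 'I_K -> sgraph),
  forall H : sgraph, (#|H| <= J)%N -> exists i, sg_iso H (Gs i).
Proof.
pose T : finType := {k : 'I_J.+1 & {ffun 'I_k * 'I_k -> option bool}}.
exists #|T|, (fun i => table_graph (tagged (enum_val i : T))) => H hJ.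
pose M : {ffun 'I_#|H| * 'I_#|H| -> option bool} :=
  [ffun u => sg_label (enum_val u.1) (enum_val u.2)].
exists (enum_rank (Tagged (fun k : 'I_J.+1 => {ffun 'I_k * 'I_k -> option bool})
  (i := Ordinal (hJ : (#|H| < J.+1)%N)) M : T)).
rewrite enum_rankK /=; exists enum_rank; split; first exact: enum_rank_bij.
move=> x y; rewrite /= /table_label !ffunE /= !enum_rankK.
case: ltngtP => // [_|/val_inj/enum_rank_inj ->]; first exact: sg_label_sym.
by rewrite sg_label_irrefl.
Qed.

Lemma inv_small (R : realType) (x e : R) : 0 < e -> exists n : nat, x / n.+1%:R < e.
Proof.
move=> e0; exists (Num.Def.archi_bound (x / e)); rewrite ltr_pdivrMr ?ltr0n //.
rewrite -ltr_pdivrMl // mulrC.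
have [x0|x0] := leP 0 (x / e).
  by apply: lt_trans (archi_boundP x0) _; rewrite ltr_nat.
by apply: lt_trans x0 _; rewrite ltr0n.
Qed.

(* Only finitely many rooted graphs have at most [J] vertices, so an inequality that
   holds up to a factor close enough to 1 holds exactly. *)
Lemma rooted_gap (R : realType) (l : R) (J : nat) : exists n0 : nat, forall (H : sgraph) (r : H),
  (#|H| <= J)%N -> (forall f : H -> R, (1 - n0.+1%:R^-1) * f r ^+ 2 <= bq l f f) ->
  forall f : H -> R, f r ^+ 2 <= bq l f f.
Proof.
have [K [Gs hGs]] := finite_types J.
have gap (H : sgraph) (r : H) : exists n : nat,
    (forall f : H -> R, (1 - n.+1%:R^-1) * f r ^+ 2 <= bq l f f) ->
    forall f : H -> R, f r ^+ 2 <= bq l f f.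
  have [h|h] := EM (forall f : H -> R, f r ^+ 2 <= bq l f f); first by exists 0%N.
  have /existsNP[f /negP] := h; rewrite -ltNge => hf.
  have [|n hn] := @inv_small R (f r ^+ 2) (f r ^+ 2 - bq l f f); first by rewrite subr_gt0.
  exists n => /(_ f) hh; exfalso; move: hn; rewrite [_ / _]mulrC.
  by move: hh hf; rewrite mulrBl mul1r; move: (bq l f f) (_^-1 * _) => A D; lra.
have gap2 (i : 'I_K) : exists n : nat, forall r : Gs i,
    (forall f : Gs i -> R, (1 - n.+1%:R^-1) * f r ^+ 2 <= bq l f f) ->
    forall f : Gs i -> R, f r ^+ 2 <= bq l f f.
  have /choice [n hn] := gap (Gs i).
  exists (\max_r n r) => r hr; apply: hn => f; apply: le_trans (hr f).
  apply: ler_wpM2r; first exact: sqr_ge0.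
  rewrite lerB // lef_pV2 ?posrE ?ltr0n // ler_nat ltnS; exact: leq_bigmax.
have /choice [n hn] := gap2.
exists (\max_i n i) => H r cH hr f.
have [i [phi [bij hphi]]] := hGs H cH.
have inj := bij_inj bij.
rewrite -(push_phi inj f r) -(bq_push inj hphi l f f); apply: (hn i) => g.
have gE : push phi (fun y => g (phi y)) =1 g.
  apply: (push_comp inj) => x /imsetP h; exfalso; apply: h.
  by have [psi _ hpsi] := bij; exists (psi x); rewrite ?hpsi.
rewrite -(bq_ext l gE gE) (bq_push inj hphi) -(gE (phi r)) (push_phi inj).
apply: le_trans (hr (fun y => g (phi y))); apply: ler_wpM2r; first exact: sqr_ge0.
rewrite lerB // lef_pV2 ?posrE ?ltr0n // ler_nat ltnS; exact: leq_bigmax.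
Qed.

(** * Branches at a large clique *)

Lemma sum_option (R : realType) (T : finType) (F : option T -> R) :
  \sum_k F k = F None + \sum_y F (Some y).
Proof.
rewrite (bigD1 None) //=; congr (_ + _).
rewrite (reindex_omap (Some : T -> option T) id) => [|[]//].
by apply: eq_bigl => y; rewrite eqxx andbT.
Qed.

Section Branching.
Variables (R : realType) (G : sgraph) (l : R) (J n : nat) (C0 : {set G}).
Hypothesis clique : forall x y, x \in C0 -> y \in C0 -> x != y -> lab x y = 1.
Hypothesis cardC0 : #|C0| = n.+1.
Hypothesis l2 : l < 2.
Hypothesis J1 : (1 <= J)%N.
Hypothesis J_big : 8 < (2 - l) * J.+1%:R.
Hypothesis n_big : 16 < (2 - l) * n%:R.
Hypothesis loc : loc_psd l (J + J + n + 3) G.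

Definition branch (C : {set G}) (top : G -> G) (t : G) : {set G} := [set y in C | top y == t].

(* [img W (F x)] is a unit flow from the coordinate of [x] to the hub [None], running inside
   the branch of [x]. *)
Record branching (C : {set G}) (W : G -> vec G) (top : G -> G) (F : G -> G -> R) : Prop := {
  br_sub : C0 \subset C;
  br_star : forall c, c \in C0 -> W c =1 star_vec C0 c /\ top c = c;
  br_top : forall x, x \in C -> top x \in C /\ top (top x) = top x;
  br_supp : forall x y, x \in C -> W x (Some y) != 0 -> top y = top x;
  br_hub : forall x, x \in C -> W x None ^+ 2 = (x == top x)%:R;
  br_flow : forall x v, x \in C -> v \notin branch C top (top x) -> F x v = 0;
  br_flow_top : forall x, x \in C -> F x (top x) ^+ 2 = 1;
  br_flow_img : forall x y, x \in C -> img W (F x) (Some y) = (y == x)%:R;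
  br_flow_hub : forall x, x \in C -> img W (F x) None ^+ 2 = 1 }.

Definition spread (W : G -> vec G) (T : {set G}) (f : G -> R) : G -> R :=
  fun v => 1 * f v + (img W f None / #|T|%:R) * (v \in T)%:R.

Section Spread.
Variables (W : G -> vec G) (T : {set G}).
Hypothesis W_star : forall c, c \in C0 -> W c =1 star_vec C0 c.
Hypothesis TC0 : T \subset C0.
Hypothesis T_big : (n <= #|T|)%N.

Lemma n_gt0 : 0 < n%:R :> R.
Proof. by have h := n_big; rewrite lt0r ler0n andbT; apply/eqP => n0; rewrite n0 in h; lra. Qed.

Lemma T_gt0 : 0 < #|T|%:R :> R.
Proof. by apply: lt_le_trans n_gt0 _; rewrite ler_nat. Qed.

Lemma img_indicator k : img W (fun v => (v \in T)%:R : R) k =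
  if k is Some y then (y \in T)%:R else - #|T|%:R.
Proof.
rewrite /img; transitivity (\sum_(v in T) ((k == Some v)%:R - (k == None)%:R) : R).
  rewrite [RHS]big_mkcond; apply: eq_bigr => v _; case: ifP => vT; last by rewrite mul0r.
  have vC := subsetP TC0 _ vT.
  by rewrite mul1r W_star // /star_vec vC intrB !mulrz_nat.
case: k => [y|] /=.
  rewrite (eq_bigr (fun v => (v == y)%:R)) => [|v _]; last by rewrite subr0 eq_sym.
  have [yT|yT] := boolP (y \in T).
    by rewrite (bigD1 y) //= eqxx big1 ?addr0 // => v /andP[_ /negbTE ->].
  by rewrite big1 // => v vT; case: eqP => // vy; rewrite -vy vT in yT.
rewrite (eq_bigr (fun=> -1)) => [|v _]; last by rewrite /= sub0r.
by rewrite sumr_const mulNrn.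
Qed.

Lemma img_spread f k : img W (spread W T f) k =
  if k is Some y then img W f (Some y) + img W f None / #|T|%:R * (y \in T)%:R else 0.
Proof.
rewrite img_lin img_indicator; case: k => [y|]; first by rewrite mul1r.
have T0 := T_gt0; rewrite mul1r; field; exact: lt0r_neq0.
Qed.

(* The charge at the hub is spread over [T], which costs little because [T] is large. *)
Lemma spread_form (f : G -> R) (U : {set G}) : T \subset U -> (forall v, v \notin U -> f v = 0) ->
  (#|U| <= J + J + n + 3)%N -> (forall v w, v \in U -> w \in U -> defect W v w = 0) ->
  (2 - l) * \sum_v spread W T f v ^+ 2 <=
  \sum_y (img W f (Some y) + img W f None / #|T|%:R * (y \in T)%:R) ^+ 2.
Proof.
move=> TU fU cU dU; set g := spread W T f.
have g0 v : v \notin U -> g v = 0.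
  move=> vU; rewrite /g /spread fU // (_ : (v \in T) = false) ?mulr0 ?addr0 //.
  by apply: contraNF vU; apply: (subsetP TU).
have := loc cU g0; rewrite (bq_shift 2) (bq2_img W) [X in _ + X + _]big1 ?addr0; last first.
  move=> v _; rewrite big1 // => w _.
  have [vU|vU] := boolP (v \in U); last by rewrite g0 // !mul0r.
  have [wU|wU] := boolP (w \in U); last by rewrite (g0 w) // mulr0 mul0r.
  by rewrite dU // mulr0.
rewrite sum_option !img_spread mul0r add0r.
rewrite (eq_bigr (fun y => (img W f (Some y) + img W f None / #|T|%:R * (y \in T)%:R) ^+ 2)).
  have -> : \sum_v g v ^+ 2 = \sum_v g v * g v by [].
  lra.
by move=> y _; rewrite img_spread.
Qed.

(** In [spread_form] the left side is at least [2 - l] because of [v0], and the right side at most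
    [2 / (J + 1) + 8 / n]. The constants in [J_big] and [n_big] make these terms less than a quarter
    and a half of [2 - l]. *)
Lemma spread_absurd (f : G -> R) (U : {set G}) v0 : T \subset U -> (forall v, v \notin U -> f v = 0) ->
  (#|U| <= J + J + n + 3)%N -> (forall v w, v \in U -> w \in U -> defect W v w = 0) ->
  v0 \notin T -> f v0 ^+ 2 = 1 -> img W f None ^+ 2 <= 4 ->
  \sum_y img W f (Some y) ^+ 2 <= J.+1%:R^-1 -> False.
Proof.
move=> TU fU cU dU v0T f1 k4 s1; have := spread_form TU fU cU dU.
have n0 := n_gt0; have T0 := T_gt0; have J0 : 0 < J.+1%:R :> R by rewrite ltr0n.
have h1 : 1 <= \sum_v spread W T f v ^+ 2.
  rewrite (bigD1 v0) //= {1}/spread (negbTE v0T) mulr0 addr0 mul1r f1 lerDl.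
  by apply: sumr_ge0 => v _; apply: sqr_ge0.
have h2 : \sum_y (img W f (Some y) + img W f None / #|T|%:R * (y \in T)%:R) ^+ 2 <=
   2 * J.+1%:R^-1 + 2 * (4 / n%:R).
  apply: le_trans (_ : \sum_y (2 * img W f (Some y) ^+ 2 +
     2 * ((img W f None / #|T|%:R) ^+ 2 * (y \in T)%:R)) <= _).
    apply: ler_sum => y _; set a := img W f (Some y); set b := _ / _.
    have := sqr_ge0 (a - b); case: (y \in T); rewrite ?mulr1 ?mulr0 ?addr0 => h.
      by rewrite -subr_ge0 (_ : _ - _ = (a - b) ^+ 2) //; ring.
    by have := sqr_ge0 a; lra.
  rewrite big_split /= -!mulr_sumr -natr_sum -big_mkcond /= sum1_card.
  apply: lerD; first by rewrite ler_pM2l.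
  rewrite ler_pM2l // expr_div_n -mulrA.
  have -> : (#|T|%:R ^+ 2)^-1 * #|T|%:R = #|T|%:R^-1 :> R.
    by field; exact: lt0r_neq0.
  apply: ler_pM => //; [exact: sqr_ge0|by rewrite invr_ge0 ltW|].
  by rewrite lef_pV2 ?posrE // ler_nat.
have h3 : 2 * J.+1%:R^-1 < (2 - l) / 4.
  by have h := J_big; rewrite ltr_pdivrMr //; lra.
have h4 : 2 * (4 / n%:R) < (2 - l) / 2.
  by have h := n_big; rewrite mulrA ltr_pdivrMr //; lra.
have h5 : (2 - l) <= (2 - l) * \sum_v spread W T f v ^+ 2.
  by rewrite ler_peMr // subr_ge0 ltW.
move=> h6; have hl := l2; have := le_trans h5 (le_trans h6 h2).
move: h3 h4; move: (2 * J.+1%:R^-1) (2 * (4 / n%:R)) => A B h3 h4 h7.  lra.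
Qed.
End Spread.

Lemma card_punctured t : (n <= #|C0 :\ t|)%N.
Proof. by have := cardsD1 t C0; rewrite cardC0; case: (t \in C0) => /= [[->]|]; lia. Qed.

(** The average of [J + 1] unit flows of one branch, with signs that make them agree at the top, has
    value 1 there, although its image off the hub has squared length only [1 / (J + 1)]. As branches
    grow by one vertex at a time, they never pass [J]. *)
Lemma branch_small C W top F t : growing C W -> branching C W top F ->
  (#|branch C top t| <= J.+1)%N -> (#|branch C top t| <= J)%N.
Proof.
move=> gr br cB; rewrite leqNgt; apply/negP => JB; set B := branch C top t in cB JB.
have cE : #|B| = J.+1 by apply/eqP; rewrite eqn_leq cB JB.
have BC x : x \in B -> x \in C /\ top x = t by rewrite inE => /andP[-> /eqP].
have J0 : J.+1%:R != 0 :> R by rewrite pnatr_eq0.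
pose f v := \sum_(x in B) (F x t / J.+1%:R) * F x v.
have imgf k : img W f k = \sum_(x in B) (F x t / J.+1%:R) * img W (F x) k by exact: img_sum.
have sqF x : x \in B -> F x t ^+ 2 = 1 by move=> /BC[xC <-]; rewrite (br_flow_top br).
have sub : B :|: C0 \subset C.
  by rewrite subUset (br_sub br) andbT; apply/subsetP => x /BC[].
apply: (@spread_absurd W (C0 :\ t) _ _ _ f (B :|: C0) t).
- by move=> c /(br_star br)[].
- exact: subsetDl.
- exact: card_punctured.
- by apply: subset_trans (subsetDl _ _) (subsetUr _ _).
- move=> v; rewrite in_setU negb_or => /andP[vB _]; rewrite /f big1 // => x /BC[xC xt].
  by rewrite (br_flow (v := v) br xC) ?mulr0 // xt.
- apply: leq_trans (leq_card_setU _ _) _; rewrite cE cardC0; lia.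
- by move=> v w _ wU; apply: (gr_cons gr); apply: (subsetP sub).
- by rewrite !inE eqxx.
- rewrite /f (eq_bigr (fun=> J.+1%:R^-1)) => [|x xB].
    by rewrite sumr_const cE -[_ *+ _]mulr_natr mulVf // expr1n.
  by rewrite mulrAC -expr2 sqF // mul1r.
- have h := @sqr_sum_le R _ B (fun x => F x t / J.+1%:R * img W (F x) None).
  rewrite imgf; apply: le_trans h _; rewrite (eq_bigr (fun=> J.+1%:R^-1 * J.+1%:R^-1)) => [|x xB].
    rewrite sumr_const cE -[X in _ * X]mulr_natr mulfVK // divff //; lra.
  by rewrite !exprMn sqF // (br_flow_hub br) ?(BC _ xB).1 // mul1r mulr1 expr2.
rewrite (eq_bigr (fun y => (y \in B)%:R * J.+1%:R^-1 ^+ 2)) => [|y _].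
  by rewrite -mulr_suml -natr_sum -big_mkcond /= sum1_card cE expr2 mulrA divff // mul1r.
rewrite imgf; have [yB|yB] := boolP (y \in B).
  rewrite (bigD1 y) //= (br_flow_img br) ?(BC _ yB).1 // eqxx big1 => [|x /andP[xB xy]].
    by rewrite addr0 mulr1 exprMn sqF.
  by rewrite (br_flow_img br) ?(BC _ xB).1 // eq_sym (negbTE xy) mulr0.
rewrite big1 ?mul0r ?expr0n // => x xB.
rewrite (br_flow_img br) ?(BC _ xB).1 //; case: eqP => [yx|]; last by rewrite mulr0.
by rewrite yx xB in yB.
Qed.

Definition branched (C : {set G}) (W : G -> vec G) := exists top F, branching C W top F /\
  forall t, (#|branch C top t| <= J)%N.

Lemma branched_init W : (forall c, c \in C0 -> W c =1 star_vec C0 c) -> growing C0 W ->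
  branched C0 W.
Proof.
move=> hW gr; exists id, (fun x => dl R x); split; last first.
  move=> t; apply: leq_trans J1; rewrite -(cards1 t); apply: subset_leq_card.
  by apply/subsetP => x; rewrite !inE => /andP[].
have dE x y : x \in C0 -> W x (Some y) = (y == x)%:R.
  by move=> xC; rewrite hW // /star_vec xC subr0.
have dN x : x \in C0 -> W x None = -1 by move=> xC; rewrite hW // /star_vec xC.
split=> //; first by move=> c cC; split=> //; apply: hW.
- by move=> x y xC; rewrite dE //; have [//|_] := eqVneq y x; rewrite eqxx.
- by move=> x xC; rewrite dN // eqxx.
- by move=> x v xC; rewrite inE /dl => h; case: eqP => // vx; rewrite vx xC eqxx in h.
- by move=> x xC; rewrite /dl eqxx expr1n.
- by move=> x y xC; rewrite img_dl dE // mulrz_nat.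
- by move=> x xC; rewrite img_dl dN // -rmorphXn.
Qed.

Lemma branched_step C W a : growing C W -> growing (a |: C) (step W a) -> branched C W ->
  a \notin C -> defect W a a = 1 -> branched (a |: C) (step W a).
Proof.
move=> gr gr' [top [F [br small]]] aC a1.
have [|b [sg [sg1 hWa]]] := @dot1P G (W a).
  by move: a1; rewrite /defect eqxx; lia.
have bC y : b = Some y -> y \in C.
  move=> by_; apply: contraT => yC; have := gr_supp gr a yC; rewrite hWa by_ eqxx mulr1 => s0.
  by rewrite s0 expr0n in sg1.
have sgR : sg%:~R ^+ 2 = 1 :> R by rewrite -rmorphXn /= sg1.
have stepC c k : c \in C -> step W a c k = W c k.
  move=> cC; rewrite /step /step_coef; case: eqP => [ca|_]; first by rewrite -ca cC in aC.
  by rewrite defectC (gr_cons gr a cC) mul0r addr0.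
have stepa k : step W a a k = sg * (k == b)%:R + (k == Some a)%:R.
  by rewrite /step /step_coef eqxx hWa mul1r.
have neq c : c \in C -> c == a = false by move=> cC; apply: contraNF aC => /eqP <-.
(* The vector of [a] is a unit vector at [b] up to sign: for [b = None] the vertex opens a new
   branch, otherwise it joins the branch that owns the coordinate [b]. *)
pose top' x := if x == a then (if b is Some y then top y else a) else top x.
pose F' x := if x == a then
  (if b is Some y then fun v => 1 * dl R a v + (- sg%:~R) * F y v else dl R a) else F x.
have topC c : c \in C -> top' c = top c by move=> cC; rewrite /top' neq.
have imgC x k : x \in C -> img (step W a) (F x) k = img W (F x) k.
  move=> xC; apply: eq_bigr => v _; have [vC|vC] := boolP (v \in C); first by rewrite stepC.
  by rewrite (br_flow br xC) ?mul0r // inE (negbTE vC).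
have tC y : y \in C -> top y \in C by move=> /(br_top br)[].
have subB t : branch C top t \subset branch (a |: C) top' t.
  by apply/subsetP => x; rewrite !inE => /andP[xC xt]; rewrite topC // xC orbT.
have br' : branching (a |: C) (step W a) top' F'.
  split.
  - by apply: subset_trans (br_sub br) (subsetUr _ _).
  - move=> c cC0; have cC := subsetP (br_sub br) _ cC0; have [h1 h2] := br_star br cC0.
    by split=> [k|]; [rewrite stepC|rewrite topC].
  - move=> x; rewrite in_setU1 => /orP[/eqP -> {x}|xC]; last first.
      have [h1 h2] := br_top br xC.
      by rewrite (topC _ xC) (topC _ h1) in_setU1 h1 orbT.
    rewrite /top' eqxx; case bE : b => [y|]; last by rewrite eqxx in_setU1 eqxx.
    have yC := bC y bE; have [h1 h2] := br_top br yC.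
    by rewrite neq // in_setU1 h1 orbT.
  - move=> x y; rewrite in_setU1 => /orP[/eqP -> {x}|xC].
      rewrite stepa; have [[->]//|ya] := eqVneq (Some y) (Some a).
      rewrite addr0; have [yb _|_] := eqVneq (Some y) b; last by rewrite mulr0 eqxx.
      by rewrite (topC y) ?(bC y) // /top' eqxx -yb.
    rewrite stepC // => h; have yC : y \in C.
      by apply: contraR h => yC; rewrite (gr_supp gr).
    by rewrite !topC //; apply: (br_supp br).
  - move=> x; rewrite in_setU1 => /orP[/eqP -> {x}|xC]; last by rewrite stepC // topC // (br_hub br).
    rewrite stepa addr0 /top' eqxx; case bE : b => [y|]; last by rewrite !eqxx mulr1.
    by rewrite mulr0 eq_sym neq // tC // bC.
  - move=> x v; rewrite in_setU1 => /orP[/eqP -> {x}|xC]; last first.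
      rewrite topC // => h; rewrite /F' neq // (br_flow br xC) //.
      by apply: contra h; apply: (subsetP (subB _)).
    rewrite /F' /top' eqxx -/top'; case bE : b => [y|] h.
      have va : v != a by apply: contraNneq h => ->; rewrite !inE /top' !eqxx bE eqxx.
      rewrite /dl (negbTE va) mulr0 add0r (br_flow br (bC y bE)) ?mulr0 //.
      by apply: contra h; apply: (subsetP (subB _)).
    rewrite /dl; case: eqP => // va; move: h; rewrite va !inE /top' !eqxx bE eqxx.
    by [].
  - move=> x; rewrite in_setU1 => /orP[/eqP -> {x}|xC]; last first.
      by rewrite topC // /F' neq // (br_flow_top br).
    rewrite /F' /top' eqxx; case bE : b => [y|]; last by rewrite /dl eqxx expr1n.
    by rewrite /dl neq ?tC ?bC // mulr0 add0r exprMn sqrrN sgR mul1r (br_flow_top br) // bC.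
  - move=> x z; rewrite in_setU1 => /orP[/eqP -> {x}|xC]; last first.
      by rewrite /F' neq // imgC // (br_flow_img br).
    rewrite /F' eqxx; case bE : b => [y|].
      rewrite img_lin imgC ?bC // (br_flow_img br) ?bC // img_dl stepa bE.
      rewrite rmorphD rmorphM /= !mulrz_nat.
      by rewrite (inj_eq (@Some_inj _)) (inj_eq (@Some_inj _)); ring.
    by rewrite img_dl stepa bE mulr0 add0r mulrz_nat (inj_eq (@Some_inj _)).
  - move=> x; rewrite in_setU1 => /orP[/eqP -> {x}|xC]; last first.
      by rewrite /F' neq // imgC // (br_flow_hub br).
    rewrite /F' eqxx; case bE : b => [y|].
      rewrite img_lin imgC ?bC // img_dl stepa bE mulr0 addr0 mulr0 add0r exprMn sqrrN sgR mul1r.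
      by rewrite (br_flow_hub br) // bC.
    by rewrite img_dl stepa bE eqxx mulr1 addr0.
exists top', F'; split=> // t; apply: (branch_small gr' br').
apply: leq_trans (_ : #|a |: branch C top t| <= _)%N.
  apply: subset_leq_card; apply/subsetP => x; rewrite !inE.
  have [//|xa] /= := eqVneq x a.
  by rewrite /top' (negbTE xa).
by rewrite cardsU1; apply: leq_trans (_ : (1 + J <= _)%N) => //; rewrite leq_add ?leq_b1.
Qed.

(** A vertex [s] left outside would have a vector of norm 2 on the coordinates of [C] and the hub.
    Subtracting the flows of these coordinates leaves a charge at the hub only, of square at most 4,
    while the value at [s] is 1. *)
Lemma branched_full C W top F : growing C W -> (forall v w, defect W v w = 0) ->
  branching C W top F -> (forall t, (#|branch C top t| <= J)%N) -> C = setT.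
Proof.
move=> gr d0 br small; apply/setP => s; rewrite inE; apply: contraT => sC.
pose X := [set x | W s (Some x) != 0]; pose S := [set k | W s k != 0].
have s2 : dot (W s) (W s) = 2 by have := d0 s s; rewrite /defect eqxx; lia.
have cS : (#|S| <= 2)%N by have := card_vec_supp (W s); rewrite s2 (ler_nat _ _ 2).
have cX : (#|X| <= 2)%N.
  apply: leq_trans cS; rewrite -(card_imset (mem X) (@Some_inj _)); apply: subset_leq_card.
  by apply/subsetP => _ /imsetP[x xX ->]; move: xX; rewrite !inE.
have XC x : x \in X -> x \in C.
  by rewrite inE; apply: contraR => xC; rewrite (gr_supp gr).
pose f v := 1 * dl R s v + (-1) * \sum_(x in X) (W s (Some x))%:~R * F x v.
pose U := (s |: C0) :|: \bigcup_(x in X) branch C top (top x).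
have sC0 : s \notin C0 by apply: contra sC; apply: (subsetP (br_sub br)).
have imgf k : img W f k = (W s k)%:~R - \sum_(x in X) (W s (Some x))%:~R * img W (F x) k.
  by rewrite /f img_lin img_dl img_sum; ring.
exfalso; apply: (@spread_absurd W C0 _ _ _ f U s).
- by move=> c /(br_star br)[].
- exact: subxx.
- by rewrite cardC0.
- by apply: subset_trans (subsetUr _ _) (subsetUl _ _).
- move=> v vU; rewrite /f big1 => [|x xX].
    rewrite mulr0 addr0 mul1r /dl; case: eqP => // vs.
    by rewrite vs !inE eqxx in vU.
  rewrite (br_flow (v := v) br (XC x xX)) ?mulr0 //.
  by apply: contra vU => vB; rewrite in_setU; apply/orP; right; apply/bigcupP; exists x.
- have c1 : (#|s |: C0| <= n.+2)%N by rewrite cardsU1 sC0 cardC0.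
  have c2 : (#|\bigcup_(x in X) branch C top (top x)| <= #|X| * J)%N.
    rewrite -sum_nat_const; elim/big_rec2: _ => [|x k A xX h]; first by rewrite cards0.
    by apply: leq_trans (leq_card_setU _ _) _; apply: leq_add.
  apply: leq_trans (leq_card_setU _ _) _; apply: leq_trans (leq_add c1 c2) _.
  apply: leq_trans (_ : (n.+2 + 2 * J <= _)%N); first by rewrite leq_add2l leq_mul2r cX orbT.
  lia.
- by move=> v w _ _; apply: d0.
- exact: sC0.
- rewrite /f big1 => [|x xX]; first by rewrite /dl eqxx mulr0 addr0 mulr1 expr1n.
  by rewrite (br_flow (v := s) br (XC x xX)) ?mulr0 // inE (negbTE sC).
- pose e k := if k is Some x then - img W (F x) None else 1.
  have fE : img W f None = \sum_(k in S) (W s k)%:~R * e k.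
    rewrite big_mkcond sum_option imgf /=; congr (_ + _).
      by rewrite inE; case: eqP => [->|_]; rewrite ?mulr1.
    rewrite -sumrN [LHS]big_mkcond; apply: eq_bigr => x _; rewrite !inE.
    by case: ifP => _; rewrite ?mulrN.
  have h := @sqr_sum_le R _ S (fun k => (W s k)%:~R * e k).
  rewrite fE; apply: le_trans h _.
  have -> : \sum_(k in S) ((W s k)%:~R * e k) ^+ 2 = 2.
    transitivity ((dot (W s) (W s))%:~R : R); last by rewrite s2.
    rewrite /dot rmorph_sum /= [LHS]big_mkcond; apply: eq_bigr => k _; rewrite inE.
    case: eqP => [->|/eqP k0] /=; first by rewrite mul0r.
    rewrite exprMn rmorphM -expr2; case: k k0 => [x|] k0 /=; last by rewrite expr1n mulr1.
    by rewrite sqrrN (br_flow_hub br) ?mulr1 // XC // inE.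
  have : #|S|%:R <= 2 :> R by rewrite (ler_nat R _ 2).
  lra.
rewrite big1 ?invr_ge0 ?ler0n // => y _; rewrite imgf.
rewrite (eq_bigr (fun x => (W s (Some x))%:~R * (y == x)%:R)) => [|x xX]; last first.
  by rewrite (br_flow_img br) // XC.
have [yX|yX] := boolP (y \in X).
  rewrite (bigD1 y) //= eqxx big1 => [|x /andP[_ xy]]; last by rewrite eq_sym (negbTE xy) mulr0.
  by rewrite mulr1 addr0 subrr expr0n.
rewrite big1 => [|x xX]; last by case: eqP => [yx|]; [rewrite yx xX in yX|rewrite mulr0].
by move: yX; rewrite inE negbK => /eqP ->; rewrite subr0 expr0n.
Qed.

Hypothesis gap : forall (H : sgraph) (r : H), (#|H| <= J)%N ->
  (forall f : H -> R, (1 - n%:R^-1) * f r ^+ 2 <= bq l f f) ->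
  forall f : H -> R, f r ^+ 2 <= bq l f f.

Section Full.
Variables (W : G -> vec G) (top : G -> G) (F : G -> G -> R).
Hypothesis d0 : forall v w, defect W v w = 0.
Hypothesis br : branching setT W top F.
Hypothesis small : forall t, (#|branch setT top t| <= J)%N.

Lemma bq_rep (f : G -> R) :
  bq l f f = img W f None ^+ 2 + \sum_y img W f (Some y) ^+ 2 - (2 - l) * \sum_v f v ^+ 2.
Proof.
have -> : bq l f f = \sum_k img W f k * img W f k + (l - 2) * \sum_v f v * f v.
  rewrite (bq_shift 2) (bq2_img W); congr (_ + _); rewrite [X in _ + X]big1 ?addr0 // => v _.
  by rewrite big1 // => w _; rewrite d0 mulr0.
rewrite sum_option.
have -> : \sum_v f v * f v = \sum_v f v ^+ 2 by [].
have -> : \sum_y img W f (Some y) * img W f (Some y) = \sum_y img W f (Some y) ^+ 2 by [].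
ring.
Qed.

Lemma img_branch (f : G -> R) t : (forall v, v \notin branch setT top t -> f v = 0) ->
  img W f None ^+ 2 <= f t ^+ 2 /\
  (top t = t -> img W f None ^+ 2 = f t ^+ 2) /\
  forall y, top y != t -> img W f (Some y) = 0.
Proof.
move=> hf.
have hN : img W f None = f t * (W t None)%:~R.
  rewrite /img (bigD1 t) //= big1 ?addr0 // => v vt.
  have [vB|vB] := boolP (v \in branch setT top t); last by rewrite hf // mul0r.
  have := br_hub br (in_setT v); move: vB; rewrite !inE => /eqP ->.
  by rewrite (negbTE vt) => /eqP; rewrite sqrf_eq0 => /eqP ->; rewrite mulr0.
have ht := br_hub br (in_setT t).
have hN2 : img W f None ^+ 2 = f t ^+ 2 * (t == top t)%:R.
  by rewrite hN exprMn -rmorphXn /= ht mulrz_nat.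
split; first by rewrite hN2; case: (t == top t); rewrite ?mulr1 ?mulr0 ?sqr_ge0.
split=> [tt|y yt]; first by rewrite hN2 tt eqxx mulr1.
rewrite /img big1 // => v _.
have [vB|vB] := boolP (v \in branch setT top t); last by rewrite hf // mul0r.
have [->|w0] := eqVneq (W v (Some y)) 0; first by rewrite mulr0.
have := br_supp br (in_setT v) w0; move: vB; rewrite !inE /= => /eqP -> e.
by rewrite e eqxx in yt.
Qed.

(** A function on one branch charges the hub only through its top. Spreading this charge over the
    clique vertices outside the branch gives the inequality up to the factor [1 - 1 / n], which
    [gap] removes. *)
Lemma branch_bound (f : G -> R) t : (forall v, v \notin branch setT top t -> f v = 0) ->
  f t ^+ 2 <= bq l f f.
Proof.
have [tt|tt] := eqVneq (top t) t; last first.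
  move=> hf; have f0 v : f v = 0.
    apply: hf; rewrite !inE; apply: contra_neqN tt => /eqP vt.
    by have [_] := br_top br (in_setT v); rewrite vt.
  by rewrite f0 expr0n /= bq_expand big1 // => v _; rewrite f0 mul0r.
move=> hf; set B := branch setT top t in hf *.
have inB v : (v \in B) = (top v == t) by rewrite /B !inE.
have tB : t \in B by rewrite inB tt.
have W_star c : c \in C0 -> W c =1 star_vec C0 c by move=> /(br_star br)[].
have [r rE] := in_inducedP tB.
have main : forall h : induced B -> R, h r ^+ 2 <= bq l h h.
  apply: gap => [|h]; first by rewrite card_induced small.
  set g := push (@in_induced G B) h.
  have gt : g t = h r by rewrite /g -rE (push_phi (@in_induced_inj G B)).
  rewrite -(bq_push (@in_induced_inj G B) (@in_induced_lab G B)) -/g -gt.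
  have hg v : v \notin B -> g v = 0.
    rewrite -(imset_induced B) => vB; apply: (push0 (U := setT)) vB => x.
    by rewrite inE.
  have [_ [/(_ tt) gN gy]] := img_branch hg.
  pose T := C0 :\ t; have cT : (n <= #|T|)%N := card_punctured t.
  have TB v : v \in T -> v \notin B.
    by move=> /setD1P[vt /(br_star br)[_ vv]]; rewrite inB vv.
  have A1 : T \subset B :|: C0 by apply: subset_trans (subsetDl _ _) (subsetUr _ _).
  have A2 v : v \notin B :|: C0 -> g v = 0 by rewrite in_setU negb_or => /andP[vB _]; apply: hg.
  have A3 : (#|B :|: C0| <= J + J + n + 3)%N.
    apply: leq_trans (leq_card_setU _ _) _; apply: leq_trans (leq_add (small t) (leqnn _)) _.
    by rewrite cardC0; lia.
  have := @spread_form W T W_star (subsetDl _ _) cT g (B :|: C0) A1 A2 A3 (fun v w _ _ => d0 v w).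
  set K := img W g None; have T0 := @T_gt0 T cT; have n0 := n_gt0.
  have e1 : \sum_y (img W g (Some y) + K / #|T|%:R * (y \in T)%:R) ^+ 2 =
      \sum_y img W g (Some y) ^+ 2 + K ^+ 2 / #|T|%:R.
    rewrite (eq_bigr (fun y => img W g (Some y) ^+ 2 + (K / #|T|%:R) ^+ 2 * (y \in T)%:R)).
      rewrite big_split /= -mulr_sumr -natr_sum -big_mkcond /= sum1_card; congr (_ + _).
      by field; exact: lt0r_neq0.
    move=> y _; have [yT|yT] := boolP (y \in T); last by rewrite !mulr0 !addr0.
    rewrite gy; first by rewrite [true%:R]mulr1n; ring.
    by move: (TB y yT); rewrite inB.
  have e2 : \sum_v g v ^+ 2 <= \sum_v spread W T g v ^+ 2.
    apply: ler_sum => v _; rewrite /spread -/K mul1r.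
    have [vT|vT] := boolP (v \in T); last by rewrite mulr0 addr0.
    by rewrite hg ?TB // expr0n /= sqr_ge0.
  have e3 : K ^+ 2 / #|T|%:R <= K ^+ 2 / n%:R.
    apply: ler_wpM2l; first exact: sqr_ge0.
    by rewrite lef_pV2 ?posrE // ler_nat.
  rewrite e1 => e4; rewrite bq_rep -gN -/K mulrBl mul1r [n%:R^-1 * _]mulrC.
  have hl := l2.
  have e5 : (2 - l) * \sum_v g v ^+ 2 <= (2 - l) * \sum_v spread W T g v ^+ 2.
    by apply: ler_wpM2l => //; rewrite subr_ge0 ltW.
  move: (le_trans e5 e4) e3; move: (K ^+ 2) (K ^+ 2 / n%:R) (K ^+ 2 / _) (\sum_y _) ((2 - l) * _).
  by move=> a b c d e; lra.
have fE : push (@in_induced G B) (fun y => f (in_induced y)) =1 f.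
  by apply: (push_comp (@in_induced_inj G B)) => x; rewrite imset_induced; apply: hf.
rewrite -(bq_ext l fE fE) (bq_push (@in_induced_inj G B) (@in_induced_lab G B)) -rE.
exact: main.
Qed.

(** By [branch_bound] each branch is nonnegative even without its hub term, so the sum is
    nonnegative although the charges of different branches may cancel at the hub. *)
Lemma full_psd : @psd R G l.
Proof.
move=> f; pose ft t v := f v * (top v == t)%:R.
have hft t v : v \notin branch setT top t -> ft t v = 0.
  by rewrite inE in_setT /= /ft => /negbTE ->; rewrite mulr0.
have imgt t y : img W (ft t) (Some y) = img W f (Some y) * (top y == t)%:R.
  have [yt|yt] := eqVneq (top y) t; last first.
    by rewrite mulr0; have [_ [_ ->]] := img_branch (hft t).
  rewrite mulr1; apply: eq_bigr => v _.
  have [->|w0] := eqVneq (W v (Some y)) 0; first by rewrite !mulr0.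
  have := br_supp br (in_setT v) w0; rewrite yt /ft => <-.
  by rewrite eqxx mulr1.
have one (c : R) v : \sum_t c * (top v == t)%:R = c.
  rewrite (bigD1 (top v)) //= eqxx mulr1 big1 ?addr0 // => t tv.
  by rewrite eq_sym (negbTE tv) mulr0.
have h1 : \sum_t (\sum_y img W (ft t) (Some y) ^+ 2 - (2 - l) * \sum_v ft t v ^+ 2) >= 0.
  apply: sumr_ge0 => t _; have := branch_bound (hft t); rewrite bq_rep.
  have [] := img_branch (hft t).
  move: (ft t t ^+ 2) (img W _ None ^+ 2) (\sum_y _) (_ * \sum_v _).
  by move=> a b c d; lra.
have sq (a : R) (b : bool) : (a * b%:R) ^+ 2 = a ^+ 2 * b%:R.
  by case: b; rewrite ?mulr1 ?mulr0 ?expr0n.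
have e1 : \sum_t \sum_y img W (ft t) (Some y) ^+ 2 = \sum_y img W f (Some y) ^+ 2.
  rewrite exchange_big; apply: eq_bigr => y _ /=.
  by under eq_bigr do rewrite imgt sq; rewrite one.
have e2 : \sum_t \sum_v ft t v ^+ 2 = \sum_v f v ^+ 2.
  rewrite exchange_big; apply: eq_bigr => y _ /=.
  by under eq_bigr do rewrite /ft sq; rewrite one.
move: h1; rewrite sumrB -mulr_sumr e1 e2 bq_rep => h1.
by have := sqr_ge0 (img W f None); move: h1; move: (img W f None ^+ 2) (\sum_y _) (_ * \sum_v _) => a b c; lra.
Qed.
End Full.

Hypothesis large : (n + 2 < #|G|)%N.

Theorem large_star_psd : (45 <= n)%N -> connected G -> @psd R G 2 -> @psd R G l.
Proof.
move=> n45 conn psd2.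
have C45 : (45 <= #|C0|)%N by rewrite cardC0; apply: leqW.
have proper (U : {set G}) : U != setT -> psd_on (2 : R) U by move=> _ f _; apply: psd2.
have room : (#|C0|.+1 < #|G|)%N by rewrite cardC0 -addn2.
have big : (16 <= #|C0|)%N by apply: leq_trans C45.
have [C [W [gr [top [F [br small]]] d0]]] := base_grow (star_base R clique C45) proper room big
  (Q := branched) branched_init branched_step conn.
have CT := branched_full gr d0 br small; rewrite CT in br small.
exact: full_psd d0 br small.
Qed.
End Branching.

(** * From local to global positivity *)

(** The signed sum of all path vectors telescopes to a vector of squared length 2, while its
    coefficients have squared length [M]; the form takes the value [2 - (2 - l) * M]. *)
Lemma induced_path_psd (R : realType) (l : R) (G : sgraph) (p : nat -> G) (M : nat) :
  induced_path p M -> (80 <= M)%N -> 2 < (2 - l) * M%:R -> ~ psd_on l (path_set p M).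
Proof.
move=> [padj psep pinj] M80 hM.
have bs : base R (path_set p M) (path_vec p M) by apply: (@path_base _ _ _ _ 40).
pose sg (i : nat) : R := (path_sign p i)%:~R.
have sg2 (i : 'I_M) : sg i * sg i = 1.
  by rewrite -intrM -expr2 (path_sign2 padj).
pose f v := \sum_(i < M) sg i * dl R (p i.+1) v.
have f0 v : v \notin path_set p M -> f v = 0.
  move=> vn; rewrite /f big1 // => i _; rewrite /dl; case: eqP => [vp|]; last by rewrite mulr0.
  by case/negP: vn; apply/path_setP; exists i.
have fp (i : 'I_M) : f (p i.+1) = sg i.
  rewrite /f (bigD1 i) //= {1}/dl eqxx mulr1 big1 ?addr0 // => j ji.
  rewrite /dl; case: eqP => [pp|]; last by rewrite mulr0.
  by case/eqP: ji; apply/val_inj/succn_inj/esym/pinj => //=.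
have ff : \sum_v f v * f v = M%:R.
  transitivity (\sum_v \sum_(i < M) dl R (p i.+1) v * (sg i * f v)).
    by apply: eq_bigr => v _; rewrite mulr_suml; apply: eq_bigr => i _; ring.
  rewrite exchange_big /= (eq_bigr (fun=> 1)) => [|i _]; last by rewrite sum_dl fp sg2.
  by rewrite sumr_const card_ord.
have M0 : (0 < M)%N by apply: leq_trans M80.
have imgf k : img (path_vec p M) f k = (k == path_coord p M)%:R - (k == None)%:R.
  rewrite img_sum; pose F i : R := (k == path_coord p i)%:R.
  transitivity (\sum_(i < M) (F i.+1 - F i)); last first.
    by rewrite -(big_mkord xpredT (fun i => F i.+1 - F i)) telescope_sumr.
  apply: eq_bigr => i _; rewrite img_dl (path_vecE pinj) // intrM intrB !mulrz_nat mulrA.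
  by rewrite sg2 mul1r.
have img2 : \sum_k img (path_vec p M) f k * img (path_vec p M) f k = 2.
  have cE : path_coord p M = Some (p M) by case: (M) M0.
  rewrite sum_option !imgf cE (eq_bigr (fun y => dl R (p M) y * 1)) => [|y _].
    by rewrite sum_dl /= sub0r mulrNN mulr1.
  by rewrite imgf cE /= subr0 mulr1 /dl (inj_eq (@Some_inj _)); case: (y == _); rewrite ?mulr1 ?mulr0.
move=> /(_ f f0); rewrite (bq_shift 2) (bq2_img (path_vec p M)) img2 ff [X in _ + X + _]big1.
  by rewrite addr0 => h; lra.
move=> v _; rewrite big1 // => w _.
have [vC|vC] := boolP (v \in path_set p M); last by rewrite f0 // !mul0r.
have [wC|wC] := boolP (w \in path_set p M); last by rewrite (f0 w) // mulr0 mul0r.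
by rewrite /defect (base_dot bs) // subrr mulr0.
Qed.

Theorem critical_below2_bounded (R : realType) (l : R) : l < 2 ->
  exists N, forall G : sgraph, critical l G -> (#|G| <= N)%N.
Proof.
move=> l2; have e0 : 0 < 2 - l by rewrite subr_gt0.
have big (a : R) : exists k : nat, forall m : nat, (k <= m)%N -> a < (2 - l) * m%:R.
  have [k hk] := inv_small a e0; exists k.+1 => m km.
  move: hk; rewrite ltr_pdivrMr ?ltr0n // => hk; apply: lt_le_trans hk _.
  by rewrite ler_pM2l // ler_nat.
have [N2 hN2] := critical2_bounded R.
have [J0 hJ0] := big 8; pose J := J0.+1; have [n1 hn1] := big 16; have [M1 hM1] := big 2.
have [n0 hn0] := rooted_gap l J.
pose n := maxn 45 (maxn n0.+1 n1); pose M := maxn 80 M1.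
have [n45 nn0 nn1] : [/\ (45 <= n)%N, (n0.+1 <= n)%N & (n1 <= n)%N].
  by rewrite /n; split; rewrite !leq_max leqnn ?orbT.
have [|N hN] := @clique_or_path n.+1 M; first by rewrite /M leq_max.
exists (maxn N2 (maxn N (maxn (J + J + n + 3) (maxn M 6)))) => G crit; rewrite leqNgt; apply/negP.
rewrite !gtn_max => /and5P[b2 bN bJ bM b6].
have [nG proper] := crit; have conn := critical_connected crit.
have psd2 : @psd R G 2.
  apply: contrapT => n2; move: b2; rewrite ltnNge => /negP; apply; apply: hN2.
  by split=> // U /proper; apply: psd_on_mono; exact: ltW.
have [||[A [cA hA]]|[p path]] := hN R l G _ conn _ bN.
- by lra.
- exact: critical_loc crit b6.
- apply: nG; apply: (@large_star_psd R G l J n A) => //.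
  + by apply: hJ0; exact: leqW (leqnSn J0).
  + exact: hn1.
  + exact: critical_loc crit bJ.
  + move=> H r cH hH; apply: hn0 => // f; apply: le_trans (hH f).
    apply: ler_wpM2r; first exact: sqr_ge0.
    by rewrite lerB // lef_pV2 ?posrE ?ltr0n ?(leq_trans _ n45) // ler_nat.
  by apply: leq_ltn_trans bJ; rewrite -[(_ + 3)%N]addnA; apply: leq_trans (leq_addl _ _); rewrite leq_add2l.
have [_ _ pinj] := path.
apply: (@induced_path_psd R l G p M path).
- by rewrite /M leq_max leqnn.
- by apply: hM1; rewrite /M leq_max leqnn orbT.
have locM : loc_psd l M G by apply: critical_loc crit _; rewrite gtn_max.
by apply: locM; rewrite (card_path_set pinj).
Qed.

Lemma threshold_interpolation (R : realType) (s l : R) : 1 < s -> s ^+ 6 = s ^+ 2 + 1 ->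
  l < s + s^-1 -> l < 11 / 5 /\ exists t, [/\ 1 < t, t ^+ 6 < t ^+ 2 + 1 & l < t + t^-1].
Proof.
move=> s1 hs hl; split.
  have s65 : s < 6 / 5 by rewrite sextic_lt // hs.
  by have : s^-1 <= 1 by [rewrite invf_le1 ?ltW // (lt_trans _ s1)]; lra.
pose d := Num.min (s - 1) (s + s^-1 - l) / 2.
have [d0 d1 d2] : [/\ 0 < d, d < s - 1 & d < s + s^-1 - l].
  have h1 : 0 < s - 1 by lra.
  have h2 : 0 < s + s^-1 - l by lra.
  rewrite /d; case: (leP (s - 1) (s + s^-1 - l)) => h; split; lra.
have t1 : 1 < s - d by lra.
exists (s - d); split=> //.
  have ts : s - d < s by lra.
  move: (s - d) t1 ts => t t1 ts.
  have h2 : t ^+ 2 < s ^+ 2 by rewrite !expr2; nra.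
  have e6 (x : R) : x ^+ 6 = x ^+ 2 * x ^+ 2 * x ^+ 2 by rewrite -!exprD.
  have t2 : 1 < t ^+ 2 by rewrite expr2; nra.
  move: hs; rewrite !e6; move: (t ^+ 2) (s ^+ 2) h2 t2 => x y h2 t2 hs.
  have : x * x < y * y by nra.
  by nra.
have : s^-1 <= (s - d)^-1 by rewrite lef_pV2 ?posrE; lra.
by lra.
Qed.

(** For [l >= 2], a large graph critical for [l] would already be positive for 2: a critical
    subgraph for 2 has at most [h] vertices, and the tails make sets of that size positive. *)
Theorem local_to_global (R : realType) (s l : R) : 1 < s -> s ^+ 6 = s ^+ 2 + 1 ->
  l < s + s^-1 -> exists N, forall G : sgraph, loc_psd l N G -> @psd R G l.
Proof.
move=> s1 hs hl; have [l115 [t [t1 ht lt_]]] := threshold_interpolation s1 hs hl.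
have loc_full N (H : sgraph) : (#|H| <= N)%N -> loc_psd l N H -> @psd R H l.
  by move=> cH loc; apply/psd_onT; apply: loc; rewrite cardsT.
have [l2|l2] := ltP l 2.
  have [N hN] := critical_below2_bounded l2; exists N => G loc; apply: contrapT.
  case/critical_exists => H [HG crit]; have [nH _] := crit; apply: nH.
  exact: loc_full (hN H crit) (loc_psd_induced HG loc).
have [h hh] := critical2_bounded R.
have [N [M hNM]] := exists_tail_psd2 t1 ht lt_ h l115.
exists (maxn N M) => G loc; apply: contrapT.
case/critical_exists => H [HG crit]; have [nH _] := crit; apply: nH.
have {HG}locH := loc_psd_induced HG loc.
have [small|large] := leqP #|H| M.
  by apply: loc_full locH; apply: leq_trans small (leq_maxr _ _).
apply: psd_mono l2 _; apply: contrapT => /critical_exists[K [KH critK]].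
have [nK _] := critK; apply: nK; have [phi [inj lab_phi]] := KH.
apply/psd_onT/(psd_on_push inj lab_phi).
apply: (hNM H (critical_connected crit) _ large).
  by move=> U cU; apply: locH; apply: leq_trans cU (leq_maxl _ _).
by rewrite card_imset // cardsT; apply: hh.
Qed.

Lemma psd_sg_induced (R : realType) (l : R) (H G : sgraph) : sg_induced H G -> @psd R G l -> @psd R H l.
Proof. by move=> [phi [inj hl]] h f; rewrite -(bq_push inj hl); apply: h. Qed.

Lemma finite_of_local (R : realType) (l : R) (N : nat) :
  (forall G : sgraph, loc_psd l N G -> @psd R G l) ->
  has_finite_forbidden_characterization (smallest_eigenvalue_family l).
Proof.
move=> loc; exists (fun H : sgraph => (#|H| <= N)%N /\ ~ @psd R H l); split.
  have [K [Gs hGs]] := finite_types N; exists K, Gs => H [cH _]; exact: hGs.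
move=> G; rewrite family_psd; split=> [pG [H [[_ nH] HG]]|none].
  by apply: nH; apply: psd_sg_induced HG pG.
apply: loc => U cU; apply: contrapT => nU; apply: none.
exists (induced U); split; last exact: sg_induced_induced.
by rewrite card_induced; split=> // /psd_induced.
Qed.

(** A member of [F] found inside the bad graph is small, so local positivity makes it positive; but
    it contains itself and is therefore excluded from the family. *)
Lemma not_finite_of_bad (R : realType) (l : R) : locally_psd_not_psd l ->
  ~ has_finite_forbidden_characterization (smallest_eigenvalue_family l).
Proof.
move=> bad [F [[k [K hK]] forb]].
have [G [nG hG]] := bad (\max_i #|K i|)%N.
have [H [FH HG]] : exists H, F H /\ sg_induced H G.
  by apply: contrapT => none; apply: nG; apply/family_psd/forb.
have nH : ~ @psd R H l.
  move/family_psd/forb; apply; exists H; split=> //; exists id; split=> //; exact: inj_id.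
apply: nH => f; have [phi [inj hphi]] := HG; rewrite -(bq_push inj hphi); apply: hG.
have [i [psi [bij _]]] := hK H FH.
have cH : #|H| = #|K i| by apply: bij_eq_card bij.
apply: leq_trans (leq_bigmax i); rewrite -cH -cardsT -(card_imset _ inj).
apply: subset_leq_card; apply/subsetP => x; rewrite inE; apply: contraNT => xn.
by apply/eqP; apply: (push0 (U := setT)) xn => y; rewrite inE.
Qed.

Theorem theorem1p5 (R : realType) (rho : R) (hrho : rho ^+ 3 = rho + 1)
    (lambda : R) :
  has_finite_forbidden_characterization (smallest_eigenvalue_family lambda)
  <-> lambda < Num.sqrt rho + (Num.sqrt rho)^-1.
Proof.
have rho1 : 1 < rho.
  rewrite ltNge; apply/negP => h; have : rho * (rho ^+ 2 - 1) = 1.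
    by rewrite mulrBr -exprS hrho; ring.
  by rewrite expr2; have := sqr_ge0 (rho + 1); nra.
set s := Num.sqrt rho; have s2 : s ^+ 2 = rho by rewrite sqr_sqrtr //; lra.
have s0 : 0 <= s by apply: sqrtr_ge0.
have s1 : 1 < s by move: s2; rewrite expr2; nra.
have s6 : s ^+ 6 = s ^+ 2 + 1 by rewrite (exprM s 2 3) s2.
split=> [fin|lt_]; last by have [N /finite_of_local] := local_to_global s1 s6 lt_.
rewrite ltNge; apply/negP => ge; exact: not_finite_of_bad (bad_above s1 s6 ge) fin.
Qed.
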